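(* Let $G=(V,F)$ be a $5$-connected graph on $n$ vertices, with $V$ identified with $V(K_n)$. Suppose $F$ is a cyclic set of the generic $C_2^1$-cofactor matroid $\mathcal{C}^1_{2,n}$. Then $G$ is $C_2^1$-rigid, i.e. $F$ spans $\mathcal{C}^1_{2,n}$.
   Context: A graph is $k$-connected if it has at least $k+1$ vertices and remains connected after deleting any fewer than $k$ vertices. A set is cyclic if it is a union of circuits. $\mathcal{C}^1_{2,n}$ is defined as follows. Take vertices $v_1,\dots,v_n$ of $K_n$ and points $p(v_i)=(x_i,y_i)\in\mathbb{R}^2$ with algebraically independent coordinates over $\mathbb{Q}$. It is the row matroid of the $|E(K_n)|\times 3n$ matrix with three columns per vertex. The row of edge $v_iv_j$ with $i<j$ has $D_{ij}=((x_i-x_j)^2,(x_i-x_j)(y_i-y_j),(y_i-y_j)^2)$ in the columns of $v_i$, $-D_{ij}$ in the columns of $v_j$, and zeros elsewhere. *)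

(* Defs.v *)
From HB Require Import structures.
From mathcomp Require Import all_boot all_order all_algebra.
From mathcomp Require Import mpoly.
Set Implicit Arguments. Unset Strict Implicit. Unset Printing Implicit Defensive.
Import Order.TTheory GRing.Theory Num.Theory.
Local Open Scope ring_scope.

Definition edgeKn (n : nat) (e : 'I_n * 'I_n) : bool := (e.1 < e.2)%N.
Definition EKn (n : nat) : {set 'I_n * 'I_n} := [set e | edgeKn e].

Definition coords (R : nzRingType) (n : nat) (x y : 'I_n -> R) : 'I_(n + n) -> R :=
  fun k => match split k with inl i => x i | inr i => y i end.

Definition alg_indep_Q (R : numFieldType) (k : nat) (w : 'I_k -> R) : Prop :=
  forall q : {mpoly rat[k]}, q != 0 -> (map_mpoly (@ratr R) q).@[w] != 0.

Definition Dvec (R : nzRingType) (n : nat) (x y : 'I_n -> R) (i j : 'I_n) (k : 'I_3) : R :=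
  let a := x i - x j in let b := y i - y j in
  if k == 0 then a ^+ 2 else if k == 1 then a * b else b ^+ 2.

Definition cof_row (R : nzRingType) (n : nat) (x y : 'I_n -> R) (e : 'I_n * 'I_n)
  : 'rV[R]_(n * 3) :=
  mxvec (\matrix_(v < n, k < 3)
    (if v == e.1 then Dvec x y e.1 e.2 k
     else if v == e.2 then - Dvec x y e.1 e.2 k else 0)).

Definition cof_rank (R : fieldType) (n : nat) (x y : 'I_n -> R)
  (S : {set 'I_n * 'I_n}) : nat :=
  \rank (\sum_(e in S) <<cof_row x y e>>)%MS.

Definition cof_indep (R : fieldType) (n : nat) (x y : 'I_n -> R)
  (S : {set 'I_n * 'I_n}) : Prop :=
  S \subset EKn n /\ cof_rank x y S = #|S|.

Definition cof_circuit (R : fieldType) (n : nat) (x y : 'I_n -> R)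
  (C : {set 'I_n * 'I_n}) : Prop :=
  C \subset EKn n /\ ~ cof_indep x y C /\
  (forall C' : {set 'I_n * 'I_n}, C' \proper C -> cof_indep x y C').

Definition cof_cyclic (R : fieldType) (n : nat) (x y : 'I_n -> R)
  (F : {set 'I_n * 'I_n}) : Prop :=
  exists P : {set {set 'I_n * 'I_n}},
    (forall C, C \in P -> cof_circuit x y C) /\ \bigcup_(C in P) C = F.

Definition cof_spans (R : fieldType) (n : nat) (x y : 'I_n -> R)
  (F : {set 'I_n * 'I_n}) : Prop :=
  cof_rank x y F = cof_rank x y (EKn n).

Definition adj (n : nat) (F : {set 'I_n * 'I_n}) (u v : 'I_n) : bool :=
  ((u, v) \in F) || ((v, u) \in F).

Definition connected_minus (n : nat) (F : {set 'I_n * 'I_n}) (S : {set 'I_n}) : Prop :=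
  forall u v, u \notin S -> v \notin S ->
    connect (fun a b => [&& a \notin S, b \notin S & adj F a b]) u v.

Definition k_connected (k n : nat) (F : {set 'I_n * 'I_n}) : Prop :=
  (k + 1 <= n)%N /\ forall S : {set 'I_n}, (#|S| < k)%N -> connected_minus F S.

(* Main.v *)
Require Import Defs.
From HB Require Import structures.
From mathcomp Require Import all_boot all_order all_algebra.
From mathcomp Require Import mpoly.
From mathcomp Require Import ring lra zify.
Set Implicit Arguments. Unset Strict Implicit. Unset Printing Implicit Defensive.
Import Order.TTheory GRing.Theory Num.Theory.
Local Open Scope ring_scope.

(** The pivot is a description of all linear relations among rows: inside a closed edge set
they are generated by the relations of its [K5]s.  It is proved by deleting a vertex [v] of
degree 4 or 5, which exists by sparsity.  Since the coordinates are generic, moving [v] cannot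
raise the rank, so for every new position the star at [v] loads its set [T] of neighbours
within few dimensions.  Positions of [v] on lines through pairs of [T], midpoints, and the
original position classify these loads: either all pairs of [T] are in the closure of the
remaining edges up to one dimension, or a vector [X_ab - X_cd] is in their span for disjoint
pairs [ab], [cd], where [X_ab] is the row of [ab] scaled by its coefficient in the [K5] relation
on [T].  The second case is excluded because [X_ab - X_cd] cannot lie in a span of rows without
the row of [ab] doing so, which is shown by the same deletion argument.

Given this, let [P] be the set of maximal cliques, with at least 5 vertices, of the closure of
[F].  Every edge of the cyclic set [F] lies in one of them, two of them share at most 2 vertices,
and the dimension count for relations gives [sum_X (3|X| - 6) - sum_e (d_e - 1) <= 3n - 6], where
[d_e] and [d_v] count the cliques containing the edge [e] and the vertex [v].  The same count for
the cliques through [v] gives [2 sum_{e at v} (d_e - 1) <= 3 d_v - 3].  If no clique is everything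
then 5-connectivity puts at least 5 vertices with [d_v >= 2] in each, and summing over the
vertices contradicts the first inequality. *)

(** * Polynomial functions of a generic placement *)

(** The obstacle is that deleting [v] from a relation leaves the given edge set: the part of the
    relation at [v] is balanced there, hence a combination of [K5]s on [v] and four neighbours, but
    these [K5]s bring in pairs of neighbours that must be shown to lie in the closed set. The moving
    stars serve this purpose. Their tests are local and not sufficient: they do not exclude the
    pattern in which one neighbour is idle and opposite pairs of the other four have equal scaled
    rows ([quadrangle] with [t = 1]). Hence the separate induction over whole edge sets. The degrees
    4 and 5 come from the rank [3n - 6], which keeps the average degree below 6, and from the
    independence of up to three squared directions at [v], by which a vertex of degree at most 3
    carries no part of a relation. Two maximal cliques cannot share three vertices, because three
    edges from a vertex to a clique already supply all the rank that a new vertex can add. *)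

Definition polyfun (R : realFieldType) (k : nat) (f : ('I_k -> R) -> R) : Prop :=
  exists q : {mpoly rat[k]}, forall w, f w = (map_mpoly (@ratr R) q).@[w].

Section Polyfun.
Variables (R : realFieldType) (k : nat).
Implicit Types f g : ('I_k -> R) -> R.

Lemma polyfun_coord i : polyfun (fun w : 'I_k -> R => w i).
Proof. by exists 'X_i => w; rewrite map_mpolyX mevalXU. Qed.

Lemma polyfun_const (c : rat) : polyfun (fun _ : 'I_k -> R => ratr c).
Proof. by exists c%:MP => w; rewrite map_mpolyC ?raddf0 // mevalC. Qed.

Lemma polyfun0 : polyfun (fun _ : 'I_k -> R => 0).
Proof. by exists 0 => w; rewrite !rmorph0. Qed.

Lemma polyfunD f g : polyfun f -> polyfun g -> polyfun (fun w => f w + g w).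
Proof. by case=> p fp [q gq]; exists (p + q) => w; rewrite !rmorphD fp gq. Qed.

Lemma polyfunN f : polyfun f -> polyfun (fun w => - f w).
Proof. by case=> p fp; exists (- p) => w; rewrite !rmorphN fp. Qed.

Lemma polyfunB f g : polyfun f -> polyfun g -> polyfun (fun w => f w - g w).
Proof. by move=> pf pg; apply/polyfunD/polyfunN. Qed.

Lemma polyfunM f g : polyfun f -> polyfun g -> polyfun (fun w => f w * g w).
Proof. by case=> p fp [q gq]; exists (p * q) => w; rewrite !rmorphM fp gq. Qed.

Lemma polyfun_det m (A : ('I_k -> R) -> 'M[R]_m) :
  (forall i j, polyfun (fun w => A w i j)) -> polyfun (fun w => \det (A w)).
Proof.
move=> pA.
have /fin_all_exists[q qE] (ij : 'I_m * 'I_m) := pA ij.1 ij.2.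
exists (\det (\matrix_(i, j) q (i, j))) => w.
pose phi : {rmorphism {mpoly rat[k]} -> R} := meval w \o map_mpoly (@ratr R).
rewrite -[RHS]/(phi _) -det_map_mx; congr (\det _).
by apply/matrixP => i j; rewrite !mxE /= -(qE (i, j)).
Qed.

(** The test placement [w'] may be degenerate: nondegeneracy of the generic [w] is later certified
    by coordinates 0 and 1, or by letting two points coincide. *)
Lemma generic_neq0 f (w w' : 'I_k -> R) :
  alg_indep_Q w -> polyfun f -> f w' != 0 -> f w != 0.
Proof.
move=> gw [q fq]; rewrite !fq => q'; apply: gw.
by apply: contra_neq q' => ->; rewrite !rmorph0.
Qed.

(** A nonzero minor of [A w'] is a rational polynomial in the placement that does not vanish
    identically, so the same minor is nonzero at the generic [w]. *)
Lemma generic_rank_ge m N (A : ('I_k -> R) -> 'M[R]_(m, N)) (w w' : 'I_k -> R) :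
  alg_indep_Q w -> (forall i j, polyfun (fun w => A w i j)) ->
  (\rank (A w') <= \rank (A w))%N.
Proof.
move=> gw pA; pose f := maxrankfun (A w').
have full : row_full (rowsub f (A w'))^T.
  by rewrite /row_full mxrank_tr; apply: maxrowsub_free.
pose g := fullrankfun full.
have detg v : \det (rowsub g (rowsub f (A v))^T) = \det (mxsub f g (A v)).
  by rewrite -det_tr; congr (\det _); apply/matrixP=> i j; rewrite !mxE.
have: \det (mxsub f g (A w')) != 0.
  by rewrite -detg -unitfE -unitmxE; apply: fullrowsub_unit.
move/(generic_neq0 (f := fun v => \det (mxsub f g (A v))) gw) => /= det0.
have {}det0: \det (mxsub f g (A w)) != 0.
  by apply: det0; apply: polyfun_det => i j; have := pA (f i) (g j); case=> q qE; exists q => v; rewrite -qE mxE.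
have /eqP <- : row_free (mxsub f g (A w)) by rewrite row_free_unit unitmxE unitfE.
rewrite (_ : mxsub f g (A w) = rowsub f 1%:M *m A w *m colsub g 1%:M).
  by apply: leq_trans (mxrankM_maxl _ _) (mxrankM_maxr _ _).
by apply/matrixP=> i j; rewrite -mulmxA mul_rowsub_mx mul1mx mulmx_colsub mulmx1 !mxE.
Qed.

Lemma generic_rank_span_ge (I : finType) (P : {pred I}) N (r : ('I_k -> R) -> I -> 'rV[R]_N)
    (w w' : 'I_k -> R) :
  alg_indep_Q w -> (forall i j, polyfun (fun w => r w i 0 j)) ->
  (\rank (\sum_(i in P) <<r w' i>>) <= \rank (\sum_(i in P) <<r w i>>))%N.
Proof.
move=> gw pr.
pose A v := \matrix_(i < #|P|) r v (enum_val i).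
have AE v : (A v :=: \sum_(i in P) <<r v i>>)%MS.
  apply/eqmxP/andP; split.
    by apply/row_subP => i; rewrite rowK; apply: (sumsmx_sup (enum_val i)); rewrite ?enum_valP ?genmxE.
  apply/sumsmx_subP => i Pi; rewrite genmxE.
  by have := row_sub (enum_rank_in Pi i) (A v); rewrite rowK enum_rankK_in.
rewrite -!AE; apply: generic_rank_ge => // i j.
by have [q qE] := pr (enum_val i) j; exists q => v; rewrite -qE mxE.
Qed.

End Polyfun.

(** * Rows of the cofactor matrix *)

Section Rows.
Variables (R : realFieldType) (n : nat).
Implicit Types (w : 'I_(n + n) -> R) (i j k l m v : 'I_n).

Definition px w i : R := w (lshift n i).
Definition py w i : R := w (rshift n i).

Definition move_vertex w v (a b : R) : 'I_(n + n) -> R :=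
  fun t => if t == lshift n v then a else if t == rshift n v then b else w t.

(** Twice the signed area of the triangle [ijk]. *)
Definition br w i j k : R :=
  (px w j - px w i) * (py w k - py w i) - (px w k - px w i) * (py w j - py w i).

Definition dv w i j : 'rV[R]_3 := \row_k Dvec (px w) (py w) i j k.

(** Defined for all ordered pairs, so that it is antisymmetric ([erN]). *)
Definition erow w i j : 'rV[R]_(n * 3) := cof_row (px w) (py w) (i, j).

(** Multiplication by [blk v] reads the three coordinates at [v], called the load at [v] below. As a
    matrix it has a kernel [kermx (blk v)], the space of vectors without load at [v]. *)
Definition blk v : 'M[R]_(n * 3, 3) := lin1_mx (row v \o vec_mx).

Lemma px_mv w v a b i : px (move_vertex w v a b) i = if i == v then a else px w i.
Proof. by rewrite /px /move_vertex (inj_eq (@lshift_inj _ _)) eq_lrshift. Qed.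

Lemma py_mv w v a b i : py (move_vertex w v a b) i = if i == v then b else py w i.
Proof. by rewrite /py /move_vertex eq_rlshift (inj_eq (@rshift_inj _ _)). Qed.

Lemma er_blk w i j v :
  erow w i j *m blk v = if v == i then dv w i j else if v == j then - dv w i j else 0.
Proof.
rewrite mul_rV_lin1 /= /erow /cof_row mxvecK; apply/rowP => k; rewrite !mxE /=.
by case: ifP => _; [|case: ifP => _]; rewrite !mxE.
Qed.

Lemma blk_inj (u : 'rV[R]_(n * 3)) : (forall v, u *m blk v = 0) -> u = 0.
Proof.
move=> u0; apply: (can_inj vec_mxK); rewrite linear0; apply/row_matrixP => v.
by have := u0 v; rewrite mul_rV_lin1 /= => ->; rewrite row0.
Qed.

Lemma dvC w i j : dv w j i = dv w i j.
Proof.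
apply/rowP => k; rewrite !mxE /Dvec -(opprB (px w j)) -(opprB (py w j)).
by rewrite !sqrrN mulrNN.
Qed.

Lemma dvii w i : dv w i i = 0.
Proof. by apply/rowP => k; rewrite !mxE /Dvec !subrr expr0n mul0r !if_same. Qed.

Lemma erN w i j : erow w j i = - erow w i j.
Proof.
apply/eqP; rewrite -subr_eq0 opprK; apply/eqP/blk_inj => v.
rewrite mulmxDl !er_blk dvC; case: (eqVneq v i) => [->|_].
  by case: (eqVneq i j) => [->|_]; rewrite ?dvii ?addNr ?addr0.
by case: ifP => _; rewrite ?addr0 ?subrr.
Qed.

Lemma erii w i : erow w i i = 0.
Proof.
by apply/blk_inj => v; rewrite er_blk dvii oppr0 !if_same.
Qed.

Lemma br_cyc w i j k : br w j k i = br w i j k.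
Proof. by rewrite /br; ring. Qed.

Lemma br_swap w i j k : br w j i k = - br w i j k.
Proof. by rewrite /br; ring. Qed.

Lemma br_swapr w i j k : br w i k j = - br w i j k.
Proof. by rewrite /br; ring. Qed.

Lemma br_mv w v a b i j k :
  i != v -> j != v -> k != v -> br (move_vertex w v a b) i j k = br w i j k.
Proof. by move=> /negPf iv /negPf jv /negPf kv; rewrite /br !px_mv !py_mv iv jv kv. Qed.

Lemma dv_mv w v a b i j : i != v -> j != v -> dv (move_vertex w v a b) i j = dv w i j.
Proof.
move=> /negPf iv /negPf jv; apply/rowP => k.
by rewrite !mxE /Dvec !px_mv !py_mv iv jv.
Qed.

Lemma er_mv w v a b i j : i != v -> j != v -> erow (move_vertex w v a b) i j = erow w i j.
Proof.
move=> iv jv; apply/eqP; rewrite -subr_eq0; apply/eqP/blk_inj => u.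
by rewrite mulmxBl !er_blk dv_mv // subrr.
Qed.

Definition genpos w (s : seq 'I_n) : Prop :=
  forall i j k, i \in s -> j \in s -> k \in s -> uniq [:: i; j; k] -> br w i j k != 0.

Lemma sub_genpos w (s t : seq 'I_n) : {subset s <= t} -> genpos w t -> genpos w s.
Proof. by move=> st gt i j k /st ti /st tj /st tk; apply: gt. Qed.

(** Lagrange interpolation: over four directions [p_i], a binary quadratic form [q] satisfies [sum_i
    q(p_i) / prod_(j != i) [p_i p_j] = 0], and [dv] lists the values of the monomials of degree
    2. *)
Lemma dv_lagrange w v i j k l : uniq [:: v; i; j; k; l] -> genpos w [:: v; i; j; k; l] ->
  (br w v i j * br w v i k * br w v i l)^-1 *: dv w v i
  + (br w v j i * br w v j k * br w v j l)^-1 *: dv w v j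
  + (br w v k i * br w v k j * br w v k l)^-1 *: dv w v k
  + (br w v l i * br w v l j * br w v l k)^-1 *: dv w v l = 0.
Proof.
move=> U G.
have nz a b : a \in [:: i; j; k; l] -> b \in [:: i; j; k; l] -> a != b -> br w v a b != 0.
  move=> ai bi ab; have /andP[vN _] := U.
  apply: G; rewrite ?mem_head //; first by rewrite in_cons ai orbT.
    by rewrite in_cons bi orbT.
  rewrite /= !inE ab !andbT negb_or.
  by apply/andP; split; apply: contraNneq vN => ->.
have {}U : uniq [:: i; j; k; l] by case/andP: U.
move: U; rewrite /= !inE !negb_or => /and4P[/and3P[ij ik il] /andP[jk jl] kl _].
have nij := nz i j; have nik := nz i k; have nil := nz i l.
have njk := nz j k; have njl := nz j l; have nkl := nz k l.
rewrite !inE !eqxx ?orbT /= in nij nik nil njk njl nkl.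
move: {nij nik nil njk njl nkl} (nij isT isT ij) (nik isT isT ik) (nil isT isT il)
  (njk isT isT jk) (njl isT isT jl) (nkl isT isT kl).
rewrite (br_swapr w v j i) (br_swapr w v k i) (br_swapr w v k j).
rewrite (br_swapr w v l i) (br_swapr w v l j) (br_swapr w v l k).
move=> nij nik nil njk njl nkl.
apply/rowP => c; rewrite !mxE /Dvec.
set xi := px w v - px w i; set xj := px w v - px w j; set xk := px w v - px w k; set xl := px w v - px w l.
set yi := py w v - py w i; set yj := py w v - py w j; set yk := py w v - py w k; set yl := py w v - py w l.
have brE a b : br w v a b = (px w v - px w a) * (py w v - py w b) - (px w v - px w b) * (py w v - py w a).
  by rewrite /br; ring.
move: nij nik nil njk njl nkl; rewrite !brE -/xi -/xj -/xk -/xl -/yi -/yj -/yk -/yl !oppr_eq0.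
move: xi xj xk xl yi yj yk yl => xi xj xk xl yi yj yk yl nij nik nil njk njl nkl.
by case: c => [[|[|[|//]]] cE] /=; field; rewrite nij nik nil njk njl nkl.
Qed.

(** The coefficient of the edge [ij] in the relation of the [K5] on [i, j, k, l, m]. Seen from [i]
    it is the Lagrange weight of the direction to [j]; it is antisymmetric in [i, j] like [erow], so
    their product does not depend on the orientation. *)
Definition kap w i j k l m : R := (br w i j k * br w i j l * br w i j m)^-1.

Lemma kapN w i j k l m : kap w j i k l m = - kap w i j k l m.
Proof. by rewrite /kap 3!(br_swap w i j) mulrNN mulrN invrN. Qed.

(** The load of the combination at each vertex is the Lagrange identity [dv_lagrange]. *)
Lemma K5_relation w a b c d f :
  uniq [:: a; b; c; d; f] -> genpos w [:: a; b; c; d; f] ->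
  kap w a b c d f *: erow w a b + kap w a c b d f *: erow w a c
  + kap w a d b c f *: erow w a d + kap w a f b c d *: erow w a f
  + kap w b c a d f *: erow w b c + kap w b d a c f *: erow w b d
  + kap w b f a c d *: erow w b f + kap w c d a b f *: erow w c d
  + kap w c f a b d *: erow w c f + kap w d f a b c *: erow w d f = 0.
Proof.
move=> U G; apply/blk_inj => v; rewrite !mulmxDl -!scalemxAl !er_blk.
have lag i j k l m : perm_eq [:: i; j; k; l; m] [:: a; b; c; d; f] ->
    kap w i j k l m *: dv w i j + kap w i k j l m *: dv w i k
    + kap w i l j k m *: dv w i l + kap w i m j k l *: dv w i m = 0.
  move=> p; apply: dv_lagrange; first by rewrite (perm_uniq p).
  by apply: sub_genpos G => x; rewrite (perm_mem p).
have U' := U; move: U; rewrite /= !inE !negb_or.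
move=> /and5P[/and4P[ab ac ad af] /and3P[bc bd bf] /andP[cd cf] df _].
have sw i j k l m : kap w i j k l m *: - dv w i j = kap w j i k l m *: dv w j i.
  by rewrite kapN scaleNr dvC scalerN opprK.
case: (eqVneq v a) => [->|va].
  rewrite (negPf ab) (negPf ac) (negPf ad) (negPf af) !scaler0 !addr0.
  exact: lag (perm_refl _).
case: (eqVneq v b) => [->|vb].
  rewrite (negPf bc) (negPf bd) (negPf bf) !scaler0 !addr0 sw.
  by rewrite -[RHS](lag b a c d f) ?add0r // -[perm_eq _ _]/(perm_eq ([:: b] ++ [:: a] ++ [:: c; d; f]) _) perm_catCA.
case: (eqVneq v c) => [->|vc].
  rewrite (negPf cd) (negPf cf) !scaler0 !addr0 !add0r !sw.
  by rewrite -[RHS](lag c a b d f) // -[perm_eq _ _]/(perm_eq ([:: c] ++ [:: a; b] ++ [:: d; f]) _) perm_catCA.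
case: (eqVneq v d) => [->|vd].
  rewrite (negPf df) !scaler0 !addr0 !add0r !sw.
  by rewrite -[RHS](lag d a b c f) // -[perm_eq _ _]/(perm_eq ([:: d] ++ [:: a; b; c] ++ [:: f]) _) perm_catCA.
case: (eqVneq v f) => [_|vf].
  rewrite !scaler0 !addr0 !add0r !sw.
  by rewrite -[RHS](lag f a b c d) // -[perm_eq _ _]/(perm_eq ([:: f] ++ [:: a; b; c; d] ++ [::]) _) perm_catCA.
by rewrite !scaler0 !addr0.
Qed.

(** Evaluating the relation on the quadratic form that vanishes in two of the directions isolates
    the third coefficient, times two brackets. *)
Lemma dv_indep w v i j k (c1 c2 c3 : R) :
  br w v i j != 0 -> br w v i k != 0 -> br w v j k != 0 ->
  c1 *: dv w v i + c2 *: dv w v j + c3 *: dv w v k = 0 -> [/\ c1 = 0, c2 = 0 & c3 = 0].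
Proof.
move=> ij ik jk E.
have E0 : c1 * (px w v - px w i) ^+ 2 + c2 * (px w v - px w j) ^+ 2 + c3 * (px w v - px w k) ^+ 2 = 0.
  by have := congr1 (fun u : 'rV__ => u 0 0) E; rewrite !mxE /Dvec /=.
have E1 : c1 * ((px w v - px w i) * (py w v - py w i)) + c2 * ((px w v - px w j) * (py w v - py w j))
   + c3 * ((px w v - px w k) * (py w v - py w k)) = 0.
  by have := congr1 (fun u : 'rV__ => u 0 1) E; rewrite !mxE /Dvec /=.
have E2 : c1 * (py w v - py w i) ^+ 2 + c2 * (py w v - py w j) ^+ 2 + c3 * (py w v - py w k) ^+ 2 = 0.
  by have := congr1 (fun u : 'rV__ => u 0 2%:R) E; rewrite !mxE /Dvec /=.
move: E0 E1 E2 ij ik jk; have brE a b : br w v a b = (px w v - px w a) * (py w v - py w b) - (px w v - px w b) * (py w v - py w a).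
  by rewrite /br; ring.
rewrite !brE.
set xi := px w v - px w i; set xj := px w v - px w j; set xk := px w v - px w k.
set yi := py w v - py w i; set yj := py w v - py w j; set yk := py w v - py w k.
move: xi xj xk yi yj yk => xi xj xk yi yj yk E0 E1 E2 ij ik jk.
have F1 : c1 * (xi * yj - xj * yi) * (xi * yk - xk * yi) = 0.
  transitivity ((c1 * xi ^+ 2 + c2 * xj ^+ 2 + c3 * xk ^+ 2) * (yj * yk)
   - (c1 * (xi * yi) + c2 * (xj * yj) + c3 * (xk * yk)) * (xj * yk + xk * yj)
   + (c1 * yi ^+ 2 + c2 * yj ^+ 2 + c3 * yk ^+ 2) * (xj * xk)); first by ring.
  by rewrite E0 E1 E2 !mul0r subrr addr0.
have F2 : c2 * (xi * yj - xj * yi) * (xj * yk - xk * yj) = 0.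
  transitivity (- ((c1 * xi ^+ 2 + c2 * xj ^+ 2 + c3 * xk ^+ 2) * (yi * yk)
   - (c1 * (xi * yi) + c2 * (xj * yj) + c3 * (xk * yk)) * (xi * yk + xk * yi)
   + (c1 * yi ^+ 2 + c2 * yj ^+ 2 + c3 * yk ^+ 2) * (xi * xk))); first by ring.
  by rewrite E0 E1 E2 !mul0r subrr addr0 oppr0.
have F3 : c3 * (xi * yk - xk * yi) * (xj * yk - xk * yj) = 0.
  transitivity ((c1 * xi ^+ 2 + c2 * xj ^+ 2 + c3 * xk ^+ 2) * (yi * yj)
   - (c1 * (xi * yi) + c2 * (xj * yj) + c3 * (xk * yk)) * (xi * yj + xj * yi)
   + (c1 * yi ^+ 2 + c2 * yj ^+ 2 + c3 * yk ^+ 2) * (xi * xj)); first by ring.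
  by rewrite E0 E1 E2 !mul0r subrr addr0.
by move/eqP: F1; move/eqP: F2; move/eqP: F3; rewrite !mulf_eq0 (negPf ij) (negPf ik) (negPf jk) !orbF => /eqP -> /eqP -> /eqP ->.
Qed.

(** Here the test form is the square of the linear form vanishing in the other direction. *)
Lemma dv_indep2 w v i j (c1 c2 : R) :
  br w v i j != 0 -> c1 *: dv w v i + c2 *: dv w v j = 0 -> c1 = 0 /\ c2 = 0.
Proof.
move=> ij E.
have E0 : c1 * (px w v - px w i) ^+ 2 + c2 * (px w v - px w j) ^+ 2 = 0.
  by have := congr1 (fun u : 'rV__ => u 0 0) E; rewrite !mxE /Dvec /=.
have E1 : c1 * ((px w v - px w i) * (py w v - py w i)) + c2 * ((px w v - px w j) * (py w v - py w j)) = 0.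
  by have := congr1 (fun u : 'rV__ => u 0 1) E; rewrite !mxE /Dvec /=.
have E2 : c1 * (py w v - py w i) ^+ 2 + c2 * (py w v - py w j) ^+ 2 = 0.
  by have := congr1 (fun u : 'rV__ => u 0 2%:R) E; rewrite !mxE /Dvec /=.
move: E0 E1 E2 ij; have brE a b : br w v a b = (px w v - px w a) * (py w v - py w b) - (px w v - px w b) * (py w v - py w a).
  by rewrite /br; ring.
rewrite !brE.
set xi := px w v - px w i; set xj := px w v - px w j.
set yi := py w v - py w i; set yj := py w v - py w j.
move: xi xj yi yj => xi xj yi yj E0 E1 E2 ij.
have F1 : c1 * (xi * yj - xj * yi) * (xi * yj - xj * yi) = 0.
  transitivity ((c1 * xi ^+ 2 + c2 * xj ^+ 2) * (yj ^+ 2)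
   - (c1 * (xi * yi) + c2 * (xj * yj)) * (2 * xj * yj)
   + (c1 * yi ^+ 2 + c2 * yj ^+ 2) * (xj ^+ 2)); first by ring.
  by rewrite E0 E1 E2 !mul0r subrr addr0.
have F2 : c2 * (xi * yj - xj * yi) * (xi * yj - xj * yi) = 0.
  transitivity ((c1 * xi ^+ 2 + c2 * xj ^+ 2) * (yi ^+ 2)
   - (c1 * (xi * yi) + c2 * (xj * yj)) * (2 * xi * yi)
   + (c1 * yi ^+ 2 + c2 * yj ^+ 2) * (xi ^+ 2)); first by ring.
  by rewrite E0 E1 E2 !mul0r subrr addr0.
by move/eqP: F1; move/eqP: F2; rewrite !mulf_eq0 (negPf ij) !orbF => /eqP -> /eqP ->.
Qed.

End Rows.

(** * Nondegeneracy and balanced stars at a generic placement *)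

Section Generic.
Variables (R : realFieldType) (n : nat) (w : 'I_(n + n) -> R).
Hypothesis gw : alg_indep_Q w.
Implicit Types (i j k l m v a b c d f : 'I_n) (T : {set 'I_n}) (S : {set 'I_n * 'I_n}).

Lemma polyfun_px i : polyfun (fun w : 'I_(n + n) -> R => px w i).
Proof. exact: polyfun_coord. Qed.

Lemma polyfun_py i : polyfun (fun w : 'I_(n + n) -> R => py w i).
Proof. exact: polyfun_coord. Qed.

Lemma polyfun_br i j k : polyfun (fun w : 'I_(n + n) -> R => br w i j k).
Proof.
by apply: polyfunB; apply: polyfunM; apply: polyfunB; (exact: polyfun_px || exact: polyfun_py).
Qed.

Lemma polyfun_er i j t : polyfun (fun w : 'I_(n + n) -> R => erow w i j 0 t).
Proof.
case/mxvec_indexP: t => v k.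
pose D := fun w : 'I_(n + n) -> R => Dvec (px w) (py w) i j k.
have pD : polyfun D.
  have px' : polyfun (fun w : 'I_(n + n) -> R => px w i - px w j).
    by apply: polyfunB; exact: polyfun_px.
  have py' : polyfun (fun w : 'I_(n + n) -> R => py w i - py w j).
    by apply: polyfunB; exact: polyfun_py.
  rewrite /D /Dvec; case: (k == 0); first exact: polyfunM.
  by case: (k == 1); exact: polyfunM.
have [q qE] : polyfun (fun w : 'I_(n + n) -> R => if v == i then D w else if v == j then - D w else 0).
  by case: (v == i) => //; case: (v == j); [exact: polyfunN | exact: polyfun0].
by exists q => u; rewrite -qE /erow /cof_row mxvecE mxE /=.
Qed.

Lemma px_neq i j : i != j -> px w i != px w j.
Proof.
move=> ij; rewrite -subr_eq0.
apply: (generic_neq0 (f := fun w => px w i - px w j) (w' := move_vertex (fun=> 0) i 1 0) gw).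
  by apply: polyfunB; exact: polyfun_px.
by rewrite !px_mv eqxx (eq_sym j) (negPf ij) /px subr0 oner_eq0.
Qed.

Lemma br_neq0 i j k : uniq [:: i; j; k] -> br w i j k != 0.
Proof.
rewrite /= !inE negb_or => /and3P[/andP[ij ik] jk _].
apply: (generic_neq0 (f := fun w => br w i j k) (w' := move_vertex (move_vertex (fun=> 0) j 1 0) k 0 1) gw).
  exact: polyfun_br.
rewrite /br !px_mv !py_mv !eqxx (negPf ij) (negPf ik) (negPf jk) /px /py.
by rewrite !subr0 mulr1 mul0r subr0 oner_eq0.
Qed.

Lemma genpos_w s : genpos w s.
Proof. by move=> i j k _ _ _; exact: br_neq0. Qed.

(** With [j] moved onto [k] the second bracket vanishes and the first does not. The coefficients are
    rational so that the expression is a rational polynomial in the placement. *)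
Lemma br_comb_neq0 (x y : rat) i j k l : x != 0 -> uniq [:: i; j; k; l] ->
  ratr x * br w i k l + ratr y * br w j k l != 0.
Proof.
move=> x0 U; pose w' := move_vertex w j (px w k) (py w k).
apply: (generic_neq0 (f := fun w => ratr x * br w i k l + ratr y * br w j k l) (w' := w') gw).
  by apply: polyfunD; apply: polyfunM; (exact: polyfun_const || exact: polyfun_br).
have U' := U; move: U; rewrite /= !inE !negb_or => /and4P[/and3P[ij ik il] /andP[jk jl] kl _].
have -> : br w' j k l = 0.
  by rewrite /br !px_mv !py_mv !eqxx eq_sym (negPf jk) !subrr mulr0 mul0r subrr.
rewrite mulr0 addr0 br_mv ?[k == j]eq_sym ?[l == j]eq_sym // mulf_neq0 ?fmorph_eq0 //.
by apply: br_neq0; rewrite /= !inE negb_or ik il kl.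
Qed.

Lemma K5_er a b c d f : uniq [:: a; b; c; d; f] ->
  kap w a b c d f *: erow w a b + kap w a c b d f *: erow w a c
  + kap w a d b c f *: erow w a d + kap w a f b c d *: erow w a f
  + kap w b c a d f *: erow w b c + kap w b d a c f *: erow w b d
  + kap w b f a c d *: erow w b f + kap w c d a b f *: erow w c d
  + kap w c f a b d *: erow w c f + kap w d f a b c *: erow w d f = 0.
Proof. by move=> U; apply: K5_relation U (@genpos_w _). Qed.

Lemma kap_neq0 i j k l m : uniq [:: i; j; k; l; m] -> kap w i j k l m != 0.
Proof.
rewrite /= !inE !negb_or => /and5P[/and4P[ij ik il im] /and3P[jk jl jm] /andP[kl km] lm _].
by rewrite invr_eq0 !mulf_neq0 ?br_neq0 //= !inE negb_or; apply/and3P; split=> //; apply/andP.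
Qed.

(** Rank-nullity for [blk v] on [A]: the image contains three independent squared directions, the
    kernel contains [U]. *)
Lemma star_rank (w' : 'I_(n + n) -> R) v i j k (U A : 'M[R]_(n * 3)) :
  v != i -> v != j -> v != k ->
  U *m blk R v = 0 -> (U <= A)%MS ->
  (erow w' v i <= A)%MS -> (erow w' v j <= A)%MS -> (erow w' v k <= A)%MS ->
  br w' v i j != 0 -> br w' v i k != 0 -> br w' v j k != 0 ->
  (\rank U + 3 <= \rank A)%N.
Proof.
move=> vi vj vk U0 UA Ai Aj Ak ij ik jk.
rewrite -(mxrank_mul_ker A (blk R v)) addnC leq_add //; last first.
  by apply: mxrankS; rewrite sub_capmx UA; apply/sub_kermxP.
pose B := \matrix_(t < 3) nth 0 [:: dv w' v i; dv w' v j; dv w' v k] t.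
have BA : (B <= A *m blk R v)%MS.
  apply/row_subP => t; rewrite rowK.
  have dA l : (erow w' v l <= A)%MS -> (dv w' v l <= A *m blk R v)%MS.
    by move=> /submxMr-/(_ _ (blk R v)); rewrite er_blk eqxx.
  by case: t => [[|[|[|//]]] tP] /=; exact: dA.
apply: leq_trans (mxrankS BA); suff /eqP -> : row_free B by [].
rewrite -kermx_eq0; apply/eqP/row_matrixP => r; rewrite row0.
have : row r (kermx B) *m B = 0 by rewrite -row_mul mulmx_ker row0.
set u := row r _; rewrite mulmx_sum_row !big_ord_recl big_ord0 !rowK /= addr0 addrA.
move/(dv_indep ij ik jk) => [u0 u1 u2].
apply/rowP => t; rewrite [RHS]mxE.
case: t => [[|[|[|//]]] tP]; [move: u0 | move: u1 | move: u2]; set x := (X in u 0 X) => <-;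
  by congr (u 0 _); apply: val_inj.
Qed.

Definition rspan (S : {set 'I_n * 'I_n}) : 'M[R]_(n * 3) := (\sum_(e in S) <<erow w e.1 e.2>>)%MS.

Lemma er_Sp S i j : ((i, j) \in S) || ((j, i) \in S) -> (erow w i j <= rspan S)%MS.
Proof.
case/orP => ijS.
  by apply: (sumsmx_sup (i, j)) => //=; rewrite genmxE.
by rewrite erN (eqmx_opp (erow w j i)); apply: (sumsmx_sup (j, i)) => //=; rewrite genmxE.
Qed.

Lemma SpP S N (A : 'M_(N, n * 3)) : (forall i j, (i, j) \in S -> (erow w i j <= A)%MS) -> (rspan S <= A)%MS.
Proof. by move=> H; apply/sumsmx_subP => -[i j] /H; rewrite genmxE. Qed.

Lemma SpS S S' : S \subset S' -> (rspan S <= rspan S')%MS.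
Proof. by move=> /subsetP SS; apply: SpP => i j /SS ijS; apply: er_Sp; rewrite ijS. Qed.

(** [setX T T] stands for the complete graph on [T]; it also holds reversed and diagonal pairs,
    whose rows are opposite or zero. *)
Lemma er_Sp_setX T i j : i \in T -> j \in T -> (erow w i j <= rspan (setX T T))%MS.
Proof. by move=> iT jT; apply: er_Sp; rewrite !inE /= iT jT. Qed.

Lemma SpU S S' : (rspan (S :|: S') :=: rspan S + rspan S')%MS.
Proof.
apply/eqmxP/andP; split.
  apply: SpP => i j; rewrite inE => /orP[] ijS.
    by apply: submx_trans (addsmxSl _ _); rewrite er_Sp ?ijS.
  by apply: submx_trans (addsmxSr _ _); rewrite er_Sp ?ijS.
by rewrite addsmx_sub !SpS ?subsetUl ?subsetUr.
Qed.

Lemma Sp_blk0 S v : (forall i j, (i, j) \in S -> (i != v) && (j != v)) -> rspan S *m blk R v = 0.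
Proof.
move=> H; apply/sub_kermxP/SpP => i j /H /andP[iv jv]; apply/sub_kermxP.
by rewrite er_blk !(eq_sym v) (negPf iv) (negPf jv).
Qed.

(** Abstract in [r], to serve both for rows, where it vanishes, and for formal edges, where it
    generates the relations. *)
Definition K5comb N (r : 'I_n -> 'I_n -> 'rV[R]_N) a b c d f :=
  kap w a b c d f *: r a b + kap w a c b d f *: r a c
  + kap w a d b c f *: r a d + kap w a f b c d *: r a f
  + kap w b c a d f *: r b c + kap w b d a c f *: r b d
  + kap w b f a c d *: r b f + kap w c d a b f *: r c d
  + kap w c f a b d *: r c f + kap w d f a b c *: r d f.

(** Squares of up to three distinct directions are independent. Hence a star with at most three
    edges takes part in no relation. *)
Lemma load_small v T (c : 'I_n -> R) : v \notin T -> (#|T| <= 3)%N ->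
  \sum_(j in T) c j *: dv w v j = 0 -> forall j, j \in T -> c j = 0.
Proof.
move=> vT T3 E j jT.
have vt t : t \in T -> v != t by move=> tT; apply: contraNneq vT => ->.
move: E; rewrite (big_setD1 j) //=.
have T2 : (#|T :\ j| <= 2)%N by move: T3; rewrite (cardsD1 j) jT.
have inT k : k \in T :\ j -> v != k /\ j != k.
  by rewrite !inE eq_sym => /andP[-> /vt].
have brvj k : k \in T :\ j -> br w v j k != 0.
  by case/inT => vk jk; apply: br_neq0; rewrite /= !inE negb_or (vt _ jT) vk jk.
case TE: #|T :\ j| T2 => [|[|[|//]]] _.
- rewrite (cards0_eq TE) big_set0 addr0 => /rowP/(_ 0); rewrite !mxE /Dvec /=.
  move/eqP; rewrite mulf_eq0 => /orP[/eqP -> //|].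
  by rewrite expf_eq0 subr_eq0 /= (negPf (px_neq (vt _ jT))).
- have /cards1P[k kE] : #|T :\ j| == 1%N by rewrite TE.
  move: (brvj k).
  by rewrite kE big_set1 set11 => /(_ isT)/dv_indep2 H /H[].
have /cards2P[k [l [kl kE]]] : #|T :\ j| == 2%N by rewrite TE.
rewrite kE big_setU1 ?inE //= big_set1 addrA.
have kT : k \in T :\ j by rewrite kE set21.
have lT : l \in T :\ j by rewrite kE set22.
have [[vk jk] [vl jl]] := (inT _ kT, inT _ lT).
move/dv_indep => /(_ (brvj _ kT) (brvj _ lT)).
by case=> //; apply: br_neq0; rewrite /= !inE negb_or vk vl kl.
Qed.

(** A star whose squared directions are balanced at [v] is a combination of complete
graphs on [v] and four neighbours, up to pairs of neighbours: subtracting a [K5] kills one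
coefficient, and with three left they all vanish. *)
Lemma load_span N (r : 'I_n -> 'I_n -> 'rV[R]_N) (G : 'M[R]_N) v T (c : 'I_n -> R) :
  v \notin T ->
  (forall i j k l, i \in T -> j \in T -> k \in T -> l \in T -> uniq [:: v; i; j; k; l] ->
    (K5comb r v i j k l <= G)%MS) ->
  \sum_(j in T) c j *: dv w v j = 0 ->
  ((\sum_(j in T) c j *: r v j)%R <= G + \sum_(e in setX T T) <<r e.1 e.2>>)%MS.
Proof.
have [m] := ubnP #|T|; elim: m T c => // m IH T c Tm vT HG E.
case: (leqP #|T| 3) => T3.
  have c0 := load_small vT T3 E.
  by rewrite big1 ?sub0mx // => j jT; rewrite c0 ?scale0r.
have [i iT] : exists i, i \in T by apply/set0Pn; rewrite -card_gt0; apply: leq_trans T3.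
have Ti : (3 <= #|T :\ i|)%N by move: T3; rewrite (cardsD1 i) iT.
have [[|j [|k [|l s]]] [es Us Ts]] : exists s, [/\ (3 <= size s)%N, uniq s & {subset s <= T :\ i}].
- by exists (enum (T :\ i)); rewrite -cardE enum_uniq; split=> // x; rewrite mem_enum.
- by [].
- by [].
- by [].
have {}Ts x : x \in [:: j; k; l] -> x \in T :\ i.
  move=> xs; apply: Ts; move: xs; rewrite !inE.
  by case/or3P => ->; rewrite ?orbT.
have {es s}Us : uniq [:: j; k; l].
  by move: Us; rewrite -[_ :: _]/([:: j; k; l] ++ s) cat_uniq => /and3P[].
have /setD1P[ji jT] : j \in T :\ i by apply: Ts; rewrite inE eqxx.
have /setD1P[ki kT] : k \in T :\ i by apply: Ts; rewrite !inE eqxx orbT.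
have /setD1P[li lT] : l \in T :\ i by apply: Ts; rewrite !inE eqxx !orbT.
have U5 : uniq [:: v; i; j; k; l].
  rewrite cons_uniq; apply/andP; split.
    by rewrite !inE !negb_or; apply/and4P; split; apply: contraNneq vT => ->.
  by rewrite cons_uniq Us andbT !inE !negb_or !(eq_sym i) ji ki li.
(* Subtracting [x] times the [K5] on [v, i, j, k, l] kills the coefficient at [i]; [g] is the star
   of that [K5] at [v], extended by zero to [T]. *)
pose x := c i / kap w v i j k l.
pose g t := if t == i then kap w v i j k l else if t == j then kap w v j i k l
  else if t == k then kap w v k i j l else if t == l then kap w v l i j k else 0.
have gE N' (s : 'I_n -> 'rV[R]_N') : \sum_(t in T) g t *: s t =
  kap w v i j k l *: s i + kap w v j i k l *: s j + kap w v k i j l *: s k + kap w v l i j k *: s l.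
  move: Us; rewrite /= !inE !negb_or => /and3P[/andP[jk jl] kl _].
  rewrite (big_setD1 i) //= (big_setD1 j) ?inE ?ji //= (big_setD1 k) ?inE ?ki 1?eq_sym ?jk //=.
  rewrite (big_setD1 l) ?inE ?li 1?[l == k]eq_sym ?kl 1?[l == j]eq_sym ?jl //=.
  rewrite big1 ?addr0 ?addrA.
    by rewrite /g !eqxx (negPf ji) (negPf ki) (negPf li) ![k == j]eq_sym (negPf jk)
      ![l == _]eq_sym (negPf jl) (negPf kl).
  move=> t; rewrite !inE /g => /and5P[/negPf-> /negPf-> /negPf-> /negPf-> _].
  by rewrite scale0r.
have dvg : \sum_(t in T) g t *: dv w v t = 0.
  by rewrite gE; apply: dv_lagrange U5 (@genpos_w _).
pose c' t := c t - x * g t.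
have c'i : c' i = 0.
  by rewrite /c' /g eqxx /x divfK ?subrr // kap_neq0.
have split_c N' (s : 'I_n -> 'rV[R]_N') : \sum_(t in T) c t *: s t =
    \sum_(t in T :\ i) c' t *: s t + x *: \sum_(t in T) g t *: s t.
  have -> : \sum_(t in T :\ i) c' t *: s t = \sum_(t in T) c' t *: s t.
    by rewrite [RHS](big_setD1 i) //= c'i scale0r add0r.
  rewrite scaler_sumr.
  by rewrite -big_split /=; apply: eq_bigr => t _; rewrite scalerA -scalerDl subrK.
have TiT : T :\ i \subset T by rewrite subsetDl.
rewrite split_c addmx_sub //.
  apply: submx_trans (IH _ _ _ _ _ _) _.
  - by move: Tm; rewrite (cardsD1 i) iT ltnS.
  - by rewrite !inE (negPf vT) andbF.
  - by move=> i1 i2 i3 i4 /setD1P[_ ?] /setD1P[_ ?] /setD1P[_ ?] /setD1P[_ ?]; apply: HG.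
  - by move: E; rewrite split_c dvg scaler0 addr0.
  apply: addsmxS => //; apply/sumsmx_subP => e eT; apply: (sumsmx_sup e) => //.
  by apply: subsetP eT; apply: setXS.
rewrite scalemx_sub // gE.
have K5G := HG i j k l iT jT kT lT U5.
have -> : kap w v i j k l *: r v i + kap w v j i k l *: r v j + kap w v k i j l *: r v k
   + kap w v l i j k *: r v l = K5comb r v i j k l - (kap w i j v k l *: r i j + kap w i k v j l *: r i k
   + kap w i l v j k *: r i l + kap w j k v i l *: r j k + kap w j l v i k *: r j l
   + kap w k l v i j *: r k l).
  by apply/eqP; rewrite -subr_eq opprK /K5comb !addrA.
have rT p q : p \in T -> q \in T -> (r p q <= \sum_(e in setX T T) <<r e.1 e.2>>)%MS.
  by move=> pT qT; apply: (sumsmx_sup (p, q)); rewrite ?inE ?pT ?qT //= genmxE.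
rewrite addmx_sub //; first exact: submx_trans K5G (addsmxSl _ _).
rewrite eqmx_opp; apply: submx_trans (addsmxSr _ _).
by rewrite !addmx_sub ?scalemx_sub ?rT.
Qed.

End Generic.

(** * Symmetric vectors on five points *)

Ltac uniq5 := rewrite /= ?inE ?negb_or; repeat (apply/andP; split);
  first [done | assumption | by rewrite eq_sym].

Section Classify.
Variables (R : realFieldType) (N : nat) (I : finType) (T : {set I}) (X : I -> I -> 'rV[R]_N).
Hypothesis XC : forall i j, X j i = X i j.
Hypothesis P1 : forall a b c d f, uniq [:: a; b; c; d; f] ->
  a \in T -> b \in T -> c \in T -> d \in T -> f \in T ->
  X a b != 0 -> (X c d <= X a b)%MS.
Hypothesis P2 : forall a b c d f, uniq [:: a; b; c; d; f] ->
  a \in T -> b \in T -> c \in T -> d \in T -> f \in T ->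
  X a b != 0 -> ((X a c + X a d + X a f)%R <= X a b)%MS.

Definition vanishing_off (m : I) : Prop :=
  forall i j, i \in T -> j \in T -> i != m -> j != m -> i != j -> X i j = 0.

(** The exceptional pattern: [f] is idle, and opposite pairs of [a, b, c, d] are proportional with a
    common ratio [t], including [X b c = t *: X a d]. The three vectors at [a] sum to zero and span
    a plane. [P1] and [P2] leave [t] free. *)
Definition quadrangle (t : R) (a b c d f : I) : Prop :=
  [/\ uniq [:: a; b; c; d; f], [/\ a \in T, b \in T, c \in T, d \in T & f \in T],
      [/\ X a f = 0, X b f = 0, X c f = 0 & X d f = 0],
      [/\ X c d = t *: X a b, X b d = t *: X a c,
          X a d = - (X a b + X a c) & X b c = - (t *: (X a b + X a c))]
    & X a b != 0 /\ ~~ (X a c <= X a b)%MS].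

(** [P1] and [P2] for the pairs [ab] and [ac], taken at both ends, express every pair avoiding [a]
    by [al] and [be] with four unknown scalars. The pairs [ad] and [af] then serve as further test
    pairs that fix these scalars. *)
Lemma classify_core a b c d f : uniq [:: a; b; c; d; f] ->
  a \in T -> b \in T -> c \in T -> d \in T -> f \in T ->
  {subset T <= [:: a; b; c; d; f]} ->
  X a b != 0 -> ~~ (X a c <= X a b)%MS -> X a d != 0 ->
  vanishing_off a \/ exists2 t, t != 0 & quadrangle t a b c d f.
Proof.
move=> U aT bT cT dT fT TE; move: (U).
rewrite /= !inE !negb_or => /and5P[/and4P[ab ac ad af] /and3P[bc bd bf] /andP[cd cf] df _].
set al := X a b; set be := X a c => al0 be_al Xad0.
have be0 : be != 0 by apply: contraNneq be_al => ->; rewrite sub0mx.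
have ind x y : x *: al + y *: be = 0 -> x = 0 /\ y = 0.
  move=> E; have y0 : y = 0.
    apply: contraNeq be_al => y0; apply/sub_rVP; exists (- (x / y)).
    move/rowP: E => E; apply/rowP => i; move: (E i); rewrite !mxE => Ei.
    by apply: (mulfI y0); transitivity (- (x * al 0 i)); [lra | field].
  move: E; rewrite y0 scale0r addr0 => /eqP; rewrite scaler_eq0 (negPf al0) orbF => /eqP ->.
  by [].
have ind2 x y x' y' : x *: al + y *: be = x' *: al + y' *: be -> x = x' /\ y = y'.
  move=> /rowP E; have [] : x - x' = 0 /\ y - y' = 0.
    by apply: ind; apply/rowP => i; move: (E i); rewrite !mxE; lra.
  by move=> /eqP + /eqP; rewrite !subr_eq0 => /eqP -> /eqP ->.
have [u1 Xcd] : exists k, X c d = k *: al by apply/sub_rVP; apply: (P1 (f := f)) => //; uniq5.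
have [u2 Xcf] : exists k, X c f = k *: al by apply/sub_rVP; apply: (P1 (f := d)) => //; uniq5.
have [t1 Xbd] : exists k, X b d = k *: be by apply/sub_rVP; apply: (P1 (f := f)) => //; uniq5.
have [t2 Xbf] : exists k, X b f = k *: be by apply/sub_rVP; apply: (P1 (f := d)) => //; uniq5.
have Xdf : X d f = 0.
  have [k kE] : exists k, X d f = k *: al by apply/sub_rVP; apply: (P1 (f := c)) => //; uniq5.
  have [k' k'E] : exists k, X d f = k *: be by apply/sub_rVP; apply: (P1 (f := b)) => //; uniq5.
  have [k0 _] : k = 0 /\ 0 = k' by apply: ind2; rewrite !scale0r addr0 add0r -kE.
  by rewrite kE k0 scale0r.
have [r1 E1] : exists k, be + X a d + X a f = k *: al by apply/sub_rVP; apply: P2 => //; uniq5.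
have [r2 E2] : exists k, al + X a d + X a f = k *: be by apply/sub_rVP; apply: P2 => //; uniq5.
have Eadf : X a d + X a f = - al - be.
  have [r1E _] : r1 = -1 /\ -1 = r2.
    apply: ind2; apply/rowP => i; move/rowP/(_ i): E1; move/rowP/(_ i): E2; rewrite !mxE; lra.
  by apply/rowP => i; move/rowP/(_ i): E1; rewrite r1E !mxE; lra.
have [r3 E3] : exists k, X b c + X b d + X b f = k *: al.
  by apply/sub_rVP; rewrite /al -(XC a b); apply: P2; rewrite // 1?XC //; uniq5.
have [r4 E4] : exists k, X c b + X c d + X c f = k *: be.
  by apply/sub_rVP; rewrite /be -(XC a c); apply: P2; rewrite // 1?XC //; uniq5.
have {E3 E4} Xbc : X b c = - (u1 + u2) *: al - (t1 + t2) *: be.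
  have [r3E _] : r3 = - (u1 + u2) /\ - (t1 + t2) = r4.
    apply: ind2; apply/rowP => i; move/rowP/(_ i): E3; move/rowP/(_ i): E4.
    by rewrite (XC b c) Xcd Xcf Xbd Xbf !mxE; lra.
  by apply/rowP => i; move/rowP/(_ i): E3; rewrite r3E Xbd Xbf !mxE; lra.
have done_a : t1 = 0 -> t2 = 0 -> u1 = 0 -> u2 = 0 -> vanishing_off a.
  move=> t10 t20 u10 u20 i j /TE iT /TE jT ia ja ij.
  have bc0 : X b c = 0 by rewrite Xbc t10 t20 u10 u20 !addr0 oppr0 !scale0r subr0.
  have bd0 : X b d = 0 by rewrite Xbd t10 scale0r.
  have bf0 : X b f = 0 by rewrite Xbf t20 scale0r.
  have cd0 : X c d = 0 by rewrite Xcd u10 scale0r.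
  have cf0 : X c f = 0 by rewrite Xcf u20 scale0r.
  move: iT jT ij; rewrite !inE (negPf ia) (negPf ja) /=.
  by case/or4P => /eqP-> /or4P[] /eqP->; rewrite ?eqxx // => _; rewrite // XC.
have Pad v : (v <= X a d)%MS -> exists k, v = k *: X a d by move/sub_rVP.
have [k1 Xbc1] : exists k, X b c = k *: X a d by apply/sub_rVP; apply: (P1 (f := f)) => //; uniq5.
have [k2 Xbf1] : exists k, X b f = k *: X a d by apply/sub_rVP; apply: (P1 (f := c)) => //; uniq5.
have [k3 Xcf1] : exists k, X c f = k *: X a d by apply/sub_rVP; apply: (P1 (f := b)) => //; uniq5.
have [k4 Xdbc] : exists k, X d b + X d c + X d f = k *: X a d.
  by apply/sub_rVP; rewrite -(XC a d); apply: P2; rewrite // 1?XC //; uniq5.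
(* If [af] vanishes, only [ad] is a test: it forces [t2 = u2 = 0] and [t1 = u1], and this common
   value, unless zero, is the ratio of the quadrangle. *)
have [Xaf0|Xaf0] := eqVneq (X a f) 0.
  have Xad : X a d = - al - be by rewrite -Eadf Xaf0 addr0.
  have [] : t2 = 0 /\ u2 = 0.
    have [k20 t2E] : - k2 = 0 /\ - k2 = t2.
      apply: ind2; apply/rowP => i; move/rowP/(_ i): Xbf1; rewrite Xad Xbf !mxE; lra.
    have [u2E k30] : - k3 = u2 /\ - k3 = 0.
      apply: ind2; apply/rowP => i; move/rowP/(_ i): Xcf1; rewrite Xad Xcf !mxE; lra.
    by rewrite -t2E -u2E k20 k30.
  move=> t20 u20; have [k1E k1E'] : - (u1 + u2) = - k1 /\ - (t1 + t2) = - k1.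
    apply: ind2; apply/rowP => i; move/rowP/(_ i): Xbc1; rewrite Xad Xbc !mxE; lra.
  have u1E : u1 = k1 by move: k1E; rewrite u20; lra.
  have t1E : t1 = k1 by move: k1E'; rewrite t20; lra.
  have [k10|k10] := eqVneq k1 0; first by left; apply: done_a; rewrite // ?u1E ?t1E.
  right; exists k1 => //; split=> //.
  - by rewrite Xbf Xcf t20 u20 !scale0r.
  - rewrite Xcd Xbd u1E t1E Xad opprD; split=> //.
    by rewrite Xbc u1E t1E t20 u20 !addr0 scaleNr -opprD -scalerDr.
(* With [ad] and [af] both nonzero, the two sets of tests together leave nothing off [a], whether or
   not [ad] lies in the plane of [al] and [be]. *)
left.
have [l1 Xbc2] : exists k, X b c = k *: X a f by apply/sub_rVP; apply: (P1 (f := d)) => //; uniq5.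
have [l2 Xbd2] : exists k, X b d = k *: X a f by apply/sub_rVP; apply: (P1 (f := c)) => //; uniq5.
have [l3 Xcd2] : exists k, X c d = k *: X a f by apply/sub_rVP; apply: (P1 (f := b)) => //; uniq5.
have [l4 Xfbc] : exists k, X f b + X f c + X f d = k *: X a f.
  by apply/sub_rVP; rewrite -(XC a f); apply: P2; rewrite // 1?XC //; uniq5.
have inspan k p q : k != 0 -> k *: X a d = p *: al + q *: be -> exists x y, X a d = x *: al + y *: be.
  move=> k0 E; exists (p / k), (q / k); apply: (can_inj (scalerK k0)).
  by rewrite E scalerDr !scalerA ![k * _]mulrC !divfK.
have [[x [y Xad]]|nspan] : (exists x y, X a d = x *: al + y *: be) \/
    (forall p q, X a d != p *: al + q *: be).
  case sp: (X a d <= col_mx al be)%MS; last first.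
    right=> p q; apply: contraFneq sp => ->.
    apply/submxP; exists (row_mx p%:M q%:M).
    by rewrite mul_row_col !mul_scalar_mx.
  left; have /submxP[D DE] := sp; exists (lsubmx D 0 0), (rsubmx D 0 0).
  by rewrite DE -{1}[D]hsubmxK mul_row_col -!mul_scalar_mx -!mx11_scalar.
  have Xaf : X a f = - (1 + x) *: al - (1 + y) *: be.
    by apply/rowP => i; move/rowP/(_ i): Eadf; rewrite Xad !mxE; lra.
  have [a1 a2] : k2 * x = 0 /\ k2 * y = t2.
    by apply: ind2; apply/rowP => i; move/rowP/(_ i): Xbf1; rewrite Xad Xbf !mxE; lra.
  have [a3 a4] : k3 * x = u2 /\ k3 * y = 0.
    by apply: ind2; apply/rowP => i; move/rowP/(_ i): Xcf1; rewrite Xad Xcf !mxE; lra.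
  have [a5 a6] : k4 * x = u1 /\ k4 * y = t1.
    by apply: ind2; apply/rowP => i; move/rowP/(_ i): Xdbc;
      rewrite (XC b d) (XC c d) Xdf Xad Xbd Xcd !mxE; lra.
  have [b1 b2] : l2 * - (1 + x) = 0 /\ l2 * - (1 + y) = t1.
    by apply: ind2; apply/rowP => i; move/rowP/(_ i): Xbd2; rewrite Xaf Xbd !mxE; lra.
  have [b3 b4] : l3 * - (1 + x) = u1 /\ l3 * - (1 + y) = 0.
    by apply: ind2; apply/rowP => i; move/rowP/(_ i): Xcd2; rewrite Xaf Xcd !mxE; lra.
  have [b5 b6] : l4 * - (1 + x) = u2 /\ l4 * - (1 + y) = t2.
    by apply: ind2; apply/rowP => i; move/rowP/(_ i): Xfbc;
      rewrite (XC b f) (XC c f) (XC d f) Xdf Xaf Xbf Xcf !mxE; lra.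
  have t20 : t2 = 0.
    apply: contra_eq a1 => t2n; have k2n : k2 != 0 by apply: contraNneq t2n => k20; rewrite -a2 k20 mul0r.
    rewrite mulf_eq0 (negPf k2n) /=; apply: contraNneq t2n => x0.
    by move: b5; rewrite -a3 -b6 x0 mulr0 addr0 mulrN1 => /eqP; rewrite oppr_eq0 => /eqP ->; rewrite mul0r.
  have u20 : u2 = 0.
    apply: contra_eq a4 => u2n; have k3n : k3 != 0 by apply: contraNneq u2n => k30; rewrite -a3 k30 mul0r.
    rewrite mulf_eq0 (negPf k3n) /=; apply: contraNneq u2n => y0.
    by move: b6; rewrite -a2 -b5 y0 mulr0 addr0 mulrN1 => /eqP; rewrite oppr_eq0 => /eqP ->; rewrite mul0r.
  have t10 : t1 = 0.
    apply: contra_eq b1 => t1n; have l2n : l2 != 0 by apply: contraNneq t1n => l20; rewrite -b2 l20 mul0r.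
    rewrite mulf_eq0 (negPf l2n) /= oppr_eq0; apply: contraNneq t1n => x0.
    have xE : x = -1 by lra.
    by move: a5; rewrite -b3 -a6 x0 xE oppr0 mulr0 mulrN1 => /eqP; rewrite oppr_eq0 => /eqP ->; rewrite mul0r.
  have u10 : u1 = 0.
    apply: contra_eq b4 => u1n; have l3n : l3 != 0 by apply: contraNneq u1n => l30; rewrite -b3 l30 mul0r.
    rewrite mulf_eq0 (negPf l3n) /= oppr_eq0; apply: contraNneq u1n => y0.
    have yE : y = -1 by lra.
    by move: a6; rewrite -b2 -a5 y0 yE oppr0 mulr0 mulrN1 => /eqP; rewrite oppr_eq0 => /eqP ->; rewrite mul0r.
  exact: done_a.
have k_eq0 k p q : p *: al + q *: be = k *: X a d -> p = 0 /\ q = 0.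
  move=> E; apply: ind; rewrite E; have [->|k0] := eqVneq k 0; first by rewrite scale0r.
  by have [x [y /eqP]] := inspan _ _ _ k0 (esym E); rewrite (negPf (nspan _ _)).
have kf_eq0 k p q : p *: al + q *: be = k *: X a f -> p = 0 /\ q = 0.
  move=> E; apply: ind; rewrite E; have [->|k0] := eqVneq k 0; first by rewrite scale0r.
  have /eqP : X a d = - (1 + p / k) *: al + - (1 + q / k) *: be.
    apply/rowP => i; move/rowP/(_ i): E; move/rowP/(_ i): Eadf; rewrite !mxE => /(congr1 ( *%R k)) Ei Fi.
    apply: (mulfI k0); transitivity (- (k + p) * al 0 i - (k + q) * be 0 i); [lra | by field].
  by rewrite (negPf (nspan _ _)).
have [_ t20] : 0 = 0 :> R /\ t2 = 0 by apply: (k_eq0 k2); rewrite scale0r add0r -Xbf1.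
have [u20 _] : u2 = 0 /\ 0 = 0 :> R by apply: (k_eq0 k3); rewrite scale0r addr0 -Xcf1.
have [_ t10] : 0 = 0 :> R /\ t1 = 0 by apply: (kf_eq0 l2); rewrite scale0r add0r -Xbd2.
have [u10 _] : u1 = 0 /\ 0 = 0 :> R by apply: (kf_eq0 l3); rewrite scale0r addr0 -Xcd2.
exact: done_a.
Qed.

(** When not all vectors are parallel, [P1] makes two nonparallel ones share an end [a], and [P2]
    supplies a third nonzero vector at [a], since otherwise [X a c] would be a multiple of [X a b].
    This is the input of [classify_core]. *)
Lemma classify : #|T| = 5%N ->
  [\/ exists2 m, m \in T & vanishing_off m,
      exists i0 j0, [/\ i0 \in T, j0 \in T &
        forall i j, i \in T -> j \in T -> i != j -> (X i j <= X i0 j0)%MS]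
    | exists t a b c d f, t != 0 /\ quadrangle t a b c d f].
Proof.
move=> T5.
have core a b c : uniq [:: a; b; c] -> a \in T -> b \in T -> c \in T ->
    X a b != 0 -> ~~ (X a c <= X a b)%MS ->
    [\/ exists2 m, m \in T & vanishing_off m,
      exists i0 j0, [/\ i0 \in T, j0 \in T &
        forall i j, i \in T -> j \in T -> i != j -> (X i j <= X i0 j0)%MS]
    | exists t a b c d f, t != 0 /\ quadrangle t a b c d f].
  move=> U aT bT cT Xab Xac.
  have [d [f [df dfE]]] : exists d f, d != f /\ T :\: [set a; b; c] = [set d; f].
    apply/cards2P; rewrite cardsD (setIidPr _); last first.
      by apply/subsetP => x; rewrite !inE -orbA => /or3P[] /eqP ->.
    move: U; rewrite T5 /= !inE negb_or => /and3P[/andP[ab ac] bc _].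
    by rewrite setUC cardsU1 !inE cards2 ab (eq_sym c a) (eq_sym c b) (negPf ac) (negPf bc).
  have /setDP[dT dN] : d \in T :\: [set a; b; c] by rewrite dfE set21.
  have /setDP[fT fN] : f \in T :\: [set a; b; c] by rewrite dfE set22.
  have TE x : x \in T -> x \in [:: a; b; c; d; f].
    move=> xT; have : (x \in T :\: [set a; b; c]) = (x \in [set d; f]) by rewrite dfE.
    rewrite !inE xT andbT -!orbA.
    by case: (x == a); case: (x == b); case: (x == c) => //= ->.
  move: U dN fN; rewrite /= !inE !negb_or -!andbA.
  move=> /and4P[ab ac bc _] /and3P[da db dc] /and3P[fa fb fc].
  have [Xad|Xad] := eqVneq (X a d) 0; last first.
    have U5 : uniq [:: a; b; c; d; f] by uniq5.
    have [va|[t t0 Q]] := classify_core U5 aT bT cT dT fT TE Xab Xac Xad.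
      by constructor 1; exists a.
    by constructor 3; exists t, a, b, c, d, f.
  have [Xaf|Xaf] := eqVneq (X a f) 0.
    have /sub_rVP[k kE] : ((X a c + X a d + X a f)%R <= X a b)%MS by apply: P2 => //; uniq5.
    by rewrite Xad Xaf !addr0 in kE; rewrite kE scalemx_sub in Xac.
  have TE' : {subset T <= [:: a; b; c; f; d]}.
    by move=> x /TE; rewrite !inE [(x == d) || _]orbC.
  have U5 : uniq [:: a; b; c; f; d] by uniq5.
  have [va|[t t0 Q]] := classify_core U5 aT bT cT fT dT TE' Xab Xac Xaf.
    by constructor 1; exists a.
  by constructor 3; exists t, a, b, c, f, d.
have [|all0] := boolP [exists i, exists j, [&& i \in T, j \in T, i != j & X i j != 0]]; last first.
  have [m mT] : exists m, m \in T by apply/set0Pn; rewrite -card_gt0 T5.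
  constructor 1; exists m => // i j iT jT _ _ ij; apply: contraNeq all0 => Xij.
  by apply/existsP; exists i; apply/existsP; exists j; rewrite iT jT ij.
case/existsP=> i0 /existsP[j0 /and4P[i0T j0T ij0 Xij0]].
have [|par] := boolP [exists i, exists j, [&& i \in T, j \in T, i != j & ~~ (X i j <= X i0 j0)%MS]]; last first.
  constructor 2; exists i0, j0; split=> // i j iT jT ij; apply: contraNT par => Xij.
  by apply/existsP; exists i; apply/existsP; exists j; rewrite iT jT ij.
case/existsP=> i /existsP[j /and4P[iT jT ij Xij]].
have ji0 : j0 != i0 by rewrite eq_sym.
have [ii0|ii0] := eqVneq i i0.
  rewrite ii0 in ij Xij; have jj : j0 != j by apply: contraNneq Xij => ->.
  by apply: (core i0 j0 j) => //; uniq5.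
have [ji|ji] := eqVneq j i0.
  rewrite ji (XC i0 i) in ij Xij; have jj : j0 != i by apply: contraNneq Xij => ->.
  by apply: (core i0 j0 i) => //; uniq5.
rewrite -(XC i0 j0) in Xij0 Xij.
have [ij0'|ij0'] := eqVneq i j0.
  rewrite ij0' in ij Xij ii0; have jj : i0 != j by rewrite eq_sym.
  by apply: (core j0 i0 j) => //; uniq5.
have [jj0|jj0] := eqVneq j j0.
  rewrite jj0 (XC j0 i) in ij Xij ji; have jj : i0 != i by rewrite eq_sym.
  by apply: (core j0 i0 i) => //; uniq5.
rewrite (XC i0 j0) in Xij0 Xij.
have [f fT] : exists f, f \in T :\: [set i0; j0; i; j].
  apply/set0Pn; rewrite -card_gt0 cardsD subn_gt0 T5 ltnS; apply: leq_trans (subset_leq_card (subsetIr _ _)) _.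
  by rewrite -!setUA !cardsU1 cards1 /=; case: (_ \notin _); case: (_ \notin _); case: (_ \notin _).
move: fT; rewrite !inE !negb_or -!andbA => /and5P[fi0 fj0 fi fj fT].
by move: Xij; rewrite (P1 (f := f)) //; uniq5.
Qed.
End Classify.

(** * Loads of a moving star *)

Section Star.
Variables (R : realFieldType) (n : nat) (w : 'I_(n + n) -> R).
Hypothesis gw : alg_indep_Q w.
Implicit Types (i j k l m v a b c d f : 'I_n) (T : {set 'I_n}) (S : {set 'I_n * 'I_n}).

Definition star (w' : 'I_(n + n) -> R) v T : 'M[R]_(n * 3) := (\sum_(j in T) <<erow w' v j>>)%MS.

Lemma er_star (w' : 'I_(n + n) -> R) v T j : j \in T -> (erow w' v j <= star w' v T)%MS.
Proof. by move=> jT; apply: (sumsmx_sup j) => //; rewrite genmxE. Qed.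

Lemma sub_sum_genP (I : finType) (P : {pred I}) N (r : I -> 'rV[R]_N) (u : 'rV_N) :
  (u <= \sum_(t in P) <<r t>>)%MS -> exists c : I -> R, u = \sum_(t in P) c t *: r t.
Proof.
case/sub_sumsmxP => u_ ->.
have /fin_all_exists[c cE] (t : I) : exists x, u_ t *m <<r t>>%MS = x *: r t.
  by apply/sub_rVP; rewrite (submx_trans (submxMl _ _)) ?genmxE.
by exists c; apply: eq_bigr.
Qed.

(** For rows the [K5] combinations of [load_span] vanish, so its generator space is taken to be
    0. *)
Lemma load_er v T (c : 'I_n -> R) : v \notin T -> \sum_(j in T) c j *: dv w v j = 0 ->
  ((\sum_(j in T) c j *: erow w v j)%R <= rspan w (setX T T))%MS.
Proof.
move=> vT E; have := @load_span _ _ w gw _ (erow w) 0 v T c vT _ E.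
rewrite adds0mx; apply=> i j k l iT jT kT lT U.
by rewrite /K5comb (K5_er gw) ?sub0mx.
Qed.

(** The star part of a vector without load at [v] is itself balanced at [v], so [load_er] turns it
    into pairs of neighbours. *)
Lemma star_ker v T (U : 'M[R]_(n * 3)) : v \notin T -> U *m blk R v = 0 ->
  ((U + star w v T) :&: kermx (blk R v) <= U + rspan w (setX T T))%MS.
Proof.
move=> vT U0; apply/rV_subP => u; rewrite sub_capmx => /andP[/sub_addsmxP[[a b] /= uE] /sub_kermxP].
have /sub_sum_genP[c cE] : (b *m star w v T <= star w v T)%MS by rewrite submxMl.
rewrite uE cE mulmxDl -mulmxA U0 mulmx0 add0r mulmx_suml => E.
apply: submx_trans (addsmxS (submxMl a U) (submx_refl _)).
apply: addmx_sub_adds => //; apply: load_er => //.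
rewrite -[RHS]E; apply: eq_bigr => j _.
by rewrite -scalemxAl er_blk eqxx.
Qed.

(** Loads at [v] take up at most 3 dimensions, so the vectors of [A] without load have at least the
    rank of [U + rspan w (setX T T)]. By [star_ker] they lie in that space, hence fill it. This is
    how pairs of neighbours get into a closure. *)
Lemma star_absorb v T (U : 'M[R]_(n * 3)) : v \notin T -> U *m blk R v = 0 ->
  (\rank (U + rspan w (setX T T)) + 3 <= \rank (U + star w v T)%MS)%N ->
  (U + rspan w (setX T T) <= U + star w v T)%MS.
Proof.
move=> vT U0; set A := (U + star w v T)%MS => rk.
have le := star_ker vT U0; rewrite -/A in le.
suff: (U + rspan w (setX T T) <= A :&: kermx (blk R v))%MS.
  by move/submx_trans; apply; apply: capmxSl.
rewrite -(geq_leqif (mxrank_leqif_sup le)).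
have := mxrank_mul_ker A (blk R v); have := rank_leq_col (A *m blk R v).
by lia.
Qed.

(** When [v] is on the line [cd], the two squared directions at [v] are proportional, so the
loads cancel there. *)
Lemma line_load v x y c d : c != v -> d != v -> c != d ->
  br (move_vertex w v x y) v c d = 0 -> x != px w c -> x != px w d ->
  (erow w c d <= <<erow (move_vertex w v x y) v c>> + <<erow (move_vertex w v x y) v d>>)%MS.
Proof.
move=> cv dv' cd; set w' := move_vertex w v x y => col xc xd.
pose X1 := x - px w c; pose X2 := x - px w d; pose z := px w c - px w d.
have z0 : z != 0 by rewrite subr_eq0 (px_neq gw).
have [X10 X20] : X1 != 0 /\ X2 != 0 by rewrite !subr_eq0.
have pv : (px w' v = x) * (py w' v = y) by rewrite /w' px_mv py_mv eqxx.
have pc : (px w' c = px w c) * (py w' c = py w c) by rewrite /w' px_mv py_mv (negPf cv).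
have pd : (px w' d = px w d) * (py w' d = py w d) by rewrite /w' px_mv py_mv (negPf dv').
have E : erow w c d = (z ^+ 2 / X2 ^+ 2) *: erow w' v d - (z ^+ 2 / X1 ^+ 2) *: erow w' v c.
  have colE : X1 * (y - py w d) = X2 * (y - py w c).
    by move: col; rewrite /br !pv !pc !pd /X1 /X2; lra.
  (* [s] is the parameter of [v] on the line, with [c] at 0 and [d] at 1; the squared directions at
     [v] are then [s^2] and [(1 - s)^2] times that of [cd]. *)
  have [s [xE yE]] : exists s, x = px w c + s * (px w d - px w c) /\ y = py w c + s * (py w d - py w c).
    exists (- X1 / z); split; first by rewrite /X1 /z; field; rewrite subr_eq0 (px_neq gw).
    apply: (mulfI z0); transitivity (z * py w c - X1 * (py w d - py w c)); last by field.
    by move: colE; rewrite /X1 /X2 /z; lra.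
  have X1E : X1 = - (s * z) by rewrite /X1 xE /z; ring.
  have X2E : X2 = (1 - s) * z by rewrite /X2 xE /z; ring.
  have s0 : s != 0 by apply: contraNneq X10 => s0; rewrite X1E s0 mul0r oppr0.
  have s1 : 1 - s != 0 by apply: contraNneq X20 => s1; rewrite X2E s1 mul0r.
  have -> : z ^+ 2 / X2 ^+ 2 = (1 - s) ^- 2 by rewrite X2E; field; rewrite s1 z0.
  have -> : z ^+ 2 / X1 ^+ 2 = s ^- 2 by rewrite X1E; field; rewrite s0 z0.
  have dc : dv w' v c = s ^+ 2 *: dv w c d.
    by apply/rowP => k; rewrite !mxE /Dvec !pv !pc xE yE; case: (k == 0); [|case: (k == 1)]; ring.
  have dd : dv w' v d = (1 - s) ^+ 2 *: dv w c d.
    by apply/rowP => k; rewrite !mxE /Dvec !pv !pd xE yE; case: (k == 0); [|case: (k == 1)]; ring.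
  apply/eqP; rewrite -subr_eq0; apply/eqP/blk_inj => u.
  rewrite !mulmxBl -!scalemxAl !er_blk dc dd.
  have [->|uv] := eqVneq u v.
    by rewrite eq_sym (negPf cv) eq_sym (negPf dv') !scalerA !mulVf ?expf_eq0 ?s0 ?s1 // subrr subr0.
  have [->|uc] := eqVneq u c.
    by rewrite (negPf cd) scaler0 sub0r opprK scalerN scalerA mulVf ?expf_eq0 // scale1r subrr.
  have [_|_] := eqVneq u d; last by rewrite !scaler0 !subr0.
  by rewrite scaler0 subr0 scalerN scalerA mulVf ?expf_eq0 // scale1r subrr.
rewrite E addrC addmx_sub_adds ?eqmx_opp ?scalemx_sub ?genmxE //.
Qed.

Lemma br_line v s a b i j : i != v -> j != v ->
  br (move_vertex w v ((1 - s) * px w a + s * px w b) ((1 - s) * py w a + s * py w b)) v i j =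
  (1 - s) * br w a i j + s * br w b i j.
Proof.
move=> /negPf iv /negPf jv; rewrite /br !px_mv !py_mv eqxx iv jv; ring.
Qed.

Lemma br_aab a b : br w a a b = 0.
Proof. by rewrite /br; ring. Qed.

Lemma br_aba a b : br w a b a = 0.
Proof. by rewrite /br; ring. Qed.

Lemma br_baa a b : br w b a a = 0.
Proof. by rewrite /br; ring. Qed.

Lemma genpos_mv v x y (s : seq 'I_n) : v \notin s ->
  {in s &, forall j k, j != k -> br (move_vertex w v x y) v j k != 0} -> genpos (move_vertex w v x y) (v :: s).
Proof.
move=> vs H i j k; rewrite !inE.
have sv t : t \in s -> t != v by move=> ts; apply: contraNneq vs => <-.
move=> /predU1P[->|iS] /predU1P[->|jS] /predU1P[->|kS]; rewrite /= !inE ?eqxx ?orbT ?andbF //;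
  rewrite negb_or => /and3P[/andP[ij ik] jk _].
- exact: H.
- by rewrite br_swap oppr_eq0; apply: H.
- by rewrite br_cyc; apply: H.
- by rewrite br_mv ?sv // br_neq0 //= !inE negb_or ij ik jk.
Qed.

(** A nonzero multiple of [X_ab - X_cd], for [X] the rows scaled by their coefficients in the
[K5] relation on [a, b, c, d, f]. *)
Definition rho (w' : 'I_(n + n) -> R) a b c d f : 'rV[R]_(n * 3) :=
  (br w' c d a * br w' c d b * br w' c d f) *: erow w' a b
  - (br w' a b c * br w' a b d * br w' a b f) *: erow w' c d.

Section Loc.
Variables (v : 'I_n) (T : {set 'I_n}) (U : 'M[R]_(n * 3)).
Hypothesis vT : v \notin T.
Hypothesis U0 : U *m blk R v = 0.
Hypothesis H : forall x y, (\rank (U + star (move_vertex w v x y) v T)%MS <= \rank U + 4)%N.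

(** The quotient by [U] in coordinates: [cokermx U] has kernel [U], and membership modulo one more
    row becomes proportionality ([cls_sub]). *)
Definition cls (x : 'rV[R]_(n * 3)) : 'rV[R]_(n * 3) := x *m cokermx U.

Lemma cls_eq0 x : (cls x == 0) = (x <= U)%MS.
Proof. by rewrite submxE. Qed.

Lemma clsD x y : cls (x + y) = cls x + cls y. Proof. exact: mulmxDl. Qed.
Lemma clsZ (t : R) x : cls (t *: x) = t *: cls x. Proof. by rewrite /cls scalemxAl. Qed.

Lemma cls_sub x y : (y <= U + <<x>>)%MS = (cls y <= cls x)%MS.
Proof.
apply/idP/sub_rVP => [/sub_addsmxP[[p q] /= yE]|[k yE]].
  have /sub_rVP[k kE] : (q *m <<x>>%MS <= x)%MS by rewrite (submx_trans (submxMl _ _)) ?genmxE.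
  exists k; rewrite yE kE clsD clsZ.
  have /eqP -> : cls (p *m U) == 0 by rewrite cls_eq0 submxMl.
  by rewrite add0r.
rewrite -[y](subrK (k *: x)) addmx_sub_adds ?scalemx_sub ?genmxE //.
by rewrite -cls_eq0 clsD -scaleN1r !clsZ yE scalerA mulN1r scaleNr subrr.
Qed.

Let nv i : i \in T -> i != v.
Proof. by move=> iT; apply: contraNneq vT => <-. Qed.

(** Of the at most 4 dimensions that the star adds to [U], three are loads at [v]; so the vectors
    without load fill at most one dimension modulo [U]. *)
Lemma loads_dependent x y u1 u2 i j k : i \in T -> j \in T -> k \in T ->
  let w' := move_vertex w v x y in
  br w' v i j != 0 -> br w' v i k != 0 -> br w' v j k != 0 ->
  u1 *m blk R v = 0 -> u2 *m blk R v = 0 ->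
  (u1 <= U + star w' v T)%MS -> (u2 <= U + star w' v T)%MS ->
  cls u1 != 0 -> (cls u2 <= cls u1)%MS.
Proof.
move=> iT jT kT w' ij ik jk b1 b2 s1 s2; rewrite cls_eq0 -cls_sub => u1U.
pose A := (U + <<u1>> + <<u2>>)%MS.
have AS : (A <= U + star w' v T)%MS by rewrite !addsmx_sub addsmxSl !genmxE s1 s2.
have sv t : t \in T -> v != t by rewrite eq_sym; exact: nv.
have A0 : A *m blk R v = 0.
  by apply/sub_kermxP; rewrite !addsmx_sub !genmxE; apply/andP; split; [apply/andP; split|]; apply/sub_kermxP.
have sS t : t \in T -> (erow w' v t <= U + star w' v T)%MS.
  by move=> tT; rewrite (submx_trans (er_star w' v tT)) ?addsmxSr.
have rkA := star_rank (sv _ iT) (sv _ jT) (sv _ kT) A0 AS (sS _ iT) (sS _ jT) (sS _ kT) ij ik jk.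
have lt1 : (U < U + <<u1>>)%MS.
  by rewrite /ltmx addsmxSl addsmx_sub submx_refl genmxE.
have rk1 := rank_ltmx lt1; have H' := H x y; rewrite -/w' in H'.
have le1 : (U + <<u1>> <= A)%MS by rewrite addsmxSl.
suff : (A <= U + <<u1>>)%MS by rewrite addsmx_sub genmxE => /andP[].
rewrite -(geq_leqif (mxrank_leqif_sup le1)); move: rkA rk1 H'.
by move: (\rank _) (\rank _) (\rank _) (\rank _) => r1 r2 r3 r4; clear; lia.
Qed.

Lemma er_blk0 i j : i \in T -> j \in T -> erow w i j *m blk R v = 0.
Proof. by move=> /nv iv /nv jv; rewrite er_blk !(eq_sym v) (negPf iv) (negPf jv). Qed.

(** Were [x] the abscissa of [c], then [v] would sit at [c], as the line [cd] is not vertical, and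
    [c] would lie on the line [eg]. This supplies the side conditions of [line_load]. *)
Lemma collinear_px x y c d e g : c \in T -> d \in T -> e \in T -> g \in T ->
  uniq [:: c; d; e; g] -> br (move_vertex w v x y) v c d = 0 -> br (move_vertex w v x y) v e g = 0 ->
  x != px w c.
Proof.
move=> cT dT eT gT Uc cold colg; apply/eqP => xE.
move: (Uc); rewrite /= !inE !negb_or => /and4P[/and3P[cd ce cg] /andP[de dg] eg _].
have [vx vy] : px (move_vertex w v x y) v = x /\ py (move_vertex w v x y) v = y by rewrite px_mv py_mv eqxx.
have op t : t \in T -> px (move_vertex w v x y) t = px w t /\ py (move_vertex w v x y) t = py w t.
  by move=> /nv/negPf tv; rewrite px_mv py_mv tv.
have [[cx cy] [dx dy]] := (op _ cT, op _ dT); have [[ex ey] [gx gy]] := (op _ eT, op _ gT).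
have yE : y = py w c.
  have dc0 : px w d - px w c != 0 by rewrite subr_eq0 (px_neq gw) // eq_sym.
  apply: (mulfI dc0); move: cold; rewrite /br vx vy cx cy dx dy xE; lra.
have : br w c e g != 0 by rewrite br_neq0 //= !inE negb_or ce cg eg.
by rewrite -colg /br vx vy ex ey gx gy xE yE eqxx.
Qed.

(** With [v] at the intersection of the lines [ab] and [cd], the star spans both rows by
    [line_load], and [loads_dependent] applies. *)
Lemma disjoint_parallel a b c d f : uniq [:: a; b; c; d; f] ->
  a \in T -> b \in T -> c \in T -> d \in T -> f \in T ->
  cls (erow w a b) != 0 -> (cls (erow w c d) <= cls (erow w a b))%MS.
Proof.
move=> U5 aT bT cT dT fT.
move: (U5); rewrite /= !inE !negb_or => /and5P[/and4P[ab ac ad af] /and3P[bc bd bf] /andP[cd cf] df _].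
(* [s] below is the parameter on [ab] at which the bracket with [c, d] vanishes; [D] is nonzero
   because the lines are not parallel. *)
pose D := br w a c d - br w b c d.
have D0 : D != 0.
  have := @br_comb_neq0 _ _ w gw 1 (-1) a b c d isT; rewrite rmorph1 rmorphN1 mul1r mulN1r.
  by apply; uniq5.
have acd : br w a c d != 0 by apply: br_neq0 => //; uniq5.
have bcd : br w b c d != 0 by apply: br_neq0 => //; uniq5.
pose s := br w a c d / D.
have s1 : 1 - s = - br w b c d / D by rewrite /s /D; field.
have s0 : s != 0 by rewrite mulf_neq0 ?invr_eq0.
have s10 : 1 - s != 0 by rewrite s1 mulf_neq0 ?invr_eq0 ?oppr_eq0.
pose x := (1 - s) * px w a + s * px w b; pose y := (1 - s) * py w a + s * py w b.
have brp i j : i \in T -> j \in T -> br (move_vertex w v x y) v i j = (1 - s) * br w a i j + s * br w b i j.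
  by move=> iT jT; rewrite /x /y br_line ?nv.
have colab : br (move_vertex w v x y) v a b = 0 by rewrite brp // br_aab br_aba !mulr0 addr0.
have colcd : br (move_vertex w v x y) v c d = 0 by rewrite brp // s1 /s; field.
have px' i j k l : i \in T -> j \in T -> k \in T -> l \in T -> uniq [:: i; j; k; l] ->
   br (move_vertex w v x y) v i j = 0 -> br (move_vertex w v x y) v k l = 0 -> x != px w i.
  exact: collinear_px.
have sw i j : br (move_vertex w v x y) v i j = 0 -> br (move_vertex w v x y) v j i = 0.
  by move=> E; rewrite br_swapr E oppr0.
have ld i j : i \in T -> j \in T -> i != j -> br (move_vertex w v x y) v i j = 0 -> x != px w i -> x != px w j ->
    (erow w i j <= U + star (move_vertex w v x y) v T)%MS.
  move=> iT jT ij col xi xj; apply: submx_trans (line_load (nv iT) (nv jT) ij col xi xj) _.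
  rewrite addsmx_sub !genmxE; apply/andP; split.
    exact: submx_trans (er_star _ _ iT) (addsmxSr _ _).
  exact: submx_trans (er_star _ _ jT) (addsmxSr _ _).
apply: (@loads_dependent x y _ _ a c f) => //; rewrite ?er_blk0 //.
- by rewrite brp // br_aab mulr0 add0r mulf_neq0 // br_neq0 //; uniq5.
- by rewrite brp // br_aab mulr0 add0r mulf_neq0 // br_neq0 //; uniq5.
- rewrite brp //; have -> : (1 - s) * br w a c f + s * br w b c f = br w a b c * br w c d f / D.
    by rewrite s1 /s; move: D0; rewrite /D /br => D0; field.
  by rewrite !mulf_neq0 ?invr_eq0 // br_neq0 //; uniq5.
- apply: ld => //.
    by apply: (px' a b c d) => //; uniq5.
  by apply: (px' b a c d) => //; [uniq5 | exact: sw].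
apply: ld => //.
  by apply: (px' c d a b) => //; uniq5.
by apply: (px' d c a b) => //; [uniq5 | exact: sw].
Qed.

(** The edges at [v] of a [K5] relation are in the star, so the combination of the other six is
    spanned as well. The placement is arbitrary, as long as it is in general position. *)
Lemma K5_load (w' : 'I_(n + n) -> R) i j k l : uniq [:: v; i; j; k; l] ->
  i \in T -> j \in T -> k \in T -> l \in T -> genpos w' [:: v; i; j; k; l] ->
  ((kap w' i j v k l *: erow w' i j + kap w' i k v j l *: erow w' i k + kap w' i l v j k *: erow w' i l
   + kap w' j k v i l *: erow w' j k + kap w' j l v i k *: erow w' j l + kap w' k l v i j *: erow w' k l)%R
   <= U + star w' v T)%MS.
Proof.
move=> U5 iT jT kT lT G; have := K5_relation U5 G.
set sg := (X in (_ <= X)%MS).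
have st t (z : R) : t \in T -> (z *: erow w' v t <= sg)%MS.
  by move=> tT; rewrite scalemx_sub // (submx_trans (er_star w' v tT)) ?addsmxSr.
move=> E; set P := (X in (X <= _)%MS).
pose s4 := kap w' v i j k l *: erow w' v i + kap w' v j i k l *: erow w' v j
  + kap w' v k i j l *: erow w' v k + kap w' v l i j k *: erow w' v l.
have s4s : (s4 <= sg)%MS by rewrite !addmx_sub ?st.
have /eqP : s4 + P = 0 by rewrite /P !addrA.
by rewrite addr_eq0 => /eqP sE; rewrite -eqmx_opp -sE.
Qed.

(** With [v] at the midpoint of [ab], the row of [ab] is one load. The [K5] on [v, a, c, d, f] gives
    another, whose pairs among [c, d, f] are parallel to [ab] by [disjoint_parallel], and whose
    other three coefficients are those of the [K5] on [a, b, c, d, f] up to a common factor. *)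
Lemma midpoint_sum a b c d f : uniq [:: a; b; c; d; f] ->
  a \in T -> b \in T -> c \in T -> d \in T -> f \in T ->
  cls (erow w a b) != 0 ->
  ((kap w a c b d f *: cls (erow w a c) + kap w a d b c f *: cls (erow w a d)
    + kap w a f b c d *: cls (erow w a f))%R <= cls (erow w a b))%MS.
Proof.
move=> U5 aT bT cT dT fT ab0.
move: (U5); rewrite /= !inE !negb_or => /and5P[/and4P[ab ac ad af] /and3P[bc bd bf] /andP[cd cf] df _].
pose s : R := 2^-1; have s1 : 1 - s = 2^-1 by rewrite /s; field.
pose x := (1 - s) * px w a + s * px w b; pose y := (1 - s) * py w a + s * py w b.
have h0 : 2^-1 != 0 :> R by rewrite invr_eq0 pnatr_eq0.
have brp i j : i \in T -> j \in T -> br (move_vertex w v x y) v i j = 2^-1 * (br w a i j + br w b i j).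
  by move=> iT jT; rewrite /x /y br_line ?nv // s1 /s -mulrDr.
have [va [vb [vc [vd vf]]]] : a != v /\ b != v /\ c != v /\ d != v /\ f != v by rewrite !nv.
have brpa i : i \in T -> br (move_vertex w v x y) v a i = 2^-1 * br w b a i.
  by move=> iT; rewrite brp // br_aab add0r.
have colab : br (move_vertex w v x y) v a b = 0 by rewrite brpa // br_aba mulr0.
have vs : v \notin [:: a; c; d; f] by uniq5.
have brcd i j : i \in [:: c; d; f] -> j \in [:: c; d; f] -> i != j -> br (move_vertex w v x y) v i j != 0.
  move=> iS jS ij; have inT t : t \in [:: c; d; f] -> t \in T by rewrite !inE => /or3P[] /eqP ->.
  rewrite brp ?inT // mulf_neq0 //.
  have := @br_comb_neq0 _ _ w gw 1 1 a b i j isT; rewrite rmorph1 !mul1r; apply.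
  have na t : t \in [:: c; d; f] -> a != t /\ b != t.
    by rewrite !inE => /or3P[] /eqP ->.
  by have [[ai bi] [aj bj]] := (na _ iS, na _ jS); uniq5.
have ba t : t \in [:: c; d; f] -> br (move_vertex w v x y) v a t != 0.
  move=> tS; have tT : t \in T by move: tS; rewrite !inE => /or3P[] /eqP ->.
  rewrite brpa // mulf_neq0 // br_neq0 //; move: tS; rewrite !inE => /or3P[] /eqP ->; uniq5.
have G : genpos (move_vertex w v x y) [:: v; a; c; d; f].
  apply: genpos_mv => // i j; rewrite inE => /predU1P[->|iS]; rewrite inE => /predU1P[->|jS] ij.
  - by rewrite eqxx in ij.
  - exact: ba.
  - by rewrite br_swapr oppr_eq0 ba.
  - exact: brcd.
have U5' : uniq [:: v; a; c; d; f] by uniq5.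
have := K5_load U5' aT cT dT fT G.
rewrite !er_mv //.
(* At the midpoint [br v a i] is half of [br b a i], so [v] plays the part of [b] up to the factor
   2. *)
have kE i j k : i \in [:: c; d; f] -> j != v -> k != v ->
    kap (move_vertex w v x y) a i v j k = 2 * kap w a i b j k.
  move=> iS jv kv; have iT : i \in T by move: iS; rewrite !inE => /or3P[] /eqP ->.
  rewrite /kap (br_mv _ _ _ va (nv iT) jv) (br_mv _ _ _ va (nv iT) kv).
  by rewrite br_cyc brpa // -br_cyc -mulrA -mulrA !invfM invrK !mulrA.
rewrite !kE ?inE ?eqxx ?orbT //.
set ld := (X in (X <= _)%MS) => ldS.
have ldcls : (cls ld <= cls (erow w a b))%MS.
  apply: (@loads_dependent x y _ _ a c d) => //; rewrite ?er_blk0 //; rewrite ?ba ?brcd ?inE ?eqxx ?orbT //.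
    by rewrite /ld !mulmxDl -!scalemxAl !er_blk0 // !scaler0 !addr0.
  have xa : x != px w a.
    by rewrite /x s1 /s -subr_eq0 (_ : _ - _ = 2^-1 * (px w b - px w a)) ?mulf_neq0 // ?subr_eq0 ?(px_neq gw) 1?eq_sym //; field.
  have xb : x != px w b.
    by rewrite /x s1 /s -subr_eq0 (_ : _ - _ = 2^-1 * (px w a - px w b)) ?mulf_neq0 // ?subr_eq0 ?(px_neq gw) //; field.
  apply: submx_trans (line_load va vb ab colab xa xb) _.
  rewrite addsmx_sub !genmxE; apply/andP; split.
    exact: submx_trans (er_star _ _ aT) (addsmxSr _ _).
  exact: submx_trans (er_star _ _ bT) (addsmxSr _ _).
have cd_par : (cls (erow w c d) <= cls (erow w a b))%MS by apply: (disjoint_parallel (f := f)).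
have cf_par : (cls (erow w c f) <= cls (erow w a b))%MS by apply: (disjoint_parallel (f := d)) => //; uniq5.
have df_par : (cls (erow w d f) <= cls (erow w a b))%MS by apply: (disjoint_parallel (f := c)) => //; uniq5.
set goal := (X in (X <= _)%MS).
have -> : goal = 2^-1 *: (cls ld - (kap (move_vertex w v x y) c d v a f *: cls (erow w c d)
   + kap (move_vertex w v x y) c f v a d *: cls (erow w c f) + kap (move_vertex w v x y) d f v a c *: cls (erow w d f))).
  rewrite /ld !clsD !clsZ -!addrA opprD !addrA.
  by apply/rowP => t; rewrite /goal !mxE; field.
apply: scalemx_sub; apply: addmx_sub => //; rewrite eqmx_opp.
by apply: addmx_sub; [apply: addmx_sub|]; apply: scalemx_sub.
Qed.

End Loc.
End Star.

(** * Classification of loads on five neighbours *)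

Section LocalClassification.
Variables (R : realFieldType) (n : nat) (w : 'I_(n + n) -> R).
Hypothesis gw : alg_indep_Q w.
Variables (v : 'I_n) (T : {set 'I_n}) (U : 'M[R]_(n * 3)).
Hypothesis vT : v \notin T.
Hypothesis U0 : U *m blk R v = 0.
Hypothesis H : forall x y, (\rank (U + star (move_vertex w v x y) v T)%MS <= \rank U + 4)%N.
Hypothesis T5 : #|T| = 5%N.
Implicit Types i j k l m a b c d f : 'I_n.

Notation cls := (cls U).

Let nv i : i \in T -> i != v.
Proof. by move=> iT; apply: contraNneq vT => <-. Qed.

(** The class of a row scaled by [kap], with a product over the rest of [T] so that no order of
    these vertices is chosen. The sign of three brackets cancels that of [erow], which makes it
    symmetric. *)
Definition ncls i j : 'rV[R]_(n * 3) :=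
  if [&& i \in T, j \in T & i != j]
  then (\prod_(k in T :\ i :\ j) br w i j k)^-1 *: cls (erow w i j) else 0.

Lemma nclsC i j : ncls j i = ncls i j.
Proof.
rewrite /ncls eq_sym andbCA; case: ifP => // /and3P[iT jT ij].
have -> : T :\ j :\ i = T :\ i :\ j by rewrite !setDDl setUC.
have cT : #|T :\ i :\ j| = 3%N.
  by move: T5; rewrite (cardsD1 i) iT (cardsD1 j) !inE (eq_sym j) ij jT !add1n => -[->].
have -> : \prod_(k in T :\ i :\ j) br w j i k = - \prod_(k in T :\ i :\ j) br w i j k.
  under eq_bigr do rewrite br_swap -mulN1r.
  by rewrite big_split /= prodr_const cT -signr_odd /= expr1 mulN1r.
by rewrite erN /cls mulNmx invrN scaleNr scalerN opprK.
Qed.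

Lemma nclsE a b c d f : uniq [:: a; b; c; d; f] ->
  a \in T -> b \in T -> c \in T -> d \in T -> f \in T ->
  ncls a b = kap w a b c d f *: cls (erow w a b).
Proof.
move=> U5 aT bT cT dT fT.
move: (U5); rewrite /= !inE !negb_or => /and5P[/and4P[ab ac ad af] /and3P[bc bd bf] /andP[cd cf] df _].
rewrite /ncls aT bT ab /kap /=; congr (_^-1 *: _).
have -> : T :\ a :\ b = [set c; d; f].
  apply/esym/eqP; rewrite eqEcard; apply/andP; split.
    apply/subsetP => z; rewrite !inE -orbA => /or3P[] /eqP ->;
      rewrite ?cT ?dT ?fT andbT; by apply/andP; split; rewrite eq_sym.
  move: T5; rewrite (cardsD1 a) aT (cardsD1 b) !inE bT (eq_sym b) ab !add1n => -[->].
  by rewrite -setUA !cardsU1 cards1 !inE (negPf df) negb_or cd cf.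
rewrite -setUA !big_setU1 ?inE ?negb_or ?cd ?cf ?df //= big_set1 mulrA.
by [].
Qed.

(** The hypothesis [H] speaks of moved placements; the original position is recovered as the move of
    [v] to its own place. *)
Lemma er_mv_id i j : erow (move_vertex w v (px w v) (py w v)) i j = erow w i j.
Proof.
apply/eqP; rewrite -subr_eq0; apply/eqP/blk_inj => u; rewrite mulmxBl !er_blk.
suff -> : dv (move_vertex w v (px w v) (py w v)) i j = dv w i j by rewrite subrr.
have p z : px (move_vertex w v (px w v) (py w v)) z = px w z by rewrite px_mv; case: eqP => // ->.
have q z : py (move_vertex w v (px w v) (py w v)) z = py w z by rewrite py_mv; case: eqP => // ->.
by apply/rowP => k; rewrite !mxE /Dvec !p !q.
Qed.

Lemma br_mv_id i j k : br (move_vertex w v (px w v) (py w v)) i j k = br w i j k.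
Proof.
have p z : px (move_vertex w v (px w v) (py w v)) z = px w z by rewrite px_mv; case: eqP => // ->.
have q z : py (move_vertex w v (px w v) (py w v)) z = py w z by rewrite py_mv; case: eqP => // ->.
by rewrite /br !p !q.
Qed.

Lemma lin_indep2 N (al be : 'rV[R]_N) x y : al != 0 -> ~~ (be <= al)%MS ->
  x *: al + y *: be = 0 -> x = 0 /\ y = 0.
Proof.
move=> al0 be_al E; have y0 : y = 0.
  apply: contraNeq be_al => y0; apply/sub_rVP; exists (- (x / y)).
  move/rowP: E => E; apply/rowP => i; move: (E i); rewrite !mxE => Ei.
  by apply: (mulfI y0); transitivity (- (x * al 0 i)); [lra | field].
move: E; rewrite y0 scale0r addr0 => /eqP; rewrite scaler_eq0 (negPf al0) orbF => /eqP ->.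
by [].
Qed.

(** The test is now the original position of [v]. The [K5]s on [v] with [a, b, c, f] and with
    [a, b, d, f] give two dependent loads, whose coordinates with respect to [al] and [be] have
    determinant [t (t - 1)] times a nonzero factor. *)
Lemma quadrangle_ratio t a b c d f : t != 0 -> quadrangle T ncls t a b c d f -> t = 1.
Proof.
move=> t0 [U5 [aT bT cT dT fT] [Xaf Xbf Xcf Xdf] [Xcd Xbd Xad Xbc] [al0 be_al]].
move: (U5); rewrite /= !inE !negb_or => /and5P[/and4P[ab ac ad af] /and3P[bc bd bf] /andP[cd cf] df _].
have [va [vb [vc [vd vf]]]] : a != v /\ b != v /\ c != v /\ d != v /\ f != v by rewrite !nv.
pose w' := move_vertex w v (px w v) (py w v).
have G s : genpos w' s by move=> i j k _ _ _ ijk; rewrite br_mv_id br_neq0.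
have bn i j k : i \in T -> j \in T -> k \in T -> uniq [:: i; j; k] -> br w i j k != 0.
  by move=> *; apply: br_neq0.
have Ud : uniq [:: v; a; b; c; f] by uniq5.
have Uc : uniq [:: v; a; b; d; f] by uniq5.
have Ld := K5_load U Ud aT bT cT fT (G _).
have Lc := K5_load U Uc aT bT dT fT (G _).
rewrite !er_mv_id in Ld Lc.
(* Replacing the vertex [z] of [T] by [v] changes [kap] by a ratio of two brackets. *)
have kE i j x y z : i \in T -> j \in T -> uniq [:: i; j; x; y; z] ->
    kap w' i j v x y = (br w i j z / br w i j v) * kap w i j x y z.
  move=> iT jT /=; rewrite !inE !negb_or => /and5P[/and4P[ij ix iy iz] /and3P[jx jy jz] _ _ _].
  have n1 : br w i j v != 0 by apply: br_neq0; rewrite //= !inE negb_or ij !nv.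
  have n2 : br w i j x != 0 by apply: br_neq0; rewrite //= !inE negb_or ij ix jx.
  have n3 : br w i j y != 0 by apply: br_neq0; rewrite //= !inE negb_or ij iy jy.
  have n4 : br w i j z != 0 by apply: br_neq0; rewrite //= !inE negb_or ij iz jz.
  by rewrite /kap !br_mv_id; field; rewrite n1 n2 n3 n4.
have kcls i j x y z : i \in T -> j \in T -> x \in T -> y \in T -> z \in T -> uniq [:: i; j; x; y; z] ->
    kap w' i j v x y *: cls (erow w i j) = (br w i j z / br w i j v) *: ncls i j.
  move=> iT jT xT yT zT Uz; rewrite (kE _ _ _ _ z) // -scalerA; congr (_ *: _).
  by rewrite -(nclsE Uz).
set ld := (X in (X <= _)%MS) in Ld; set lc := (X in (X <= _)%MS) in Lc.
set al := ncls a b in al0 be_al Xcd Xad Xbc; set be := ncls a c in be_al Xbd Xad Xbc.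
pose A1 := br w a b d / br w a b v - t * (br w b c d / br w b c v).
pose A2 := br w a c d / br w a c v - t * (br w b c d / br w b c v).
pose B1 := br w a b c / br w a b v - br w a d c / br w a d v.
pose B2 := - (br w a d c / br w a d v) + t * (br w b d c / br w b d v).
have ldE : cls ld = A1 *: al + A2 *: be.
  rewrite /ld !clsD !clsZ.
  rewrite (kcls a b c f d aT bT cT fT dT (ltac:(uniq5))) (kcls a c b f d aT cT bT fT dT (ltac:(uniq5)))
    (kcls a f b c d aT fT bT cT dT (ltac:(uniq5))) (kcls b c a f d bT cT aT fT dT (ltac:(uniq5)))
    (kcls b f a c d bT fT aT cT dT (ltac:(uniq5))) (kcls c f a b d cT fT aT bT dT (ltac:(uniq5))).
  rewrite Xaf Xbf Xcf Xbc !scaler0 !addr0 -/al -/be.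
  by apply/rowP => z; rewrite /A1 /A2 !mxE; ring.
have lcE : cls lc = B1 *: al + B2 *: be.
  rewrite /lc !clsD !clsZ.
  rewrite (kcls a b d f c aT bT dT fT cT (ltac:(uniq5))) (kcls a d b f c aT dT bT fT cT (ltac:(uniq5)))
    (kcls a f b d c aT fT bT dT cT (ltac:(uniq5))) (kcls b d a f c bT dT aT fT cT (ltac:(uniq5)))
    (kcls b f a d c bT fT aT dT cT (ltac:(uniq5))) (kcls d f a b c dT fT aT bT cT (ltac:(uniq5))).
  rewrite Xaf Xbf Xdf Xbd Xad !scaler0 !addr0 -/al -/be.
  by apply/rowP => z; rewrite /B1 /B2 !mxE; ring.
have dep : A1 * B2 = A2 * B1.
  have [ld0|ld0] := eqVneq (cls ld) 0.
    by have [-> ->] := lin_indep2 al0 be_al (etrans (esym ldE) ld0); rewrite !mul0r.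
  have /sub_rVP[k kE'] : (cls lc <= cls ld)%MS.
    apply: (loads_dependent vT U0 H aT bT cT (x := px w v) (y := py w v)) => //;
      rewrite ?br_mv_id ?br_neq0 //; try uniq5.
      by rewrite /ld !mulmxDl -!scalemxAl !(er_blk0 w vT) // !scaler0 !addr0.
    by rewrite /lc !mulmxDl -!scalemxAl !(er_blk0 w vT) // !scaler0 !addr0.
  have [] : B1 - k * A1 = 0 /\ B2 - k * A2 = 0.
    apply: (lin_indep2 al0 be_al); apply/rowP => z.
    by move/rowP/(_ z): kE'; rewrite lcE ldE !mxE => E; lra.
  by move=> /subr0_eq -> /subr0_eq ->; ring.
have nabv : br w a b v != 0 by apply: br_neq0 => //; uniq5.
have nacv : br w a c v != 0 by apply: br_neq0 => //; uniq5.
have nadv : br w a d v != 0 by apply: br_neq0 => //; uniq5.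
have nbcv : br w b c v != 0 by apply: br_neq0 => //; uniq5.
have nbdv : br w b d v != 0 by apply: br_neq0 => //; uniq5.
have nbcd : br w b c d != 0 by apply: br_neq0 => //; uniq5.
have : t * (t - 1) * (br w b c d ^+ 2 / (br w b c v * br w b d v)) = 0.
  transitivity (A1 * B2 - A2 * B1); last by rewrite dep subrr.
  rewrite /A1 /A2 /B1 /B2; move: nabv nacv nadv nbcv nbdv.
  rewrite /br => n1 n2 n3 n4 n5.
  by field; rewrite n1 n2 n3 n4 n5.
move/eqP; rewrite !mulf_eq0 (negPf t0) invr_eq0 !mulf_eq0 (negPf nbcv) (negPf nbdv) (negPf nbcd) /= !orbF.
by rewrite subr_eq0 => /eqP.
Qed.

End LocalClassification.

Section Loc.
Variables (R : realFieldType) (n : nat) (w : 'I_(n + n) -> R).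
Hypothesis gw : alg_indep_Q w.
Variables (v : 'I_n) (T : {set 'I_n}) (U : 'M[R]_(n * 3)).
Hypothesis vT : v \notin T.
Hypothesis U0 : U *m blk R v = 0.
Hypothesis H : forall x y, (\rank (U + star (move_vertex w v x y) v T)%MS <= \rank U + 4)%N.
Hypothesis T5 : #|T| = 5%N.
Implicit Types i j k l m a b c d f : 'I_n.

Notation cls := (cls U).
Notation ncls := (ncls w T U).

Lemma rho_ncls a b c d f : uniq [:: a; b; c; d; f] ->
  a \in T -> b \in T -> c \in T -> d \in T -> f \in T ->
  ncls c d = ncls a b -> (rho w a b c d f <= U)%MS.
Proof.
move=> U5 aT bT cT dT fT.
move: (U5); rewrite /= !inE !negb_or => /and5P[/and4P[ab ac ad af] /and3P[bc bd bf] /andP[cd cf] df _].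
have U5' : uniq [:: c; d; a; b; f] by uniq5.
rewrite (nclsE w U T5 U5) // (nclsE w U T5 U5') //.
rewrite -cls_eq0 /rho -scaleNr clsD !clsZ.
move: (cls (erow w a b)) (cls (erow w c d)) => s t E; apply/eqP/rowP => z.
move/rowP/(_ z): E; rewrite !mxE /kap => E.
have n1 : br w a b c * br w a b d * br w a b f != 0.
  by rewrite !mulf_neq0 ?(br_neq0 gw) //; uniq5.
have n2 : br w c d a * br w c d b * br w c d f != 0.
  by rewrite !mulf_neq0 ?(br_neq0 gw) //; uniq5.
set p := _ * _ * _ in n1 E *; set q := _ * _ * _ in n2 E *.
have -> : t 0 z = q * (p^-1 * s 0 z) by rewrite -E mulVKf.
by field.
Qed.

(** [classify] applied to [ncls], with [disjoint_parallel] and [midpoint_sum] as its two hypotheses.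
    In the last case [t = 1] turns two of the proportionalities into membership of [rho] vectors. *)
Lemma local_classification :
  [\/ exists2 m, m \in T &
        forall i j, i \in T -> j \in T -> i != m -> j != m -> (erow w i j <= U)%MS,
      exists i0 j0, [/\ i0 \in T, j0 \in T &
        forall i j, i \in T -> j \in T -> (erow w i j <= U + <<erow w i0 j0>>)%MS]
    | exists a b c d f,
      [/\ uniq [:: a; b; c; d; f], [/\ a \in T, b \in T, c \in T, d \in T & f \in T],
          (rho w a b c d f <= U)%MS /\ (rho w a c b d f <= U)%MS
        & ~~ (erow w a b <= U)%MS /\ ~~ (erow w a c <= U + <<erow w a b>>)%MS]].
Proof.
have five a b : a \in T -> b \in T -> a != b ->
    exists c d f, uniq [:: a; b; c; d; f] /\ [/\ c \in T, d \in T & f \in T].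
  move=> aT bT ab; have T3 : #|T :\ a :\ b| = 3%N.
    by move: T5; rewrite (cardsD1 a) aT (cardsD1 b) !inE (eq_sym b) ab bT !add1n => -[->].
  have /card_gt0P[c cN] : (0 < #|T :\ a :\ b|)%N by rewrite T3.
  have /eqP/cards2P[d [f [df TE']]] : #|T :\ a :\ b :\ c| = 2%N.
    by move: T3; rewrite (cardsD1 c) cN add1n => -[->].
  have TE : T :\ a :\ b = [set c; d; f] by rewrite -setUA -TE' setD1K.
  have cd : c != d by have := set21 d f; rewrite -TE' !inE eq_sym => /andP[].
  have cf : c != f by have := set22 d f; rewrite -TE' !inE eq_sym => /andP[].
  have H1 z : z \in [set c; d; f] -> [/\ z != b, z != a & z \in T].
    by rewrite -TE !inE => /and3P.
  have [cb ca cT] : [/\ c != b, c != a & c \in T] by apply: H1; rewrite !inE eqxx.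
  have [db da dT] : [/\ d != b, d != a & d \in T] by apply: H1; rewrite !inE eqxx orbT.
  have [fb fa fT] : [/\ f != b, f != a & f \in T] by apply: H1; rewrite !inE eqxx !orbT.
  by exists c, d, f; split => //; uniq5.
have n0 a b : ncls a b = 0 -> a \in T -> b \in T -> (erow w a b <= U)%MS.
  have [-> _ _ _|ab E aT bT] := eqVneq a b; first by rewrite erii sub0mx.
  have [c [d [f [U5 [cT dT fT]]]]] := five a b aT bT ab.
  move/eqP: E; rewrite (nclsE w U T5 U5) // scaler_eq0 (negPf (kap_neq0 gw U5)) cls_eq0.
  by [].
have nS a b : a \in T -> b \in T -> a != b -> (ncls a b :=: cls (erow w a b))%MS.
  move=> aT bT ab; have [c [d [f [U5 [cT dT fT]]]]] := five a b aT bT ab.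
  rewrite (nclsE w U T5 U5) //; apply: eqmx_scale; exact: kap_neq0.
have X0 a b : ncls a b != 0 -> a \in T -> b \in T -> a != b -> cls (erow w a b) != 0.
  by move=> X0 aT bT ab; rewrite -submx0 -(nS a b) // submx0.
have P1 a b c d f : uniq [:: a; b; c; d; f] ->
    a \in T -> b \in T -> c \in T -> d \in T -> f \in T ->
    ncls a b != 0 -> (ncls c d <= ncls a b)%MS.
  move=> U5 aT bT cT dT fT.
  move: (U5); rewrite /= !inE !negb_or => /and5P[/and4P[ab ac ad af] _ /andP[cd cf] _ _] X1.
  by rewrite (nS c d) // (nS a b) //; apply: (disjoint_parallel gw vT U0 H U5); rewrite ?X0.
have P2 a b c d f : uniq [:: a; b; c; d; f] ->
    a \in T -> b \in T -> c \in T -> d \in T -> f \in T ->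
    ncls a b != 0 -> ((ncls a c + ncls a d + ncls a f)%R <= ncls a b)%MS.
  move=> U5 aT bT cT dT fT.
  move: (U5); rewrite /= !inE !negb_or => /and5P[/and4P[ab ac ad af] /and3P[bc bd bf] /andP[cd cf] df _] X1.
  rewrite (nS a b) // (@nclsE _ _ w T U T5 a c b d f) // ?(@nclsE _ _ w T U T5 a d b c f) //
    ?(@nclsE _ _ w T U T5 a f b c d) //; try uniq5.
  by apply: (midpoint_sum gw vT U0 H U5); rewrite ?X0.
have [[m mT V]|[i0 [j0 [iT jT V]]]|[t [a [b [c [d [f [t0 Q]]]]]]]] :=
  classify (nclsC w U T5) P1 P2 T5.
- apply: Or31; exists m => // i j iT jT im jm.
  have [->|ij] := eqVneq i j; first by rewrite erii sub0mx.
  by apply: n0 => //; apply: V.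
- apply: Or32; exists i0, j0; split=> // i j iT' jT'.
  have [->|ij] := eqVneq i j; first by rewrite erii sub0mx.
  rewrite cls_sub -(nS i j) //; have [E|ij0] := eqVneq i0 j0.
    have Z : ncls j0 j0 = 0 by rewrite /ncls eqxx !andbF.
    move: (V i j iT' jT' ij); rewrite E Z => X1.
    exact: submx_trans X1 (sub0mx _ _).
  by rewrite -(nS i0 j0) //; apply: V.
- have t1 := quadrangle_ratio gw vT U0 H T5 t0 Q; rewrite t1 in Q.
  case: Q => U5 [aT bT cT dT fT] [Xaf Xbf Xcf Xdf] [Xcd Xbd _ _] [al0 be_al].
  move: (U5); rewrite /= !inE !negb_or => /and5P[/and4P[ab ac ad af] /and3P[bc bd bf] /andP[cd cf] df _].
  apply: Or33; exists a, b, c, d, f; split => //.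
  + split; first by apply: rho_ncls; rewrite // Xcd scale1r.
    by apply: rho_ncls; rewrite ?Xbd ?scale1r //; uniq5.
  + split; first by rewrite -cls_eq0 X0.
    by rewrite cls_sub -(nS a b) // -(nS a c).
Qed.
End Loc.

(** * Edge sets and ranks *)

Section Graphs.
Variables (R : realFieldType) (n : nat) (w : 'I_(n + n) -> R).
Hypothesis gw : alg_indep_Q w.
Implicit Types (i j k l m v a b c d f : 'I_n) (T W : {set 'I_n}) (S D : {set 'I_n * 'I_n}).

Definition nbrs S v : {set 'I_n} := [set j | (j != v) && (((v, j) \in S) || ((j, v) \in S))].
Definition del S v : {set 'I_n * 'I_n} := [set e in S | (e.1 != v) && (e.2 != v)].

Lemma nbN S v : v \notin nbrs S v.
Proof. by rewrite inE eqxx. Qed.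

Lemma nb_sub S W v : S \subset setX W W -> nbrs S v \subset W :\ v.
Proof.
move=> /subsetP SW; apply/subsetP => j; rewrite !inE => /andP[-> /orP[] /SW]; rewrite inE /=.
  by case/andP.
by case/andP.
Qed.

Lemma del_sub S v : del S v \subset S.
Proof. by apply/subsetP => e; rewrite inE => /andP[]. Qed.

Lemma del_setX S W v : S \subset setX W W -> del S v \subset setX (W :\ v) (W :\ v).
Proof.
move=> /subsetP SW; apply/subsetP => e; rewrite !inE => /andP[/SW].
by rewrite inE => /andP[-> ->] /andP[-> ->].
Qed.

Lemma del_blk0 S v : rspan w (del S v) *m blk R v = 0.
Proof. by apply: Sp_blk0 => i j; rewrite inE => /andP[_]. Qed.

Lemma Sp_del S v : (rspan w S :=: rspan w (del S v) + star w v (nbrs S v))%MS.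
Proof.
apply/eqmxP/andP; split.
  apply: SpP => i j ijS; have [->|ij] := eqVneq i j; first by rewrite erii sub0mx.
  have [iv|iv] := eqVneq i v.
    apply: submx_trans (addsmxSr _ _); rewrite iv; apply: er_star.
    by rewrite inE -iv eq_sym ij ijS.
  have [jv|jv] := eqVneq j v.
    apply: submx_trans (addsmxSr _ _); rewrite jv erN eqmx_opp; apply: er_star.
    by rewrite inE -jv ij ijS orbT.
  by apply: submx_trans (addsmxSl _ _); apply: er_Sp; rewrite inE ijS /= iv jv.
rewrite addsmx_sub SpS ?del_sub //=; apply/sumsmx_subP => j; rewrite inE => /andP[_ jS].
by rewrite genmxE er_Sp.
Qed.

(** Only an inequality, since [S] may hold a pair in both orders. *)
Lemma card_nb_del S v : (#|del S v| + #|nbrs S v| <= #|S|)%N.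
Proof.
rewrite -(cardsID (del S v) S) (setIidPr (del_sub S v)) leq_add2l.
pose g (e : 'I_n * 'I_n) := if e.1 == v then e.2 else e.1.
apply: leq_trans (leq_imset_card g _); apply: subset_leq_card.
apply/subsetP => j; rewrite inE => /andP[jv /orP[] jS]; apply/imsetP.
  by exists (v, j); rewrite ?inE ?jS /= /g /= eqxx ?andbT.
by exists (j, v); rewrite ?inE ?jS /= /g /= ?(negPf jv) ?eqxx ?andbF ?andbT.
Qed.

Lemma sum_nb S W : (\sum_(u in W) #|nbrs S u| <= 2 * #|S|)%N.
Proof.
apply: (@leq_trans (\sum_u #|nbrs S u|)); first by rewrite big_mkcond leq_sum // => u _; case: ifP.
have le u : (#|nbrs S u| <= #|[set e in S | e.1 == u]| + #|[set e in S | e.2 == u]|)%N.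
  apply: leq_trans (leq_add (leq_imset_card snd _) (leq_imset_card fst _)).
  apply: leq_trans (leq_card_setU _ _).
  apply: subset_leq_card; apply/subsetP => j; rewrite !inE => /andP[_ /orP[] jS]; apply/orP; [left|right].
    by apply/imsetP; exists (u, j); rewrite // inE jS /=.
  by apply/imsetP; exists (j, u); rewrite // inE jS /=.
apply: leq_trans (leq_sum _ (fun u _ => le u)) _; rewrite big_split /= mul2n -addnn.
have E (g : 'I_n * 'I_n -> 'I_n) : (\sum_u #|[set e in S | g e == u]| = #|S|)%N.
  rewrite -sum1_card (partition_big g predT) //=; apply: eq_bigr => u _.
  by rewrite -sum1_card; apply: eq_bigl => e; rewrite inE.
by rewrite !E.
Qed.

Definition edge_free S : Prop := forall e, e \in S -> ~~ (erow w e.1 e.2 <= rspan w (S :\ e))%MS.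

Lemma free_sub S D : D \subset S -> edge_free S -> edge_free D.
Proof.
move=> DS fS e eD; apply: contra (fS e (subsetP DS e eD)) => /submx_trans; apply.
by rewrite SpS ?setSD.
Qed.

Lemma SpD1 S e : e \in S -> (rspan w S :=: rspan w (S :\ e) + <<erow w e.1 e.2>>)%MS.
Proof. by move=> eS; rewrite {1}/rspan (big_setD1 e eS) /= addsmxC. Qed.

Lemma rank_add_row N (U : 'M[R]_N) (u : 'rV_N) :
  \rank (U + <<u>>)%MS = (\rank U + ~~ (u <= U)%MS)%N.
Proof.
have [uU|uU] := boolP (u <= U)%MS.
  by rewrite addn0; apply: eqmx_rank; rewrite addsmxSl addsmx_sub genmxE uU submx_refl.
apply/eqP; rewrite eqn_leq addn1; apply/andP; split.
  by rewrite (leq_trans (mxrank_adds_leqif _ _)) // -[X in (_ <= X)%N]addn1 leq_add2l genmxE rank_leq_row.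
have sU : (U <= U + <<u>>)%MS := addsmxSl U <<u>>%MS.
rewrite ltn_neqAle (mxrankS sU) andbT (eq_leqif (mxrank_leqif_sup sU)); apply: contra uU.
by rewrite addsmx_sub genmxE => /andP[].
Qed.

Lemma free_rank S : edge_free S -> \rank (rspan w S) = #|S|.
Proof.
elim: {S}#|S| {-2}S (erefl #|S|) => [S /eqP|k IH S Sk fS].
  by rewrite cards_eq0 => /eqP-> _; rewrite /rspan big_set0 mxrank0 cards0.
have /card_gt0P[e eS] : (0 < #|S|)%N by rewrite Sk.
rewrite (SpD1 eS) rank_add_row (fS e eS) IH; first by rewrite (cardsD1 e S) eS addnC.
  by move: Sk; rewrite (cardsD1 e) eS add1n => -[].
by apply: free_sub fS; exact: subD1set.
Qed.

Lemma rank_Sp_leq S : (\rank (rspan w S) <= #|S|)%N.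
Proof.
rewrite (leq_trans (mxrank_sum_leqif _)) // -sum1_card leq_sum //= => e _.
by rewrite genmxE rank_leq_row.
Qed.

Lemma rank_star_leq (w' : 'I_(n + n) -> R) v T N (U : 'M_(N, n * 3)) :
  (\rank (U + star w' v T)%MS <= \rank U + #|T|)%N.
Proof.
rewrite (leq_trans (mxrank_adds_leqif _ _)) // leq_add2l (leq_trans (mxrank_sum_leqif _)) // -sum1_card leq_sum //= => e _.
by rewrite genmxE rank_leq_row.
Qed.

Lemma nb_setX W v : v \in W -> nbrs (setX W W) v = W :\ v.
Proof. by move=> vW; apply/setP => j; rewrite !inE /= vW andbT orbb. Qed.

(** Loads at [v] account for at most 3 dimensions, and by [star_ker] the vectors without load at [v]
    come from pairs of the other vertices. *)
Lemma rank_complete_step W v : v \in W ->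
  (\rank (rspan w (setX W W)) <= \rank (rspan w (setX (W :\ v) (W :\ v))) + 3)%N.
Proof.
move=> vW; pose A := rspan w (setX W W); pose B := rspan w (setX (W :\ v) (W :\ v)).
have AE : (A :=: B + star w v (W :\ v))%MS.
  apply: eqmx_trans (Sp_del _ v) _; rewrite nb_setX // /B.
  suff -> : del (setX W W) v = setX (W :\ v) (W :\ v) by [].
  by apply/setP => e; rewrite !inE /=; case: (e.1 == v); case: (e.2 == v); rewrite /= ?andbF ?andbT.
rewrite -/A -(mxrank_mul_ker A (blk R v)) addnC leq_add ?rank_leq_col //.
apply: mxrankS; have vT : v \notin W :\ v by rewrite !inE eqxx.
have B0 : B *m blk R v = 0 by apply: Sp_blk0 => i j; rewrite !inE => /andP[/andP[-> _] /andP[-> _]].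
apply: submx_trans (_ : (B + rspan w (setX (W :\ v) (W :\ v)) <= _)%MS); last by rewrite addsmx_sub submx_refl.
by apply: submx_trans (star_ker gw vT B0); rewrite capmxS // AE.
Qed.

(** Three vertices have three edges, and each further vertex adds at most 3 by
    [rank_complete_step]. *)
Lemma rank_complete_leq W : (3 <= #|W|)%N -> (\rank (rspan w (setX W W)) + 6 <= 3 * #|W|)%N.
Proof.
elim: {W}#|W| {-2}W (erefl #|W|) => [|k IH] W Wk; first by rewrite Wk.
rewrite [in X in X -> _]Wk => W3; have /card_gt0P[v vW] : (0 < #|W|)%N by rewrite Wk.
have Wv : #|W :\ v| = k by move: Wk; rewrite (cardsD1 v) vW add1n => -[].
have := rank_complete_step vW; move: W3; rewrite leq_eqVlt => /orP[/eqP k2|k3]; last first.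
  by have := IH _ Wv; rewrite Wv Wk => /(_ k3); move: (\rank (rspan w (setX W W))) (\rank _) => p q; clear; lia.
case: k2 Wk Wv => <- Wk Wv.
have /card_gt0P[u uW] : (0 < #|W :\ v|)%N by rewrite Wv.
have Wu : #|W :\ v :\ u| = 1%N by move: Wv; rewrite (cardsD1 u) uW add1n => -[].
have /cards1P[t tE] : #|W :\ v :\ u| == 1%N by rewrite Wu.
have WE z : z \in W -> [\/ z = v, z = u | z = t].
  have [->|zv] := eqVneq z v; first by constructor 1.
  have [->|zu] := eqVneq z u; first by constructor 2.
  by move=> zW; apply: Or33; apply/set1P; rewrite -tE !inE zv zu.
move=> _; rewrite Wk (@leq_add2r 6 _ 3).
pose D := [set (v, u); (v, t); (u, t)].
have D3 : (#|D| <= 3)%N by rewrite /D -setUA !cardsU1 cards1; case: (_ \notin _); case: (_ \notin _).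
apply: leq_trans D3; apply: leq_trans (rank_Sp_leq D); apply: mxrankS; apply: SpP => i j.
by rewrite inE /= => /andP[/WE[]-> /WE[]->]; rewrite ?erii ?sub0mx // er_Sp // !inE !eqxx ?orbT.
Qed.

End Graphs.

(** * Rank added by a star *)

Section Loads.
Variables (R : realFieldType) (n : nat) (w : 'I_(n + n) -> R).
Hypothesis gw : alg_indep_Q w.
Implicit Types (i j k l m v a b c d f : 'I_n) (T W : {set 'I_n}) (S D : {set 'I_n * 'I_n}).

(** By [load_small] the star part of such a vector has zero coefficients. *)
Lemma star_cap_small v T (U : 'M[R]_(n * 3)) : v \notin T -> (#|T| <= 3)%N -> U *m blk R v = 0 ->
  forall u : 'rV_(n * 3), u *m blk R v = 0 -> (u <= U + star w v T)%MS -> (u <= U)%MS.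
Proof.
move=> vT T3 U0 u u0 /sub_addsmxP[[a b] /= uE].
have /sub_sum_genP[z zE] : (b *m star w v T <= star w v T)%MS by rewrite submxMl.
move: u0; rewrite uE zE mulmxDl -mulmxA U0 mulmx0 add0r mulmx_suml => E.
rewrite big1 ?addr0 ?submxMl // => j jT.
rewrite (load_small gw vT T3 _ jT) ?scale0r // -[RHS]E; apply: eq_bigr => t _.
by rewrite -scalemxAl er_blk eqxx.
Qed.

(** Modulo [U] the [K5] relation only involves four edges of the star, so one of them is
    redundant. *)
Lemma K5_rank v i j k l T (U : 'M[R]_(n * 3)) : uniq [:: v; i; j; k; l] ->
  i \in T -> j \in T -> k \in T -> l \in T ->
  (erow w i j <= U)%MS -> (erow w i k <= U)%MS -> (erow w i l <= U)%MS ->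
  (erow w j k <= U)%MS -> (erow w j l <= U)%MS -> (erow w k l <= U)%MS ->
  (\rank (U + star w v T)%MS < \rank U + #|T|)%N.
Proof.
move=> U5 iT jT kT lT Uij Uik Uil Ujk Ujl Ukl.
move: (U5); rewrite /= !inE !negb_or => /and5P[/and4P[vi vj vk vl] /and3P[ij ik il] /andP[jk jl] kl _].
rewrite (cardsD1 i T) iT add1n addnS ltnS.
apply: leq_trans (rank_star_leq w v (T :\ i) U); apply: mxrankS.
rewrite addsmx_sub addsmxSl /=; apply/sumsmx_subP => t tT; rewrite genmxE.
have [{tT}->|ti] := eqVneq t i; last first.
  by apply: submx_trans (addsmxSr _ _); apply: er_star; rewrite !inE ti.
set A := (U + _)%MS; have UA x : (x <= U)%MS -> (x <= A)%MS.
  by move=> xU; apply: submx_trans xU (addsmxSl _ _).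
have SA z : z \in T -> i != z -> (erow w v z <= A)%MS.
  by move=> zT iz; apply: submx_trans (addsmxSr _ _); apply: er_star; rewrite !inE eq_sym iz.
have -> : erow w v i = - (kap w v i j k l)^-1 *:
    (kap w v j i k l *: erow w v j + kap w v k i j l *: erow w v k + kap w v l i j k *: erow w v l
     + kap w i j v k l *: erow w i j + kap w i k v j l *: erow w i k + kap w i l v j k *: erow w i l
     + kap w j k v i l *: erow w j k + kap w j l v i k *: erow w j l + kap w k l v i j *: erow w k l).
  have E := K5_er gw U5; have n0 := kap_neq0 gw U5.
  apply: (scalerI n0); rewrite scalerA mulrN mulfV // scaleN1r; apply/eqP.
  rewrite -subr_eq0 opprK -[X in _ == X]E; apply/eqP/rowP => z; rewrite !mxE; ring.
apply: scalemx_sub; repeat apply: addmx_sub; apply: scalemx_sub; by [exact: UA | exact: SA].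
Qed.

(** With [v] on the line [ij], the star spans the row of [ij], which has no load at [v]. The loads
    at [v] already use the three available dimensions, so this row must be in [U]. A rational [s]
    keeps the needed brackets nonzero by genericity; 0 and 1 would put [v] on [i] or [j]. *)
Lemma line_pair v i j k l T (U : 'M[R]_(n * 3)) (s : rat) :
  uniq [:: i; j; k; l] -> v \notin T ->
  i \in T -> j \in T -> k \in T -> l \in T -> U *m blk R v = 0 -> s != 0 -> s != 1 ->
  let s' : R := ratr s in
  let w' := move_vertex w v ((1 - s') * px w i + s' * px w j) ((1 - s') * py w i + s' * py w j) in
  (\rank (U + star w' v T)%MS <= \rank U + 3)%N -> (erow w i j <= U)%MS.
Proof.
move=> U4 vT iT jT kT lT U0 s0 s1 s' w'; set A := (U + _)%MS => rk.
move: (U4); rewrite /= !inE !negb_or => /and4P[/and3P[ij ik il] /andP[jk jl] kl _].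
have nv t : t \in T -> t != v by move=> tT; apply: contraNneq vT => <-.
have s'0 : s' != 0 by rewrite /s' fmorph_eq0.
have s'1 : 1 - s' != 0 by rewrite subr_eq0 eq_sym /s' -(rmorph1 (@ratr R)) (inj_eq (fmorph_inj _)).
have eA t : t \in T -> (erow w' v t <= A)%MS.
  by move=> tT; apply: submx_trans (addsmxSr _ _); exact: er_star.
have ijA : (erow w i j <= A)%MS.
  apply: submx_trans (_ : (<<erow w' v i>> + <<erow w' v j>> <= A)%MS); last first.
    by rewrite addsmx_sub !genmxE !eA.
  have dx : px w i != px w j := px_neq gw ij.
  apply: line_load; rewrite ?nv //.
  - by rewrite br_line ?nv // br_aab br_aba !mulr0 addr0.
  - rewrite -subr_eq0 (_ : _ - _ = s' * (px w j - px w i)); last by ring.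
    by rewrite mulf_neq0 // subr_eq0 eq_sym.
  - rewrite -subr_eq0 (_ : _ - _ = (1 - s') * (px w i - px w j)); last by ring.
    by rewrite mulf_neq0 // subr_eq0.
apply: contraLR rk => ijU; rewrite -ltnNge.
have : (\rank (U + <<erow w i j>>)%MS + 3 <= \rank A)%N.
  apply: (@star_rank _ _ w' v i k l); rewrite ?eA //; try by rewrite eq_sym nv.
  - have ij0 : erow w i j *m blk R v = 0 by rewrite er_blk !(eq_sym v) (negPf (nv i iT)) (negPf (nv j jT)).
    by apply/sub_kermxP; rewrite addsmx_sub genmxE; apply/andP; split; apply/sub_kermxP.
  - by rewrite addsmx_sub addsmxSl genmxE.
  - rewrite br_line ?nv // br_aab mulr0 add0r mulf_neq0 // (br_neq0 gw) //; uniq5.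
  - rewrite br_line ?nv // br_aab mulr0 add0r mulf_neq0 // (br_neq0 gw) //; uniq5.
  - rewrite br_line ?nv // -(rmorph1 (@ratr R)) -rmorphB; apply: br_comb_neq0 => //.
    by rewrite subr_eq0 eq_sym.
by rewrite rank_add_row ijU addn1 addSn.
Qed.
End Loads.

Section Move.
Variables (R : realFieldType) (n : nat) (w : 'I_(n + n) -> R).
Hypothesis gw : alg_indep_Q w.
Implicit Types (i j k l m v a b c d f : 'I_n) (T W : {set 'I_n}) (S D : {set 'I_n * 'I_n}).

Lemma polyfun_rho a b c d f z : polyfun (fun w : 'I_(n + n) -> R => rho w a b c d f 0 z).
Proof.
have E (w' : 'I_(n + n) -> R) : rho w' a b c d f 0 z =
    br w' c d a * br w' c d b * br w' c d f * erow w' a b 0 z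
    - br w' a b c * br w' a b d * br w' a b f * erow w' c d 0 z by rewrite !mxE.
have [q qE] : polyfun (fun w' : 'I_(n + n) -> R =>
    br w' c d a * br w' c d b * br w' c d f * erow w' a b 0 z
    - br w' a b c * br w' a b d * br w' a b f * erow w' c d 0 z).
  by apply: polyfunB; repeat apply: polyfunM; (exact: polyfun_br || exact: polyfun_er).
by exists q => w'; rewrite E qE.
Qed.

(** The extra row [r] may depend on the position of [v], as it does when the moved vertex is the [f]
    of [rho]. The rows of [D] do not see [v]. *)
Lemma rank_move D v T (r : ('I_(n + n) -> R) -> 'rV[R]_(n * 3)) x y :
  (forall e, e \in D -> (e.1 != v) && (e.2 != v)) -> v \notin T ->
  (forall z, polyfun (fun w => r w 0 z)) ->
  (\rank (rspan w D + <<r (move_vertex w v x y)>> + star (move_vertex w v x y) v T)%MS <= \rank (rspan w D + <<r w>> + star w v T)%MS)%N.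
Proof.
move=> Dv vT pr; set w' := move_vertex w v x y.
pose fam (u : 'I_(n + n) -> R) (t : ('I_n * 'I_n + unit) + 'I_n) : 'rV[R]_(n * 3) :=
  match t with inl (inl e) => erow u e.1 e.2 | inl (inr _) => r u | inr j => erow u v j end.
pose P (t : ('I_n * 'I_n + unit) + 'I_n) :=
  match t with inl (inl e) => e \in D | inl (inr _) => true | inr j => j \in T end.
have pf t z : polyfun (fun u => fam u t 0 z).
  by case: t => [[e|[]]|j]; [exact: polyfun_er | exact: pr | exact: polyfun_er].
have E u : (\sum_(t in P) <<fam u t>> :=: rspan u D + <<r u>> + star u v T)%MS.
  rewrite !big_sumType /=; apply: adds_eqmx => //; apply: adds_eqmx => //.
  by rewrite (big_pred1 tt) // => -[].
have := generic_rank_span_ge P w' gw pf; rewrite !E.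
suff -> : rspan w' D = rspan w D by [].
by apply: eq_bigr => e /Dv /andP[ev1 ev2]; rewrite er_mv.
Qed.

Lemma rho_mv a b c d f v x y : a != v -> b != v -> c != v -> d != v -> f != v ->
  rho (move_vertex w v x y) a b c d f = rho w a b c d f.
Proof. by move=> *; rewrite /rho !br_mv ?er_mv. Qed.

End Move.

(** * A minimal counterexample to forcing *)

Section Aux.
Variables (R : realFieldType) (N : nat).

Lemma sub_add_rowP (U : 'M[R]_N) (x y : 'rV[R]_N) :
  reflect (exists k, ((y - k *: x)%R <= U)%MS) (y <= U + <<x>>)%MS.
Proof.
apply: (iffP idP) => [/sub_addsmxP[[p q] /= yE]|[k kU]].
  have /sub_rVP[k kE] : (q *m <<x>>%MS <= x)%MS by rewrite (submx_trans (submxMl _ _)) ?genmxE.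
  by exists k; rewrite yE kE addrK submxMl.
rewrite -[y](subrK (k *: x)) addmx_sub ?(submx_trans kU (addsmxSl _ _)) //.
by apply: submx_trans (addsmxSr _ _); rewrite scalemx_sub // genmxE.
Qed.

Lemma row_exchange (U : 'M[R]_N) (x y : 'rV[R]_N) :
  (y <= U + <<x>>)%MS -> ~~ (y <= U)%MS -> (x <= U + <<y>>)%MS.
Proof.
case/sub_add_rowP => k kU yU; have k0 : k != 0.
  by apply: contraNneq yU => k0; move: kU; rewrite k0 scale0r subr0.
apply/sub_add_rowP; exists k^-1.
have -> : x - k^-1 *: y = - k^-1 *: (y - k *: x).
  by rewrite scalerBr scalerA mulNr mulVf // scaleN1r opprK scaleNr addrC.
exact: scalemx_sub.
Qed.

Lemma enum4 (I : finType) (T : {set I}) : #|T| = 4%N ->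
  exists i j k l, [/\ uniq [:: i; j; k; l], i \in T, j \in T, k \in T & l \in T].
Proof.
rewrite cardE; have := enum_uniq T; have := mem_enum T.
case: (enum T) => [|i [|j [|k [|l [|]]]]] //= mT U _.
by exists i, j, k, l; split; rewrite // -mT !inE eqxx ?orbT.
Qed.
End Aux.

Section Minimal.
Variables (R : realFieldType) (n : nat) (w : 'I_(n + n) -> R).
Hypothesis gw : alg_indep_Q w.
Implicit Types (i j k l m v a b c d f : 'I_n) (T W : {set 'I_n}) (S D : {set 'I_n * 'I_n}).

Lemma SpU1 e S : (rspan w (e |: S) :=: rspan w S + <<erow w e.1 e.2>>)%MS.
Proof.
by apply: eqmx_trans (SpU w [set e] S) _; rewrite {1}/rspan big_set1; apply/eqmxP; rewrite !(addsmxC <<_>>%MS) submx_refl.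
Qed.

Variables (M : {set 'I_n * 'I_n}) (W : {set 'I_n}) (a b c d f : 'I_n).
Hypothesis U5 : uniq [:: a; b; c; d; f].
Hypothesis aW : a \in W.
Hypothesis bW : b \in W.
Hypothesis cW : c \in W.
Hypothesis dW : d \in W.
Hypothesis MW : M \subset setX W W.
Let r := rho w a b c d f.
Hypothesis rM : (r <= rspan w M)%MS.
Hypothesis minM : forall D, D \proper M -> ~~ (r <= rspan w D)%MS.
Hypothesis nab : ~~ (erow w a b <= rspan w M)%MS.
Hypothesis IH : forall W' S a b c d f, (#|W'| < #|W|)%N -> S \subset setX W' W' ->
  a \in W' -> b \in W' -> c \in W' -> d \in W' -> uniq [:: a; b; c; d; f] ->
  (rho w a b c d f <= rspan w S)%MS -> (erow w a b <= rspan w S)%MS.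

Let al := br w c d a * br w c d b * br w c d f.
Let be := br w a b c * br w a b d * br w a b f.

Let rE : r = al *: erow w a b - be *: erow w c d. Proof. by []. Qed.

Let al0 : al != 0.
Proof.
move: (U5); rewrite /= !inE !negb_or => /and5P[/and4P[ab ac ad af] /and3P[bc bd bf] /andP[cd cf] df _].
by rewrite /al !mulf_neq0 ?(br_neq0 gw) //; uniq5.
Qed.

Let be0 : be != 0.
Proof.
move: (U5); rewrite /= !inE !negb_or => /and5P[/and4P[ab ac ad af] /and3P[bc bd bf] /andP[cd cf] df _].
by rewrite /be !mulf_neq0 ?(br_neq0 gw) //; uniq5.
Qed.

Let ncd : ~~ (erow w c d <= rspan w M)%MS.
Proof.
apply: contra nab => cdM.
have -> : erow w a b = al^-1 *: (r + be *: erow w c d) by rewrite rE subrK scalerA mulVf ?scale1r.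
by rewrite scalemx_sub // addmx_sub // scalemx_sub.
Qed.

Let freeM : edge_free w M.
Proof.
move=> e eM; apply: contra (minM (properD1 eM)) => eMe.
by apply: submx_trans rM _; rewrite (SpD1 w eM) addsmx_sub submx_refl genmxE.
Qed.

Let ncard_W u : u \in W -> (#|W :\ u| < #|W|)%N.
Proof. by move=> uW; rewrite [X in (_ < X)%N](cardsD1 u) uW. Qed.

Let star_M u (x : 'rV_(n * 3)) : (x <= rspan w M)%MS -> (x <= rspan w (del M u) + star w u (nbrs M u))%MS.
Proof. by rewrite (Sp_del w M u). Qed.

Let del_M u (x : 'rV_(n * 3)) : (x <= rspan w (del M u))%MS -> (x <= rspan w M)%MS.
Proof. by move=> /submx_trans; apply; rewrite SpS ?del_sub. Qed.

(** [r] has no load at [u], so a star of at most three edges contributes nothing to it, and [IH]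
    applies after deleting [u]. As [f] enters only through coefficients, [u] may be [f]. *)
Let deg_other u : u \in W -> u \notin [:: a; b; c; d] -> (3 < #|nbrs M u|)%N.
Proof.
rewrite !inE !negb_or => uW /and4P[ua ub uc ud]; rewrite ltnNge; apply: contra nab => T3.
apply: (del_M (u := u)); apply: (IH (ncard_W uW) (del_setX u MW) (c := c) (d := d) (f := f)) => //; rewrite ?inE 1?eq_sym ?ua ?ub ?uc ?ud //.
apply: (star_cap_small gw (nbN M u) T3 (del_blk0 w M u)); last exact: star_M.
by rewrite mulmxBl -!scalemxAl !er_blk (negPf ua) (negPf ub) (negPf uc) (negPf ud) !scaler0 subrr.
Qed.

(** At [a], adding [ab] to a star of at most two edges gives at most three; [r] minus its [ab] term
    has no load at [a], so the row of [cd] would be in the span of [M]. The other three vertices are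
    alike. *)
Let deg_abcd u : u \in [:: a; b; c; d] -> (2 < #|nbrs M u|)%N.
Proof.
have gen v k (x : 'rV_(n * 3)) : (#|nbrs M v| <= 2)%N -> k != v -> (x <= rspan w M)%MS ->
    forall t, (x + t *: erow w v k) *m blk R v = 0 -> ((x + t *: erow w v k)%R <= rspan w M)%MS.
  move=> T2 kv xM t E; apply: (del_M (u := v)).
  apply: (@star_cap_small _ _ w gw v (k |: nbrs M v)) => //.
  - by rewrite !inE negb_or eq_sym kv eqxx.
  - by rewrite cardsU1; case: (_ \notin _) => //=; rewrite ?add0n ?add1n // (leq_trans T2).
  - exact: del_blk0.
  apply: addmx_sub; last first.
    by apply: submx_trans (addsmxSr _ _); rewrite scalemx_sub // er_star // setU11.
  apply: submx_trans (star_M v xM) _; apply: addsmxS => //.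
  by apply/sumsmx_subP => z zT; rewrite genmxE er_star // inE zT orbT.
move: (U5); rewrite /= !inE !negb_or => /and5P[/and4P[ab ac ad af] /and3P[bc bd bf] /andP[cd cf] df _].
move=> uabcd; rewrite ltnNge; apply/negP => T2.
case/or4P: uabcd => /eqP uE; rewrite uE in T2.
- move/negP: ncd; apply; have E : r + (- al) *: erow w a b = - (be *: erow w c d).
    by rewrite rE addrAC scaleNr subrr sub0r.
  have := gen a b r T2 _ rM (- al); rewrite eq_sym ab E eqmx_opp => H.
  rewrite -(eqmx_scale (erow w c d) be0) H // mulNmx -scalemxAl er_blk (negPf ac) (negPf ad).
  by rewrite scaler0 oppr0.
- move/negP: ncd; apply; have E : r + al *: erow w b a = - (be *: erow w c d).
    by rewrite erN scalerN rE addrAC subrr sub0r.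
  have := gen b a r T2 ab rM al; rewrite E eqmx_opp => H.
  rewrite -(eqmx_scale (erow w c d) be0) H // mulNmx -scalemxAl er_blk (negPf bc) (negPf bd).
  by rewrite scaler0 oppr0.
- move/negP: nab; apply; have E : r + be *: erow w c d = al *: erow w a b by rewrite rE subrK.
  have := gen c d r T2 _ rM be; rewrite eq_sym cd E => H.
  by rewrite -(eqmx_scale (erow w a b) al0) H // -scalemxAl er_blk !(eq_sym c) (negPf ac) (negPf bc) scaler0.
- move/negP: nab; apply; have E : r + (- be) *: erow w d c = al *: erow w a b.
    by rewrite erN scalerN scaleNr opprK rE subrK.
  have := gen d c r T2 cd rM (- be); rewrite E => H.
  by rewrite -(eqmx_scale (erow w a b) al0) H // -scalemxAl er_blk !(eq_sym d) (negPf ad) (negPf bd) scaler0.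
Qed.

(** [M] together with [ab] is independent inside the complete graph on [W], whence 7 in place of
    6. *)
Let sparse : (#|M| + 7 <= 3 * #|W|)%N.
Proof.
have W3 : (3 <= #|W|)%N.
  move: (U5); rewrite /= !inE !negb_or => /and5P[/and4P[ab ac ad af] /and3P[bc bd bf] _ _ _].
  apply: (@leq_trans #|[set a; b; c]|).
    by rewrite -setUA !cardsU1 cards1 !inE negb_or ab ac bc.
  by apply: subset_leq_card; apply/subsetP => z; rewrite !inE -orbA => /or3P[]/eqP->.
apply: leq_trans (rank_complete_leq gw W3); rewrite -[7%N]/(1 + 6)%N addnA leq_add2r.
have := rank_add_row (rspan w M) (erow w a b); rewrite nab (free_rank freeM) => <-; apply: mxrankS.
rewrite addsmx_sub SpS // genmxE; exact: er_Sp_setX.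
Qed.

(** The degrees sum to at most [2 #|M| <= 6 #|W| - 14]. If both cases fail, each of [a, b, c, d]
    falls short of 6 by at most 3 and [f] by at most 1, in all 13, which is too little. *)
Lemma low_degree :
  (exists2 u, u \in W /\ u \notin [:: a; b; c; d; f] & (4 <= #|nbrs M u| <= 5)%N)
  \/ (f \in W /\ #|nbrs M f| = 4%N).
Proof.
have [/exists_inP[u uW /andP[uN un]]|/exists_inPn H1] :=
    boolP [exists u in W, (u \notin [:: a; b; c; d; f]) && (4 <= #|nbrs M u| <= 5)%N].
  by left; exists u.
have [/andP[fW /eqP fn]|nf] := boolP ((f \in W) && (#|nbrs M f| == 4%N)); first by right.
have cnt (s : seq 'I_n) : (\sum_(u in W) (u \in s) <= size s)%N.
  rewrite -big_mkcondr sum1_card; apply: leq_trans (card_size s).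
  by apply: subset_leq_card; apply/subsetP => u /andP[].
have fN : f \notin [:: a; b; c; d].
  by move: (U5); rewrite -[X in uniq X]/([:: a; b; c; d] ++ [:: f]) cat_uniq has_seq1 => /and3P[].
have le u : u \in W -> (6 <= #|nbrs M u| + ((u \in [:: a; b; c; d]) * 3 + (u \in [:: f])))%N.
  move=> uW; have [uabcd|uabcd] := boolP (u \in [:: a; b; c; d]).
    by rewrite mul1n -[6%N]/(3 + (3 + 0))%N !leq_add // deg_abcd.
  have := deg_other uW uabcd; rewrite inE; have [uf|uf] := eqVneq u f.
    by move: nf; rewrite -uf uW /=; move: #|_| => p; clear; lia.
  have := H1 u uW; rewrite -[[:: a; b; c; d; f]]/([:: a; b; c; d] ++ [:: f]) mem_cat (negPf uabcd) inE (negPf uf) /=.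
  by move: #|_| => p; clear; lia.
have : (\sum_(u in W) 6 <=
  \sum_(u in W) (#|nbrs M u| + ((u \in [:: a; b; c; d]) * 3 + (u \in [:: f]))))%N by apply: leq_sum.
rewrite sum_nat_const !big_split /= -big_distrl /=.
have arith p q t x y : (p <= 2 * x)%N -> (q <= 4)%N -> (t <= 1)%N -> (x + 7 <= 3 * y)%N ->
  (y * 6 <= p + (q * 3 + t))%N -> False by clear; lia.
by move/(arith _ _ _ _ _ (sum_nb M W) (cnt [:: a; b; c; d]) (cnt [:: f]) sparse).
Qed.

Section Step.
Variable u : 'I_n.
Hypothesis uW : u \in W.
Let U0 := rspan w (del M u).
Let T := nbrs M u.
Let uT : u \notin T. Proof. exact: nbN. Qed.
Let TW : T \subset W :\ u. Proof. exact: nb_sub. Qed.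
Let U00 : U0 *m blk R u = 0. Proof. exact: del_blk0. Qed.
Let SpM : (rspan w M :=: U0 + star w u T)%MS. Proof. exact: Sp_del. Qed.

Let rank_M : \rank (rspan w M) = (\rank U0 + #|T|)%N.
Proof.
apply/eqP; rewrite eqn_leq {1}SpM rank_star_leq (free_rank freeM).
by apply: leq_trans (card_nb_del M u); rewrite leq_add2r rank_Sp_leq.
Qed.

Hypothesis T4 : (3 < #|T|)%N.

Let rU0 : ~~ (r <= U0)%MS.
Proof.
apply: minM; rewrite properEneq del_sub andbT; apply/eqP => E.
by have := rank_M; rewrite /U0 E -[LHS]addn0 => /addnI T0; move: T4; rewrite -T0.
Qed.

Let nv t : t \in T -> t != u.
Proof. by move=> tT; apply: contraNneq uT => <-. Qed.

(** The star is independent over [U0], whereas [K5_rank] would make an edge of it redundant. *)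
Let not_K5 i j k l : uniq [:: i; j; k; l] -> i \in T -> j \in T -> k \in T -> l \in T ->
  ~ (forall x y, x \in [:: i; j; k; l] -> y \in [:: i; j; k; l] -> x != y -> (erow w x y <= U0)%MS).
Proof.
move=> U4 iT jT kT lT H.
have U5' : uniq [:: u; i; j; k; l].
  by rewrite -[X in uniq X]/([:: u] ++ [:: i; j; k; l]) cat_uniq U4 /= !inE !(eq_sym _ u) !negb_or
     ![u == _]eq_sym !nv.
have := K5_rank gw U5' iT jT kT lT.
move: (U4); rewrite /= !inE !negb_or => /and4P[/and3P[ij ik il] /andP[jk jl] kl _].
move=> /(_ U0); rewrite -SpM rank_M ltnn !H ?inE ?eqxx ?orbT //; try by move=> /(_ isT isT isT isT isT isT).
Qed.

Section Other.
Hypothesis uN : u \notin [:: a; b; c; d; f].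
Let U1 := (U0 + <<r>>)%MS.

Let nu : [/\ a != u, b != u, c != u, d != u & f != u].
Proof. by move: uN; rewrite !inE !negb_or -!(eq_sym u) => /and5P[]. Qed.

Let abW : [/\ a \in W :\ u, b \in W :\ u, c \in W :\ u & d \in W :\ u].
Proof. by case: nu => *; rewrite !inE aW bW cW dW; split; apply/andP. Qed.

Let U1M : (U1 <= rspan w M)%MS.
Proof. by rewrite addsmx_sub genmxE rM andbT SpS ?del_sub. Qed.

Let IHu S : S \subset setX (W :\ u) (W :\ u) -> (r <= rspan w S)%MS -> (erow w a b <= rspan w S)%MS.
Proof. by case: abW => *; apply: (IH (ncard_W uW) _ _ _ _ _ U5). Qed.

Let delW : del M u \subset setX (W :\ u) (W :\ u). Proof. exact: del_setX. Qed.

Let pairW i j : i \in T -> j \in T -> (i, j) |: del M u \subset setX (W :\ u) (W :\ u).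
Proof.
by move=> /(subsetP TW) iW /(subsetP TW) jW; rewrite subUset delW sub1set inE /= iW jW.
Qed.

(** Otherwise exchange puts [r] in the span of [del M u] and [ij]; [IH] on [W] minus [u] then gives
    the row of [ab] in that span, which lies inside that of [M]. *)
Let pair_U0 i j : i \in T -> j \in T -> (erow w i j <= U1)%MS -> (erow w i j <= U0)%MS.
Proof.
move=> iT jT ij1; apply: contraNT nab => ij0.
apply: submx_trans (IHu (pairW iT jT) _) _; rewrite SpU1 ?(row_exchange ij1) //.
by rewrite addsmx_sub genmxE /= (submx_trans ij1) // SpS ?del_sub.
Qed.

Let U10 : U1 *m blk R u = 0.
Proof.
apply/sub_kermxP; rewrite addsmx_sub genmxE; apply/andP; split; apply/sub_kermxP => //.
case: nu => /negPf au /negPf bu /negPf cu /negPf du _.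
by rewrite mulmxBl -!scalemxAl !er_blk !(eq_sym u) au bu cu du !scaler0 subrr.
Qed.

Let rank_U1 : \rank U1 = (\rank U0).+1.
Proof. by rewrite rank_add_row rU0 addn1. Qed.

Let U1_star : (U1 + star w u T :=: rspan w M)%MS.
Proof.
apply/eqmxP; rewrite addsmx_sub U1M SpM addsmxSr /=.
by rewrite SpM addsmxS // addsmxSl.
Qed.

(** Adding [r] to [U0] does not enlarge the span with the star, so over [U1] the star adds one
    dimension less than its size; moving [u], which [r] does not see, cannot raise this. *)
Let rank_star x y : (\rank (U1 + star (move_vertex w u x y) u T)%MS < \rank U1 + #|T|)%N.
Proof.
rewrite rank_U1 addSn -rank_M -U1_star ltnS; case: nu => *.
have := @rank_move _ _ w gw (del M u) u T (fun w => rho w a b c d f) x y _ uT _.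
rewrite rho_mv //; apply; last by move=> z; exact: polyfun_rho.
by move=> e; rewrite inE => /andP[].
Qed.

(** Every position adds at most three dimensions to [U1], so by midpoints all six pairs of [T] are
    in [U1], then in [U0], against [not_K5]. *)
Let no_degree4 : #|T| = 4%N -> False.
Proof.
move=> T4'; have [i [j [k [l [U4 iT jT kT lT]]]]] := enum4 T4'.
apply: (not_K5 U4 iT jT kT lT) => x y xT yT xy.
have sT z : z \in [:: i; j; k; l] -> z \in T.
  by rewrite !in_cons in_nil orbF => /or4P[]/eqP->.
apply: pair_U0; rewrite ?sT //.
have /eqP/cards2P[p [q [pq TE]]] : #|T :\ x :\ y| = 2%N.
  by move: T4'; rewrite (cardsD1 x) (sT x xT) (cardsD1 y) in_setD1 eq_sym xy (sT y yT) !add1n => -[->].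
have /and3P[npy npx pT] : [&& p != y, p != x & p \in T] by have := set21 p q; rewrite -TE !in_setD1.
have /and3P[qy qx qT] : [&& q != y, q != x & q \in T] by have := set22 p q; rewrite -TE !in_setD1.
apply: (@line_pair _ _ w gw u x y p q T U1 2^-1); rewrite ?(sT x) ?(sT y) //; first by uniq5.
by have := rank_star ((1 - ratr 2^-1) * px w x + ratr 2^-1 * px w y)
   ((1 - ratr 2^-1) * py w x + ratr 2^-1 * py w y); rewrite T4' addnS ltnS.
Qed.

Let no_degree5 : #|T| = 5%N -> False.
Proof.
move=> T5; have H x y : (\rank (U1 + star (move_vertex w u x y) u T)%MS <= \rank U1 + 4)%N.
  by have := rank_star x y; rewrite T5 addnS ltnS.
case: (local_classification gw uT U10 H T5) => [[z zT o1]|[i0 [j0 [i0T j0T o2]]]|].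
- have [i [j [k [l [U4 iT jT kT lT]]]]] : exists i j k l, [/\ uniq [:: i; j; k; l],
      i \in T :\ z, j \in T :\ z, k \in T :\ z & l \in T :\ z].
    by apply: enum4; move: T5; rewrite (cardsD1 z) zT add1n => -[].
  have sT x : x \in [:: i; j; k; l] -> x \in T :\ z.
    by rewrite !in_cons in_nil orbF => /or4P[]/eqP->.
  have dT x : x \in T :\ z -> x \in T by case/setD1P.
  apply: (not_K5 U4); rewrite ?dT // => x y /sT/setD1P[xz xT] /sT/setD1P[yz yT] _.
  by apply: pair_U0 => //; apply: o1.
(* [A] exceeds [U0] by at most 2 dimensions, one for [r] and one for [i0 j0]. As the star adds 5 = 2
   + 3, [star_absorb] puts [A] inside the span of [M]; [r] is in [A], so [IH] on [W] minus [u]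
   applies. *)
- pose A := (U0 + rspan w (setX T T))%MS; pose S := del M u :|: setX T T.
  have SA : (rspan w S :=: A)%MS := SpU _ _ _.
  have AM : (A <= rspan w M)%MS.
    rewrite SpM; apply: star_absorb => //; rewrite -SpM rank_M T5.
    rewrite -[5%N]/(2 + 3)%N addnA leq_add2r.
    have : (A <= U1 + <<erow w i0 j0>>)%MS.
      rewrite addsmx_sub (submx_trans (addsmxSl U0 <<r>>%MS)) ?addsmxSl //=.
      by apply: SpP => i j; rewrite in_setX => /andP[iT jT]; exact: o2.
    move/mxrankS/leq_trans; apply; rewrite rank_add_row rank_U1 addn2.
    by case: (_ <= _)%MS; rewrite ?addn0 ?addn1.
  have rA : (r <= A)%MS.
    apply: submx_trans (star_ker gw uT U00); rewrite sub_capmx -SpM rM /=.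
    by apply/sub_kermxP; rewrite -[r]mul1mx; apply/sub_kermxP;
       apply: submx_trans (_ : U1 <= _)%MS; [rewrite mul1mx (submx_trans _ (addsmxSr _ _)) // genmxE | apply/sub_kermxP].
  move/negP: nab; apply; apply: submx_trans AM; rewrite -SA; apply: IHu; last by rewrite SA.
  by rewrite subUset delW setXS.
case=> a' [b' [c' [d' [f' [U5' [aT bT cT dT fT] [r1 r2] [nab' nac']]]]]].
have aW' := subsetP TW _ aT; have bW' := subsetP TW _ bT.
have cW' := subsetP TW _ cT; have dW' := subsetP TW _ dT.
(* By [IH] the [rho] of the quadrangle is not in [U0], so it can be exchanged with [r]; a second use
   of [IH], with [pq] and [st] added, puts the row of [ab] in [U1] plus that of [pq]. Used for
   [a'b'] and [a'c'], this makes these two rows dependent modulo [U1]. *)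
have key p q s t : p \in T -> q \in T -> s \in T -> t \in T -> uniq [:: p; q; s; t; f'] ->
    (rho w p q s t f' <= U1)%MS -> ~~ (erow w p q <= U1)%MS -> (erow w a b <= U1 + <<erow w p q>>)%MS.
  move=> pT qT sT tT Upq rU1 pqU1.
  have pW := subsetP TW _ pT; have qW := subsetP TW _ qT.
  have sW := subsetP TW _ sT; have tW := subsetP TW _ tT.
  have nrU0 : ~~ (rho w p q s t f' <= U0)%MS.
    apply: contra pqU1 => rU0'; apply: submx_trans (addsmxSl _ _).
    exact: (IH (ncard_W uW) delW pW qW sW tW Upq).
  pose S := (p, q) |: ((s, t) |: del M u).
  have SE : (rspan w S :=: U0 + <<erow w s t>> + <<erow w p q>>)%MS.
    by apply: eqmx_trans (SpU1 _ _) _; apply: adds_eqmx => //; exact: SpU1.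
  have rS : (r <= rspan w S)%MS.
    apply: submx_trans (row_exchange rU1 nrU0) _; rewrite SE addsmx_sub genmxE.
    rewrite -addsmxA addsmxSl /= /rho; apply: submx_trans (addsmxSr _ _).
    apply: addmx_sub; first by apply: submx_trans (addsmxSr _ _); rewrite genmxE scalemx_sub.
    by rewrite eqmx_opp; apply: submx_trans (addsmxSl _ _); rewrite genmxE scalemx_sub.
  apply: submx_trans (IHu _ rS) _.
    by rewrite subUset pairW // andbT sub1set inE /= pW qW.
  rewrite SE addsmx_sub addsmxSr andbT addsmx_sub (submx_trans (addsmxSl U0 <<r>>%MS)) ?addsmxSl //=.
  rewrite genmxE; move: (Upq); rewrite /= !inE !negb_or.
  move=> /and5P[/and4P[pq ps pt pf] /and3P[qs qt qf] /andP[st sf] tf _].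
  have n0 : br w p q s * br w p q t * br w p q f' != 0.
    by rewrite !mulf_neq0 ?(br_neq0 gw) //; uniq5.
  rewrite -(eqmx_scale _ n0) -eqmx_opp.
  have -> : - ((br w p q s * br w p q t * br w p q f') *: erow w s t) =
     rho w p q s t f' - (br w s t p * br w s t q * br w s t f') *: erow w p q.
    by rewrite /rho addrAC subrr sub0r.
  apply: addmx_sub; first exact: submx_trans rU1 (addsmxSl _ _).
  by rewrite eqmx_opp; apply: submx_trans (addsmxSr _ _); rewrite genmxE scalemx_sub.
move: (U5'); rewrite /= !inE !negb_or => /and5P[/and4P[ab ac ad af] /and3P[bc bd bf] /andP[cd cf] df _].
have k1 := key a' b' c' d' aT bT cT dT U5' r1 nab'.
have nac1 : ~~ (erow w a' c' <= U1)%MS by apply: contra nac' => /submx_trans; apply; exact: addsmxSl.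
have Uac : uniq [:: a'; c'; b'; d'; f'] by uniq5.
have k2 := key a' c' b' d' aT cT bT dT Uac r2 nac1.
have abU1 : ~~ (erow w a b <= U1)%MS by apply: contra nab => /submx_trans; apply.
move/negP: nac'; apply; apply: submx_trans (row_exchange k2 abU1) _.
by rewrite addsmx_sub addsmxSl genmxE.
Qed.

Lemma other_step : (#|T| <= 5)%N -> False.
Proof. by rewrite leq_eqVlt => /orP[/eqP|]; [exact: no_degree5 | move=> T5; apply: no_degree4; apply/eqP; rewrite eqn_leq T4 -ltnS T5]. Qed.
End Other.

Section Apex.
Hypothesis uf : u = f.
Hypothesis Teq4 : #|T| = 4%N.

Let nu : [/\ a != u, b != u, c != u & d != u].
Proof.
by move: (U5); rewrite uf /= !inE !negb_or => /and5P[/and4P[_ _ _ ->] /and3P[_ _ ->] /andP[_ ->] ->].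
Qed.

(** As [f] moves along the line [ij], this determinant tells whether the ratio of the two
    coefficients of [rho] varies. *)
Let cross i j := br w c d i * br w a b j - br w c d j * br w a b i.

(** Either a vanishing bracket leaves just one of the two products, or moving [j] onto [c] does
    so. *)
Let cross_neq0 i j : i \in T -> j \in T -> i != j ->
  ~~ [&& i \in [:: a; b] & j \in [:: a; b]] -> ~~ [&& i \in [:: c; d] & j \in [:: c; d]] ->
  cross i j != 0.
Proof.
move=> iT jT ij; rewrite !negb_and => Hab Hcd.
move: (U5); rewrite /= !inE !negb_or => /and5P[/and4P[ab ac ad af] /and3P[bc bd bf] /andP[cd cf] df _].
have C0 z : z \in [:: c; d] -> br w c d z = 0.
  by rewrite !inE => /orP[]/eqP->; rewrite ?br_aba ?br_baa.
have A0 z : z \in [:: a; b] -> br w a b z = 0.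
  by rewrite !inE => /orP[]/eqP->; rewrite ?br_aba ?br_baa.
have Cn z : z \notin [:: c; d] -> br w c d z != 0.
  by rewrite !inE negb_or => /andP[zc zd]; apply: (br_neq0 gw); uniq5.
have An z : z \notin [:: a; b] -> br w a b z != 0.
  by rewrite !inE negb_or => /andP[zc zd]; apply: (br_neq0 gw); uniq5.
have cab : c \notin [:: a; b] by rewrite !inE negb_or !(eq_sym c) ac.
have ab_cd z : z \in [:: c; d] -> z \notin [:: a; b].
  by rewrite !inE negb_or => /orP[]/eqP->; rewrite !(eq_sym _ a) !(eq_sym _ b) ?ac ?bc ?ad ?bd.
rewrite /cross; have [jc|jc] := boolP (j \in [:: c; d]).
  rewrite (C0 j jc) mul0r subr0 mulf_neq0 ?An ?ab_cd // Cn //.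
  by move: Hcd; rewrite jc orbF.
have [ja|ja] := boolP (j \in [:: a; b]).
  rewrite (A0 j ja) mulr0 sub0r oppr_eq0 mulf_neq0 ?Cn ?An //.
  by move: Hab; rewrite ja orbF.
have [ic|ic] := boolP (i \in [:: c; d]).
  by rewrite (C0 i ic) mul0r sub0r oppr_eq0 mulf_neq0 ?Cn ?An ?ab_cd.
apply: (generic_neq0 (f := fun w => br w c d i * br w a b j - br w c d j * br w a b i)
   (w' := move_vertex w j (px w c) (py w c)) gw).
  by apply: polyfunB; apply: polyfunM; exact: polyfun_br.
move: jc ja; rewrite !inE !negb_or => /andP[jc jd] /andP[ja jb].
have -> : br (move_vertex w j (px w c) (py w c)) c d j = 0.
  by rewrite /br !px_mv !py_mv eqxx (eq_sym c) (negPf jc) !subrr mulr0 mul0r subrr.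
have -> : br (move_vertex w j (px w c) (py w c)) a b j = br w a b c.
  by rewrite /br !px_mv !py_mv eqxx !(eq_sym _ j) (negPf ja) (negPf jb).
rewrite mul0r subr0 br_mv ?ij // 1?(eq_sym _ j) //; by rewrite mulf_neq0 ?Cn ?An.
Qed.

(** Together with [r], such a combination would put the row of [cd] in the span of [M] unless it is
    a multiple of [r], and [r] is not in [U0]. *)
Let indep p q : ((p *: erow w a b + q *: erow w c d)%R <= U0)%MS -> p = 0 /\ q = 0.
Proof.
move=> pq; have q0 : al * q + p * be = 0.
  apply: contraNeq ncd => q0; rewrite -(eqmx_scale _ q0).
  have -> : (al * q + p * be) *: erow w c d = al *: (p *: erow w a b + q *: erow w c d) - p *: r.
    by rewrite rE; apply/rowP => z; rewrite !mxE; ring.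
  rewrite addmx_sub //; first by rewrite scalemx_sub // (del_M (u := u)).
  by rewrite eqmx_opp scalemx_sub.
have p0 : p = 0.
  apply: contraNeq rU0 => p0; have n0 : p / al != 0 by rewrite mulf_neq0 ?invr_eq0.
  rewrite -(eqmx_scale _ n0); have -> // : p / al *: r = p *: erow w a b + q *: erow w c d.
  have -> : q = - (p * be / al).
    apply: (mulfI al0); have -> : al * - (p * be / al) = - (p * be) by field.
    by apply/eqP; rewrite -addr_eq0 q0.
  by rewrite rE; apply/rowP => z; rewrite !mxE; field.
by split=> //; move/eqP: q0; rewrite p0 mul0r addr0 mulf_eq0 (negPf al0) => /eqP.
Qed.

(** Two positions of [f] on the line [ij] give two nonproportional vectors [rho]. Were [ij] outside
    [U0], its row would be a nonzero multiple of each of them modulo [U0], against [indep]. *)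
Let apex_pair i j : i \in T -> j \in T -> i != j -> cross i j != 0 -> (erow w i j <= U0)%MS.
Proof.
move=> iT jT ij X0; apply: contraT => ijU0.
have [au bu cu du] := nu.
have /eqP/cards2P[p [q [pq TE]]] : #|T :\ i :\ j| = 2%N.
  by move: Teq4; rewrite (cardsD1 i) iT (cardsD1 j) in_setD1 eq_sym ij jT !add1n => -[->].
have /and3P[pj pi pT] : [&& p != j, p != i & p \in T] by have := set21 p q; rewrite -TE !in_setD1.
have /and3P[qj qi qT] : [&& q != j, q != i & q \in T] by have := set22 p q; rewrite -TE !in_setD1.
pose ws (s : rat) := move_vertex w u ((1 - ratr s) * px w i + ratr s * px w j)
   ((1 - ratr s) * py w i + ratr s * py w j).
pose As (s : rat) : R := br w c d a * br w c d b * ((1 - ratr s) * br w c d i + ratr s * br w c d j).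
pose Bs (s : rat) : R := br w a b c * br w a b d * ((1 - ratr s) * br w a b i + ratr s * br w a b j).
have brs x y s : x != u -> y != u -> br (ws s) x y u = (1 - ratr s) * br w x y i + ratr s * br w x y j.
  by move=> xu yu; rewrite -br_cyc -br_cyc br_line // -2!(br_cyc w _ x y).
have rs s : rho (ws s) a b c d f = As s *: erow w a b - Bs s *: erow w c d.
  by rewrite /rho -uf !brs // /ws !br_mv // !er_mv.
have detAB s t : As s * Bs t - As t * Bs s =
    br w c d a * br w c d b * (br w a b c * br w a b d) * (ratr t - ratr s) * cross i j.
  by rewrite /As /Bs /cross; ring.
have brne : br w c d a * br w c d b * (br w a b c * br w a b d) != 0.
  move: (U5); rewrite /= !inE !negb_or => /and5P[/and4P[ab ac ad af] /and3P[bc bd bf] /andP[cd cf] df _].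
  by rewrite !mulf_neq0 ?(br_neq0 gw) //; uniq5.
have det0 s t : s != t -> As s * Bs t - As t * Bs s != 0.
  move=> st; rewrite detAB; apply: mulf_neq0 X0; apply: mulf_neq0 brne _.
  by rewrite subr_eq0 (inj_eq (fmorph_inj _)) eq_sym.
have rsU0 s t : s != t -> ~~ (rho (ws s) a b c d f <= U0)%MS.
  move=> st; apply: contra (det0 s t st); rewrite rs -scaleNr => /indep[A0 B0].
  by rewrite A0; move/eqP: B0; rewrite oppr_eq0 => /eqP->; rewrite mulr0 mul0r subr0.
have rs0 s : rho (ws s) a b c d f *m blk R u = 0.
  by rewrite rs mulmxBl -!scalemxAl !er_blk !(eq_sym u) (negPf au) (negPf bu) (negPf cu) (negPf du) !scaler0 subrr.
have mem (s t : rat) : s != 0 -> s != 1 -> s != t -> exists z, ((erow w i j - z *: rho (ws s) a b c d f)%R <= U0)%MS.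
  move=> s0 s1 st; apply/sub_add_rowP.
  apply: (@line_pair _ _ w gw u i j p q T _ s) => //; first by uniq5.
    by apply/sub_kermxP; rewrite addsmx_sub genmxE; apply/andP; split; apply/sub_kermxP.
  rewrite -/(ws s) rank_add_row (rsU0 s t) // addn1.
  have := @rank_move _ _ w gw (del M u) u T (fun w => rho w a b c d f)
     ((1 - ratr s) * px w i + ratr s * px w j) ((1 - ratr s) * py w i + ratr s * py w j) _ uT _.
  rewrite -/(ws s) -/U0 => /(_ _ _)/leq_trans; apply.
  - by move=> e; rewrite inE => /andP[].
  - by move=> z; exact: polyfun_rho.
  rewrite addSn -addnS -Teq4 -rank_M; apply: mxrankS.
  by rewrite !addsmx_sub genmxE rM !SpM addsmxSl addsmxSr.
(* Any two distinct rational parameters other than 0 and 1 would do. *)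
have [k1 H1] := mem 2^-1 3^-1 isT isT isT; have [k2 H2] := mem 3^-1 2^-1 isT isT isT.
have nk (k : R) (x : 'rV[R]_(n * 3)) : ((erow w i j - k *: x)%R <= U0)%MS -> k != 0.
  by move=> H; apply: contraNneq ijU0 => k0; move: H; rewrite k0 scale0r subr0.
have : (((k1 * As 2^-1 - k2 * As 3^-1) *: erow w a b + (k2 * Bs 3^-1 - k1 * Bs 2^-1) *: erow w c d)%R <= U0)%MS.
  have -> : (k1 * As 2^-1 - k2 * As 3^-1) *: erow w a b + (k2 * Bs 3^-1 - k1 * Bs 2^-1) *: erow w c d
      = (erow w i j - k2 *: rho (ws 3^-1) a b c d f) - (erow w i j - k1 *: rho (ws 2^-1) a b c d f).
    by rewrite !rs; apply/rowP => z; rewrite !mxE; ring.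
  by rewrite addmx_sub // eqmx_opp.
case/indep => /eqP; rewrite subr_eq0 => /eqP E1 /eqP; rewrite subr_eq0 => /eqP E2.
have /eqP[] := det0 2^-1 3^-1 isT.
apply: (mulfI (mulf_neq0 (nk _ _ H1) (nk _ _ H2))); rewrite mulr0.
transitivity (k1 * As 2^-1 * (k2 * Bs 3^-1) - k2 * As 3^-1 * (k1 * Bs 2^-1)); first by ring.
by rewrite E1 E2 subrr.
Qed.

Let load4 i j k l : uniq [:: i; j; k; l] -> i \in T -> j \in T -> k \in T -> l \in T ->
  (erow w i k <= U0)%MS -> (erow w i l <= U0)%MS -> (erow w j k <= U0)%MS -> (erow w j l <= U0)%MS ->
  ((kap w i j u k l *: erow w i j + kap w k l u i j *: erow w k l)%R <= rspan w M)%MS.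
Proof.
move=> U4 iT jT kT lT ik il jk jl.
have U5' : uniq [:: u; i; j; k; l].
  by rewrite -[X in uniq X]/([:: u] ++ [:: i; j; k; l]) cat_uniq U4 /= !inE !(eq_sym _ u) !negb_or
     ![u == _]eq_sym !nv.
have := K5_load U0 U5' iT jT kT lT (genpos_w gw (s := _)); rewrite -SpM.
set x1 := kap w i j u k l *: _; set x2 := _ *: erow w i k; set x3 := _ *: erow w i l.
set x4 := _ *: erow w j k; set x5 := _ *: erow w j l; set x6 := kap w k l u i j *: _.
have -> : x1 + x6 = (x1 + x2 + x3 + x4 + x5 + x6) - (x2 + x3 + x4 + x5).
  by apply/rowP => z; rewrite !mxE; ring.
move=> H; apply: addmx_sub H _; rewrite eqmx_opp; apply: (del_M (u := u)).
by repeat apply: addmx_sub; apply: scalemx_sub.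
Qed.

Let sides p q : uniq [:: p; q] -> p \in T -> q \in T ->
  exists k l, uniq [:: p; q; k; l] /\ (k \in T /\ l \in T).
Proof.
rewrite /= inE andbT => pq pT qT.
have /eqP/cards2P[k [l [kl TE]]] : #|T :\ p :\ q| = 2%N.
  by move: Teq4; rewrite (cardsD1 p) pT (cardsD1 q) in_setD1 eq_sym pq qT !add1n => -[->].
have /and3P[kq kp kT] : [&& k != q, k != p & k \in T] by have := set21 k l; rewrite -TE !in_setD1.
have /and3P[lq lp lT] : [&& l != q, l != p & l \in T] by have := set22 k l; rewrite -TE !in_setD1.
by exists k, l; split => //; uniq5.
Qed.

(** By [apex_pair] every pair of [T] except possibly [ab] and [cd] lies in [U0]. If [T] contains
    neither pair, [not_K5] applies; if just one, the [K5] on [f] and [T] puts its row in the span of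
    [M]. *)
Lemma apex_step : False.
Proof.
move: (U5); rewrite /= !inE !negb_or => /and5P[/and4P[ab ac ad af] /and3P[bc bd bf] /andP[cd cf] df _].
have [abT|abT] := boolP ((a \in T) && (b \in T)).
  case/andP: (abT) => aT bT.
  have [cdT|cdT] := boolP ((c \in T) && (d \in T)).
    case/andP: cdT => cT dT.
    have H : ((kap w a b u c d *: erow w a b + kap w c d u a b *: erow w c d)%R <= rspan w M)%MS.
      have cN : c \notin [:: a; b] by rewrite !inE negb_or !(eq_sym c) ac.
      have dN : d \notin [:: a; b] by rewrite !inE negb_or !(eq_sym d) ad.
      have aN : a \notin [:: c; d] by rewrite !inE negb_or ac.
      have bN : b \notin [:: c; d] by rewrite !inE negb_or bc.
      by apply: load4 => //; [uniq5 | | | |]; apply: apex_pair => //; apply: cross_neq0 => //;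
        rewrite ?(negPf cN) ?(negPf dN) ?(negPf aN) ?(negPf bN) ?andbF.
    (* The [K5] on [f] and [T] puts the sum of the scaled rows of [ab] and [cd] in the span of [M],
       while [r] is a multiple of their difference; together they give twice the row of [ab]. *)
    move/negP: nab; apply; have n0 : 2%:R * al != 0 by rewrite mulf_neq0 ?pnatr_eq0.
    rewrite -(eqmx_scale _ n0).
    have -> : (2%:R * al) *: erow w a b = r + (al * be) *: (kap w a b u c d *: erow w a b + kap w c d u a b *: erow w c d).
      have -> : kap w a b u c d = be^-1 by rewrite /kap uf /be; congr (_^-1); ring.
      have -> : kap w c d u a b = al^-1 by rewrite /kap uf /al; congr (_^-1); ring.
      by rewrite rE; apply/rowP => z; rewrite !mxE; field; rewrite al0 be0.
    by rewrite addmx_sub // scalemx_sub.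
  have Uab : uniq [:: a; b] by uniq5.
  have [k [l [U4 [kT lT]]]] := sides Uab aT bT.
  move: (U4); rewrite /= !inE !negb_or => /and4P[/and3P[_ ak al'] /andP[bk bl] kl _].
  have pr x y : x \in [:: a; b] -> y \in T -> y \notin [:: a; b] -> (erow w x y <= U0)%MS.
    move=> xab yT yab; have xT : x \in T by move: xab; rewrite !in_cons in_nil orbF => /orP[]/eqP->.
    apply: apex_pair => //; first by apply: contraNneq yab => <-.
    apply: cross_neq0 => //; rewrite ?(negPf yab) ?andbF //.
      by apply: contraNneq yab => <-.
    suff -> : (x \in [:: c; d]) = false by [].
    by move: xab; rewrite !inE => /orP[]/eqP->; rewrite ?(negPf ac) ?(negPf bc) ?(negPf ad) ?(negPf bd).
  have kN : k \notin [:: a; b] by rewrite !inE negb_or !(eq_sym k) ak.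
  have lN : l \notin [:: a; b] by rewrite !inE negb_or !(eq_sym l) al'.
  have a2 : a \in [:: a; b] by rewrite !inE eqxx.
  have b2 : b \in [:: a; b] by rewrite !inE eqxx orbT.
  have := load4 U4 aT bT kT lT (pr a k a2 kT kN) (pr a l a2 lT lN) (pr b k b2 kT kN) (pr b l b2 lT lN).
  have klU : (erow w k l <= U0)%MS.
    apply: apex_pair => //; apply: cross_neq0 => //; first by rewrite (negPf kN).
    apply: contra cdT; rewrite !in_cons !in_nil !orbF => /andP[/orP[]/eqP kE /orP[]/eqP lE];
      by move: kl kT lT; rewrite kE lE ?eqxx // => _ -> ->.
  move=> H; move/negP: nab; apply.
  have U5' : uniq [:: a; b; u; k; l].
    by rewrite uf; have nuk := nv kT; have nul := nv lT; rewrite uf in nuk nul; uniq5.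
  rewrite -(eqmx_scale _ (kap_neq0 gw U5')) -[X in (X <= _)%MS](addrK (kap w k l u a b *: erow w k l)).
  by rewrite addmx_sub // eqmx_opp scalemx_sub // (del_M (u := u)).
have [cdT|cdT] := boolP ((c \in T) && (d \in T)).
  case/andP: (cdT) => cT dT.
  have Ucd : uniq [:: c; d] by uniq5.
  have [k [l [U4 [kT lT]]]] := sides Ucd cT dT.
  move: (U4); rewrite /= !inE !negb_or => /and4P[/and3P[_ ck cl] /andP[dk dl] kl _].
  have pr x y : x \in [:: c; d] -> y \in T -> y \notin [:: c; d] -> (erow w x y <= U0)%MS.
    move=> xab yT yab; have xT : x \in T by move: xab; rewrite !in_cons in_nil orbF => /orP[]/eqP->.
    apply: apex_pair => //; first by apply: contraNneq yab => <-.
    apply: cross_neq0 => //; rewrite ?(negPf yab) ?andbF //.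
      by apply: contraNneq yab => <-.
    suff -> : (x \in [:: a; b]) = false by [].
    by move: xab; rewrite !inE => /orP[]/eqP->; rewrite !(eq_sym _ a) !(eq_sym _ b) ?(negPf ac) ?(negPf bc) ?(negPf ad) ?(negPf bd).
  have kN : k \notin [:: c; d] by rewrite !inE negb_or !(eq_sym k) ck.
  have lN : l \notin [:: c; d] by rewrite !inE negb_or !(eq_sym l) cl.
  have c2 : c \in [:: c; d] by rewrite !inE eqxx.
  have d2 : d \in [:: c; d] by rewrite !inE eqxx orbT.
  have := load4 U4 cT dT kT lT (pr c k c2 kT kN) (pr c l c2 lT lN) (pr d k d2 kT kN) (pr d l d2 lT lN).
  have klU : (erow w k l <= U0)%MS.
    apply: apex_pair => //; apply: cross_neq0 => //; last by rewrite (negPf kN).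
    apply: contra abT; rewrite !in_cons !in_nil !orbF => /andP[/orP[]/eqP kE /orP[]/eqP lE];
      by move: kl kT lT; rewrite kE lE ?eqxx // => _ -> ->.
  move=> H; move/negP: ncd; apply.
  have U5' : uniq [:: c; d; u; k; l].
    by rewrite uf; have nuk := nv kT; have nul := nv lT; rewrite uf in nuk nul; uniq5.
  rewrite -(eqmx_scale _ (kap_neq0 gw U5')) -[X in (X <= _)%MS](addrK (kap w k l u c d *: erow w k l)).
  by rewrite addmx_sub // eqmx_opp scalemx_sub // (del_M (u := u)).
have [i [j [k [l [U4 iT jT kT lT]]]]] := enum4 Teq4.
apply: (not_K5 U4 iT jT kT lT) => x y xT yT xy.
have sT z : z \in [:: i; j; k; l] -> z \in T.
  by rewrite !in_cons in_nil orbF => /or4P[]/eqP->.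
apply: apex_pair; rewrite ?(sT x) ?(sT y) //; apply: cross_neq0; rewrite ?(sT x) ?(sT y) //.
  apply: contra abT; rewrite !in_cons !in_nil !orbF => /andP[/orP[]/eqP xE /orP[]/eqP yE];
    have := sT x xT; have := sT y yT; move: xy; rewrite xE yE ?eqxx // => _ -> ->; by [].
apply: contra cdT; rewrite !in_cons !in_nil !orbF => /andP[/orP[]/eqP xE /orP[]/eqP yE];
  have := sT x xT; have := sT y yT; move: xy; rewrite xE yE ?eqxx // => _ -> ->; by [].
Qed.
End Apex.
End Step.
End Minimal.

Section Forcing.
Variables (R : realFieldType) (n : nat) (w : 'I_(n + n) -> R).
Hypothesis gw : alg_indep_Q w.
Implicit Types (a b c d f : 'I_n) (W : {set 'I_n}) (S : {set 'I_n * 'I_n}).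

(** Induction on the number of vertices, for a minimal edge set that spans [rho]. That [f] need not
    belong to [W] allows [f] itself to be deleted. *)
Lemma rho_forces W S a b c d f : S \subset setX W W ->
  a \in W -> b \in W -> c \in W -> d \in W -> uniq [:: a; b; c; d; f] ->
  (rho w a b c d f <= rspan w S)%MS -> (erow w a b <= rspan w S)%MS.
Proof.
elim/ltn_ind: {W}#|W| {-2}W (erefl #|W|) S a b c d f => k IH W Wk S a b c d f SW aW bW cW dW U5 rS.
have [M /minsetP[rM minM] MS] := minset_exists (P := fun D => (rho w a b c d f <= rspan w D)%MS) rS.
apply: contraT => nabS.
have nab : ~~ (erow w a b <= rspan w M)%MS.
  by apply: contra nabS => /submx_trans; apply; exact: SpS.
have MW := subset_trans MS SW.
have minM' (D : {set 'I_n * 'I_n}) : D \proper M -> ~~ (rho w a b c d f <= rspan w D)%MS.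
  by move=> DM; apply/negP => rD; move: (DM); rewrite (minM D rD (proper_sub DM)) properxx.
have IH' W' S' a' b' c' d' f' : (#|W'| < #|W|)%N -> S' \subset setX W' W' ->
    a' \in W' -> b' \in W' -> c' \in W' -> d' \in W' -> uniq [:: a'; b'; c'; d'; f'] ->
    (rho w a' b' c' d' f' <= rspan w S')%MS -> (erow w a' b' <= rspan w S')%MS.
  by rewrite Wk => lt; apply: (IH _ lt W' erefl).
have [[u [uW uN] /andP[u4 u5]]|[fW f4]] := low_degree gw U5 aW bW cW dW MW rM minM' nab IH'.
  by case: (other_step gw U5 aW bW cW dW MW rM minM' nab IH' uW u4 uN u5).
by case: (apex_step gw U5 rM minM' nab (u := f)); rewrite ?f4.
Qed.
End Forcing.

(** * Relations are generated by K5 relations *)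

Section Formal.
Variables (R : realFieldType) (n : nat) (w : 'I_(n + n) -> R).
Hypothesis gw : alg_indep_Q w.
Implicit Types (i j k l m v a b c d f : 'I_n) (T W : {set 'I_n}) (S D : {set 'I_n * 'I_n}).

Notation NN := #|{: 'I_n * 'I_n}|.

(** The formal edge space: one coordinate per pair [i < j]; [fomap] sends a formal edge to its
row, so that its kernel consists of the relations between rows. *)
Definition fedge i j : 'rV[R]_NN :=
  if (i < j)%N then delta_mx 0 (enum_rank (i, j))
  else if (j < i)%N then - delta_mx 0 (enum_rank (j, i)) else 0.

Definition fomap : 'M[R]_(NN, n * 3) := \matrix_(k < NN) erow w (enum_val k).1 (enum_val k).2.

Lemma foN i j : fedge j i = - fedge i j.
Proof. by rewrite /fedge; case: ltngtP => _; rewrite ?opprK ?oppr0. Qed.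

Lemma foii i : fedge i i = 0.
Proof. by rewrite /fedge ltnn. Qed.

Lemma fomapE i j : fedge i j *m fomap = erow w i j.
Proof.
have E p q : delta_mx 0 (enum_rank (p, q)) *m fomap = erow w p q by rewrite -rowE rowK enum_rankK.
rewrite /fedge; case: ltngtP => [_|_|/val_inj ->]; first exact: E.
  by rewrite mulNmx E erN opprK.
by rewrite mul0mx erii.
Qed.

Definition fspan S : 'M[R]_NN := (\sum_(e in S) <<fedge e.1 e.2>>)%MS.

Lemma fo_Fs S i j : ((i, j) \in S) || ((j, i) \in S) -> (fedge i j <= fspan S)%MS.
Proof.
case/orP => ijS; first by apply: (sumsmx_sup (i, j)) => //=; rewrite genmxE.
by rewrite foN eqmx_opp; apply: (sumsmx_sup (j, i)) => //=; rewrite genmxE.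
Qed.

Lemma Fs_sub S S' : S \subset S' -> (fspan S <= fspan S')%MS.
Proof.
by move=> /subsetP SS; apply/sumsmx_subP => e eS; apply: (sumsmx_sup e) => //; exact: SS.
Qed.

Lemma FsP N S (B : 'M[R]_(N, NN)) :
  (forall i j, (i, j) \in S -> (fedge i j <= B)%MS) -> (fspan S <= B)%MS.
Proof. by move=> H; apply/sumsmx_subP => -[i j] eS; rewrite genmxE H. Qed.

Lemma Fs_map S : (fspan S *m fomap :=: rspan w S)%MS.
Proof.
apply: eqmx_trans (sumsmxMr_gen _ _ _) _; apply: eqmx_sums => e _.
have /eq_genmx -> : (<<fedge e.1 e.2>>%MS *m fomap :=: erow w e.1 e.2)%MS; last exact: eqmx_refl.
by apply: eqmx_trans (eqmxMr _ (genmxE _)) _; rewrite fomapE.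
Qed.

Lemma Fs_del S v (x : 'rV_NN) : (x <= fspan S)%MS ->
  exists2 x0, (x0 <= fspan (del S v))%MS & exists z : 'I_n -> R, x = x0 + \sum_(j in nbrs S v) z j *: fedge v j.
Proof.
have le : (fspan S <= fspan (del S v) + \sum_(j in nbrs S v) <<fedge v j>>)%MS.
  apply: FsP => i j ijS; have [->|ij] := eqVneq i j; first by rewrite foii sub0mx.
  have [iv|iv] := eqVneq i v.
    apply: submx_trans (addsmxSr _ _); apply: (sumsmx_sup j); last by rewrite iv genmxE.
    by rewrite inE -iv eq_sym ij ijS.
  have [jv|jv] := eqVneq j v.
    apply: submx_trans (addsmxSr _ _); apply: (sumsmx_sup i); last by rewrite jv foN eqmx_opp genmxE.
    by rewrite inE -jv ij ijS orbT.
  by apply: submx_trans (addsmxSl _ _); apply: fo_Fs; rewrite inE ijS /= iv jv.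
move=> /submx_trans/(_ le)/sub_addsmxP[[p q] /= ->].
have /sub_sum_genP[z zE] := submxMl q (\sum_(j in nbrs S v) <<fedge v j>>)%MS.
by exists (p *m fspan (del S v)); [rewrite submxMl | exists z; rewrite zE].
Qed.

Variables (U : 'M[R]_(n * 3)) (G : 'M[R]_NN).
Hypothesis GK5 : forall a b c d f, uniq [:: a; b; c; d; f] ->
  {in [:: a; b; c; d; f] &, forall i j, (erow w i j <= U)%MS} -> (K5comb w fedge a b c d f <= G)%MS.
Hypothesis GA : G *m fomap = 0.

Section Step.
Variables (W : {set 'I_n}) (D : {set 'I_n * 'I_n}) (v : 'I_n).
Hypothesis vW : v \in W.
Hypothesis DW : D \subset setX W W.
Hypothesis DU : (rspan w D <= U)%MS.
Let T := nbrs D v.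
Let U0 := rspan w (del D v).
Let vT : v \notin T. Proof. exact: nbN. Qed.
Let TW : T \subset W :\ v. Proof. exact: nb_sub. Qed.
Let U00 : U0 *m blk R v = 0. Proof. exact: del_blk0. Qed.
Let SpD : (rspan w D :=: U0 + star w v T)%MS. Proof. exact: Sp_del. Qed.
Let U0U : (U0 <= U)%MS.
Proof. by apply: submx_trans DU; rewrite SpS ?del_sub. Qed.
Hypothesis T4 : (4 <= #|T| <= 5)%N.
Variable z : 'I_n -> R.
Hypothesis z0 : forall j, j \in T -> z j != 0.
Hypothesis zU0 : ((\sum_(j in T) z j *: erow w v j)%R <= U0)%MS.

Let move_rank x y : (\rank (U0 + star (move_vertex w v x y) v T)%MS <= \rank (U0 + star w v T)%MS)%N.
Proof.
have := @rank_move _ _ w gw (del D v) v T (fun=> 0) x y _ vT _.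
rewrite !genmx0 !addsmx0_id; apply; last first.
  by move=> t; have [q qE] := @polyfun0 R (n + n); exists q => u; rewrite -qE mxE.
by move=> e; rewrite inE => /andP[].
Qed.

Let dep j : j \in T -> (U0 + star w v T <= U0 + star w v (T :\ j))%MS.
Proof.
move=> jT; rewrite addsmx_sub addsmxSl /=; apply/sumsmx_subP => t tT; rewrite genmxE.
have sub i : i \in T :\ j -> (erow w v i <= U0 + star w v (T :\ j))%MS.
  by move=> iT; apply: submx_trans (addsmxSr _ _); exact: er_star.
have [->|tj] := eqVneq t j; last by apply: sub; rewrite in_setD1 tj.
rewrite -(eqmx_scale _ (z0 jT)).
move: zU0; rewrite (big_setD1 j) //= => H.
rewrite -[X in (X <= _)%MS](addrK (\sum_(i in T :\ j) z i *: erow w v i)).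
apply: addmx_sub; first exact: submx_trans H (addsmxSl _ _).
by rewrite eqmx_opp summx_sub // => i iT; rewrite scalemx_sub // sub.
Qed.

Let others i j : i \in T -> j \in T -> i != j ->
  exists k l, [/\ uniq [:: i; j; k; l], k \in T & l \in T].
Proof.
move=> iT jT ij; have /card_gt1P[k [l [kT lT kl]]] : (1 < #|T :\ i :\ j|)%N.
  case/andP: T4; rewrite (cardsD1 i T) iT (cardsD1 j) in_setD1 (eq_sym j) ij jT !add1n !ltnS.
  by [].
move: kT lT; rewrite !in_setD1 => /and3P[kj ki kT] /and3P[lj li lT].
by exists k, l; split => //; uniq5.
Qed.

(** All coefficients being nonzero, each edge of the star is redundant, so at most 4 dimensions are
    added. If at most 3 are, midpoints suffice. Otherwise [local_classification] applies: its first
    case would bring the rank down to 3 by [K5_rank], and its last is excluded by [rho_forces]. *)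
Lemma step_clique i j : i \in T -> j \in T -> (erow w i j <= U)%MS.
Proof.
move=> iT jT; have [->|ij] := eqVneq i j; first by rewrite erii sub0mx.
have [small|big] := leqP (\rank (U0 + star w v T)%MS) (\rank U0 + 3).
  have [k [l [U4 kT lT]]] := others iT jT ij; apply: submx_trans U0U.
  apply: (@line_pair _ _ w gw v i j k l T U0 2^-1) => //.
  by apply: leq_trans (move_rank _ _) small.
have dep_rank t : t \in T -> (\rank (U0 + star w v T)%MS <= \rank (U0 + star w v (T :\ t))%MS)%N.
  by move=> tT; apply/mxrankS/dep.
have T5 : #|T| = 5%N.
  apply/eqP; case/andP: T4 => t4 t5; rewrite eqn_leq t5 ltnNge; apply: contraL big => T4'.
  rewrite -leqNgt (leq_trans (dep_rank i iT)) // (leq_trans (rank_star_leq _ _ _ _)) // leq_add2l.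
  by move: T4'; rewrite (cardsD1 i T) iT.
have le4 : (\rank (U0 + star w v T)%MS <= \rank U0 + 4)%N.
  rewrite (leq_trans (dep_rank i iT)) // (leq_trans (rank_star_leq _ _ _ _)) // leq_add2l.
  by move: T5; rewrite (cardsD1 i T) iT add1n => -[->].
have H x y : (\rank (U0 + star (move_vertex w v x y) v T)%MS <= \rank U0 + 4)%N.
  exact: leq_trans (move_rank x y) le4.
case: (local_classification gw vT U00 H T5) => [[t tT o1]|[i0 [j0 [i0T j0T o2]]]|].
- have Tt4 : #|T :\ t| = 4%N by move: T5; rewrite (cardsD1 t T) tT add1n => -[].
  have [i' [j' [k' [l' [U4 iT' jT' kT' lT']]]]] := enum4 Tt4.
  have nv s : s \in T -> v != s by move=> sT; apply: contraNneq vT => ->.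
  have dT s : s \in T :\ t -> s \in T by case/setD1P.
  have U5 : uniq [:: v; i'; j'; k'; l'].
    rewrite cons_uniq U4 andbT !in_cons in_nil orbF !negb_or !nv ?dT //.
  have o1' p q : p \in T :\ t -> q \in T :\ t -> (erow w p q <= U0)%MS.
    by case/setD1P=> pt pT /setD1P[qt qT]; apply: o1.
  have := K5_rank gw U5 iT' jT' kT' lT' (o1' _ _ iT' jT') (o1' _ _ iT' kT') (o1' _ _ iT' lT')
    (o1' _ _ jT' kT') (o1' _ _ jT' lT') (o1' _ _ kT' lT').
  rewrite Tt4 ltnNge; case/negP; rewrite addnS; exact: leq_trans big (dep_rank t tT).
- apply: submx_trans DU; rewrite SpD; apply: submx_trans (_ : U0 + rspan w (setX T T) <= _)%MS.
    by apply: submx_trans (addsmxSr _ _); exact: er_Sp_setX.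
  apply: star_absorb => //; apply: leq_trans big; rewrite -(addn1 (_ + 3)) addnAC leq_add2r.
  apply: leq_trans (_ : \rank (U0 + <<erow w i0 j0>>)%MS <= _)%N; last first.
    by rewrite rank_add_row leq_add2l leq_b1.
  apply: mxrankS; rewrite addsmx_sub addsmxSl /=; apply: SpP => p q.
  by rewrite in_setX => /andP[pT qT]; exact: o2.
case=> a [b [c [d [f [U5 [aT bT cT dT fT] [r1 _] [nab _]]]]]].
have inW s : s \in T -> s \in W :\ v by move/(subsetP TW).
by move/negP: nab; case; apply: (rho_forces gw (del_setX v DW) (inW a aT) (inW b bT) (inW c cT) (inW d dT) U5).
Qed.

(** [load_span] for formal edges; its [K5]s are available because [step_clique] puts all their edges
    in [U]. *)
Lemma step_load : ((\sum_(j in T) z j *: fedge v j)%R <= G + fspan (setX T T))%MS.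
Proof.
apply: (load_span gw vT); last first.
  have : (\sum_(j in T) z j *: erow w v j) *m blk R v = 0.
    by apply/sub_kermxP/(submx_trans zU0); apply/sub_kermxP.
  by rewrite mulmx_suml => E; rewrite -[RHS]E; apply: eq_bigr => j _; rewrite -scalemxAl er_blk eqxx.
move=> i j k l iT jT kT lT U5; apply: GK5 => //.
have vU s : s \in T -> (erow w v s <= U)%MS.
  move=> sT; apply: submx_trans DU; apply: er_Sp.
  by move: sT; rewrite /T inE => /andP[].
have H s : s \in [:: v; i; j; k; l] -> s = v \/ s \in T.
  by rewrite in_cons => /predU1P[|sT]; [left|right; move: sT; rewrite !in_cons in_nil orbF => /or4P[]/eqP->].
move=> s t /H[->|sT] /H[->|tT]; rewrite ?erii ?sub0mx ?vU //; last exact: step_clique.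
by rewrite erN eqmx_opp vU.
Qed.
End Step.

Lemma dependent_edge D : (\rank (rspan w D) < #|D|)%N ->
  exists2 e, e \in D & (erow w e.1 e.2 <= rspan w (D :\ e))%MS.
Proof.
move=> rk; have [/exists_inP[e eD eS]|/exists_inPn H] :=
    boolP [exists e in D, (erow w e.1 e.2 <= rspan w (D :\ e))%MS]; first by exists e.
by move: rk; rewrite free_rank ?ltnn // => e /H.
Qed.

Lemma ker_G N (g : 'M[R]_(N, NN)) : (g <= G)%MS -> g *m fomap = 0.
Proof. by case/submxP => p ->; rewrite -mulmxA GA mulmx0. Qed.

(** Induction on [#|W|], then on [#|D|]. A star with 4 or 5 nonzero coefficients is traded by
    [step_load] for pairs of its neighbours modulo [G]. These may be new edges, but they avoid [v]
    and are in [U], so the outer induction applies. *)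
Lemma relation_span W D x : D \subset setX W W -> (rspan w D <= U)%MS ->
  (x <= fspan D)%MS -> (x : 'rV_NN) *m fomap = 0 -> (x <= G)%MS.
Proof.
elim/ltn_ind: {W}#|W| {-2}W (erefl #|W|) D x => p IHW W Wp D.
elim/ltn_ind: {D}#|D| {-2}D (erefl #|D|) => q IHD D Dq x DW DU xD x0.
have lW v : v \in W -> (#|W :\ v| < p)%N by move=> vW; rewrite -Wp [X in (_ < X)%N](cardsD1 v) vW.
have delU v : (rspan w (del D v) <= U)%MS by apply: submx_trans DU; rewrite SpS ?del_sub.
have load v x1 z : (x1 <= fspan (del D v))%MS -> x = x1 + \sum_(j in nbrs D v) z j *: fedge v j ->
    ((\sum_(j in nbrs D v) z j *: erow w v j)%R <= rspan w (del D v))%MS.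
  move=> x1D xE; have -> : \sum_(j in nbrs D v) z j *: erow w v j = - (x1 *m fomap).
    apply/eqP; rewrite -addr_eq0 addrC -[X in _ == X]x0 xE mulmxDl mulmx_suml; apply/eqP; congr (_ + _).
    by apply: eq_bigr => j _; rewrite -scalemxAl fomapE.
  by rewrite eqmx_opp -Fs_map submxMr.
have [/exists_inP[v vW T3]|/exists_inPn deg4] := boolP [exists v in W, (#|nbrs D v| <= 3)%N].
  have [x1 x1D [z xE]] := Fs_del v xD.
  have z0 j : j \in nbrs D v -> z j = 0.
    apply: (load_small gw (nbN D v) T3).
    have : (\sum_(j in nbrs D v) z j *: erow w v j) *m blk R v = 0.
      by apply/sub_kermxP/(submx_trans (load v x1 z x1D xE))/sub_kermxP/del_blk0.
    by rewrite mulmx_suml => E; rewrite -[RHS]E; apply: eq_bigr => t _; rewrite -scalemxAl er_blk eqxx.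
  have xx1 : x = x1 by rewrite xE big1 ?addr0 // => j /z0 ->; rewrite scale0r.
  by apply: (IHW _ (lW v vW) _ erefl (del D v)); rewrite ?del_setX ?xx1 // -xx1.
have [W0|/set0Pn[v0 v0W]] := eqVneq W set0.
  suff D0 : D = set0 by move: xD; rewrite D0 /fspan big_set0 => /submx_trans; apply; rewrite sub0mx.
  by apply/eqP; rewrite -subset0; apply: subset_trans DW _; apply/subsetP => e; rewrite W0 !inE.
have W3 : (3 <= #|W|)%N.
  have := deg4 v0 v0W; rewrite -ltnNge => d4; apply: leq_trans (subset_leq_card (subsetDl W [set v0])).
  by apply: leq_trans (subset_leq_card (nb_sub v0 DW)); apply: ltnW.
have rkD : (\rank (rspan w D) + 6 <= 3 * #|W|)%N.
  apply: leq_trans (rank_complete_leq gw W3); rewrite leq_add2r; apply/mxrankS/SpS; exact: DW.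
(* If [D] exceeds the rank bound by two, [D] minus an edge still carries a relation; it is in [G] by
   induction and serves to remove an edge from [x]. Otherwise the degrees average below 6. *)
have [big|small] := leqP (3 * #|W|) (#|D| + 4).
  have /card_gt0P[e eD] : (0 < #|D|)%N.
    by move: big W3; case: #|D| => // big W3; move: (leq_trans (leq_mul (leqnn 3) W3) big).
  have rk' : (\rank (rspan w (D :\ e)) < #|D :\ e|)%N.
    have : (\rank (rspan w (D :\ e)) <= \rank (rspan w D))%N by apply/mxrankS/SpS/subD1set.
    have := cardsD1 e D; rewrite eD; move: rkD big.
    move: (\rank _) (\rank _) #|D| #|D :\ e| #|W| => r1 r2 c1 c2 c3; clear; lia.
  have [e' /setD1P[ee' e'D] e'S] := dependent_edge rk'.
  have sub : (D :\ e) :\ e' \subset D :\ e' by rewrite setSD // subD1set.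
  have : (erow w e'.1 e'.2 <= fspan (D :\ e :\ e') *m fomap)%MS by rewrite Fs_map.
  case/submxP => u uE; pose y := fedge e'.1 e'.2 - u *m fspan (D :\ e :\ e').
  have y0 : y *m fomap = 0 by rewrite mulmxBl fomapE -mulmxA -uE subrr.
  have uD : (u *m fspan (D :\ e :\ e') <= fspan (D :\ e :\ e'))%MS by rewrite submxMl.
  have yG : (y <= G)%MS.
    apply: (IHD _ _ (D :\ e) erefl) => //.
    - by rewrite -Dq (cardsD1 e D) eD.
    - exact: subset_trans (subD1set _ _) DW.
    - by apply: submx_trans DU; apply/SpS/subD1set.
    rewrite addmx_sub ?eqmx_opp ?(submx_trans uD) ?Fs_sub ?subD1set //.
    by apply: fo_Fs; rewrite -surjective_pairing !inE ee' e'D.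
  have : (x <= fspan (D :\ e') + <<fedge e'.1 e'.2>>)%MS.
    by apply: submx_trans xD _; rewrite /fspan (big_setD1 e') //= addsmxC.
  case/sub_add_rowP => t tD.
  rewrite -[x](subrK (t *: y)) addmx_sub ?scalemx_sub //.
  apply: (IHD _ _ (D :\ e') erefl).
  - by rewrite -Dq (cardsD1 e' D) e'D.
  - exact: subset_trans (subD1set _ _) DW.
  - by apply: submx_trans DU; apply/SpS/subD1set.
  - have -> : x - t *: y = (x - t *: fedge e'.1 e'.2) + t *: (u *m fspan (D :\ e :\ e')).
      by rewrite scalerBr opprB addrA addrAC.
    by rewrite addmx_sub // scalemx_sub // (submx_trans uD) // Fs_sub.
  - by rewrite mulmxBl x0 -scalemxAl y0 scaler0 subr0.
have [v vW T5] : exists2 v, v \in W & (#|nbrs D v| <= 5)%N.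
  apply/exists_inP; apply: contraT => /exists_inPn H.
  have : (\sum_(v in W) 6 <= \sum_(v in W) #|nbrs D v|)%N.
    by apply: leq_sum => v /H; rewrite -ltnNge.
  rewrite sum_nat_const => /leq_trans/(_ (sum_nb D W)); move: small.
  by move: #|D| #|W| => c1 c2; clear; lia.
have T4 : (4 <= #|nbrs D v| <= 5)%N by rewrite T5 andbT ltnNge deg4.
have [x1 x1D [z xE]] := Fs_del v xD.
have [/exists_inP[j jT /eqP zj]|/exists_inPn z0] := boolP [exists j in nbrs D v, z j == 0].
  pose D' := D :\ (v, j) :\ (j, v).
  have D'D : D' \subset D by apply: subset_trans (subD1set _ _) (subD1set _ _).
  apply: (IHD _ _ D' erefl) => //.
  - rewrite -Dq; apply: proper_card; rewrite properE D'D /=; apply/subsetPn.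
    by move: jT; rewrite inE => /andP[_ /orP[]] jD; [exists (v, j)|exists (j, v)]; rewrite // !inE eqxx ?andbF.
  - exact: subset_trans D'D DW.
  - by apply: submx_trans DU; exact: SpS.
  rewrite xE; apply: addmx_sub.
    apply: submx_trans x1D _; apply: Fs_sub; apply/subsetP => -[p1 p2].
    by rewrite !inE /= !xpair_eqE => /and3P[-> /negPf-> /negPf->]; rewrite andbF.
  apply: summx_sub => t; have [->|tj] := eqVneq t j; first by rewrite zj scale0r sub0mx.
  rewrite inE => /andP[tv tD]; apply: scalemx_sub; apply: fo_Fs.
  by rewrite !inE !xpair_eqE (negPf tj) (negPf tv) /= ?andbF.
have zU0 := load v x1 z x1D xE.
have TW := nb_sub v DW; set T := nbrs D v in TW.
have /sub_addsmxP[[g y] /= gyE] := step_load DW DU T4 z0 zU0.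
pose D2 := del D v :|: setX T T.
have gG : (g *m G <= G)%MS by rewrite submxMl.
rewrite -[x](subrK (g *m G)) addmx_sub //.
apply: (IHW _ (lW v vW) _ erefl D2).
- by rewrite subUset del_setX // setXS.
- rewrite SpU addsmx_sub delU; apply: SpP => i j; rewrite inE => /andP[iT jT].
  exact: (step_clique DW DU T4 z0 zU0).
- rewrite xE gyE [g *m G + _]addrC addrA addrK.
  by rewrite addmx_sub ?(submx_trans x1D) ?(submx_trans (submxMl _ _)) ?Fs_sub ?subsetUl ?subsetUr.
- by rewrite mulmxBl x0 ker_G ?subr0.
Qed.
End Formal.

(** * Counting cliques *)

Section Counting.
Variables (R : realFieldType) (n : nat) (w : 'I_(n + n) -> R).
Hypothesis gw : alg_indep_Q w.
Implicit Types (i j k l m v a b c d f : 'I_n) (T W X Y : {set 'I_n}) (S D : {set 'I_n * 'I_n}).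

Notation fe := (@fedge R n).
Notation Fe := (@fspan R n).
Notation Cg X := (setX X X).

Lemma Fs_coord S i j (x : 'rV_#|{: 'I_n * 'I_n}|) : (i < j)%N -> (i, j) \notin S -> (j, i) \notin S ->
  (x <= Fe S)%MS -> x 0 (enum_rank (i, j)) = 0.
Proof.
move=> ij ijS jiS /sub_sum_genP[z ->]; rewrite summxE big1 // => -[p q] pqS; rewrite mxE /= /fedge.
case: ltngtP => [pq|qp|_].
- rewrite mxE eqxx (inj_eq enum_rank_inj) /=; case: eqP => [E|]; last by rewrite mulr0.
  by rewrite -E (negPf ijS) in pqS.
- rewrite mxE mxE eqxx (inj_eq enum_rank_inj) /=; case: eqP => [E|]; last by rewrite oppr0 mulr0.
  by case: E pqS jiS => -> -> ->.
- by rewrite mxE mulr0.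
Qed.

Lemma rank_Fs S : S \subset EKn n -> \rank (Fe S) = #|S|.
Proof.
elim: {S}#|S| {-2}S (erefl #|S|) => [S /eqP|p IH S Sk SE].
  by rewrite cards_eq0 => /eqP-> _; rewrite /fspan big_set0 mxrank0 cards0.
have /card_gt0P[[i j] eS] : (0 < #|S|)%N by rewrite Sk.
have cS : #|S :\ (i, j)| = p by move: Sk; rewrite (cardsD1 (i, j)) eS add1n => -[].
have ij : (i < j)%N by have := subsetP SE _ eS; rewrite inE.
have -> : Fe S = (Fe (S :\ (i, j)) + <<fe i j>>)%MS by rewrite /fspan (big_setD1 (i, j)) //= addsmxC.
rewrite rank_add_row IH //; last exact: subset_trans (subD1set _ _) SE.
rewrite cS Sk; suff -> : (fe i j <= Fe (S :\ (i, j)))%MS = false by rewrite addn1.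
apply/negP => /(Fs_coord ij); rewrite !inE eqxx /= => /(_ isT).
have jiS : (j, i) \notin S by apply/negP => /(subsetP SE); rewrite inE /edgeKn /= ltnNge ltnW.
rewrite (negPf jiS) andbF => /(_ isT); rewrite /fedge ij mxE !eqxx /=.
by move/eqP; rewrite oner_eq0.
Qed.

Lemma rank_Fs_ge S : (#|S :&: EKn n| <= \rank (Fe S))%N.
Proof. by rewrite -rank_Fs ?subsetIr //; apply/mxrankS/Fs_sub/subsetIl. Qed.

Lemma rank_Fs_complete X : (\rank (Fe (Cg X)) <= #|Cg X :&: EKn n|)%N.
Proof.
rewrite -rank_Fs ?subsetIr //; apply/mxrankS/FsP => i j; rewrite inE => /andP[/= iX jX].
case: (ltngtP i j) => [ij|ji|/val_inj ->]; last by rewrite foii sub0mx.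
  by apply: fo_Fs; rewrite !inE /= iX jX /edgeKn ij.
by apply: fo_Fs; rewrite !inE /= iX jX /edgeKn ji /= orbT.
Qed.

Lemma dv_neq0 i j : i != j -> dv w i j != 0.
Proof.
move=> ij; apply: contraNneq (px_neq gw ij) => /rowP/(_ 0); rewrite !mxE /Dvec /= => /eqP.
by rewrite sqrf_eq0 subr_eq0.
Qed.

(** A triangle is independent, and each further vertex brings three independent loads
    ([star_rank]). *)
Lemma rank_complete_geq W : (3 <= #|W|)%N -> (3 * #|W| <= \rank (rspan w (Cg W)) + 6)%N.
Proof.
elim: {W}#|W| {-2}W (erefl #|W|) => [|p IH] W Wp; first by rewrite Wp.
rewrite [in X in X -> _]Wp => W3; have /card_gt0P[v vW] : (0 < #|W|)%N by rewrite Wp.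
have Wv : #|W :\ v| = p by move: Wp; rewrite (cardsD1 v) vW add1n => -[].
have nv t : t \in W :\ v -> v != t by case/setD1P; rewrite eq_sym.
have tW t : t \in W :\ v -> t \in W by case/setD1P.
pose B := rspan w (Cg (W :\ v)).
have B0 : B *m blk R v = 0 by apply: Sp_blk0 => i j; rewrite !inE => /andP[/andP[-> _] /andP[-> _]].
have BA : (B <= rspan w (Cg W))%MS by apply: SpS; rewrite setXS // subD1set.
have eA t : t \in W :\ v -> (erow w v t <= rspan w (Cg W))%MS.
  by move=> tWv; apply: er_Sp_setX => //; exact: tW.
move: W3; rewrite leq_eqVlt => /orP[/eqP p2|p3].
  case: p2 => p2; rewrite -p2 in Wv Wp.
  have /eqP/cards2P[i [j [ij WE]]] : #|W :\ v| = 2%N by rewrite Wv.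
  have iW : i \in W :\ v by rewrite WE set21.
  have jW : j \in W :\ v by rewrite WE set22.
  rewrite Wp -[(3 * _)%N]/(3 + 6)%N leq_add2r.
  have le : (<<erow w i j>> + <<erow w v i>> + <<erow w v j>> <= rspan w (Cg W))%MS.
    by rewrite !addsmx_sub !genmxE !eA ?er_Sp_setX ?tW.
  apply: leq_trans (mxrankS le); rewrite !rank_add_row.
  have r0 : <<erow w i j>>%MS *m blk R v = 0.
    apply/sub_kermxP; rewrite genmxE; apply/sub_kermxP.
    by rewrite er_blk (negPf (nv i iW)) (negPf (nv j jW)).
  have -> : (erow w v i <= <<erow w i j>>)%MS = false.
    apply/negP => /(submxMr (blk R v)); rewrite r0 er_blk eqxx => /submxP[z].
    by rewrite mulmx0 => /eqP; rewrite (negPf (dv_neq0 (nv i iW))).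
  have -> : (erow w v j <= <<erow w i j>> + <<erow w v i>>)%MS = false.
    apply/negP => /sub_add_rowP[z] /(submxMr (blk R v)); rewrite r0 => /submxP[z'].
    rewrite mulmx0 mulmxBl -scalemxAl !er_blk eqxx => E.
    have bij : br w v i j != 0 by apply: (br_neq0 gw); rewrite /= !inE negb_or !nv // ij.
    have [_ /eqP] : - z = 0 /\ 1 = 0 :> R.
      by apply: (dv_indep2 bij); rewrite -[RHS]E scaleNr scale1r addrC.
    by rewrite oner_eq0.
  rewrite !addn1 !ltnS lt0n mxrank_eq0 -submx0 genmxE submx0.
  apply/eqP => E0; have := er_blk w i j i; rewrite E0 mul0mx eqxx => /esym/eqP.
  by rewrite (negPf (dv_neq0 ij)).
have := IH _ Wv; rewrite Wv => /(_ p3) H.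
have [i [j [k [U3 iW jW kW]]]] : exists i j k, [/\ uniq [:: i; j; k], i \in W :\ v, j \in W :\ v & k \in W :\ v].
  move: p3; rewrite -Wv cardE; have := enum_uniq (W :\ v); have := mem_enum (W :\ v).
  case: (enum _) => [|i [|j [|k s]]] //= mT U _; exists i, j, k.
  split; rewrite -?mT ?inE ?eqxx ?orbT //.
  by move: U; rewrite !inE !negb_or => /and4P[/and3P[-> -> _] /andP[-> _] _ _].
move: (U3); rewrite /= !inE !negb_or => /and3P[/andP[ij ik] jk _].
have := @star_rank _ _ w v i j k B (rspan w (Cg W)) (nv i iW) (nv j jW) (nv k kW) B0 BA (eA i iW) (eA j jW) (eA k kW).
have := nv i iW; have := nv j jW; have := nv k kW => vk vj vi.
have bn p' q' : v != p' -> v != q' -> p' != q' -> br w v p' q' != 0.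
  by move=> *; apply: (br_neq0 gw); rewrite /= !inE negb_or; apply/and3P; split=> //; apply/andP.
rewrite !bn // => /(_ isT isT isT); rewrite Wp; move: H; rewrite -/B.
by move: (\rank _) (\rank _) => r1 r2; clear; lia.
Qed.

(** With [i = j] it counts the members through [i], so one function gives both [d_e] and [d_v]. *)
Definition codegree (Q : {set {set 'I_n}}) i j := #|[set X in Q | (i \in X) && (j \in X)]|.

Lemma sum_card_set (I : finType) (Q : {set {set 'I_n}}) (A : {set I}) (g : {set 'I_n} -> {pred I}) :
  (\sum_(X in Q) #|[set t in A | g X t]| = \sum_(t in A) #|[set X in Q | g X t]|)%N.
Proof.
have E1 X : (#|[set t in A | g X t]| = \sum_(t in A) g X t)%N.
  by rewrite -sum1_card big_mkcond [RHS]big_mkcond; apply: eq_bigr => t _; rewrite inE; case: (t \in A); case: (g X t).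
have E2 t : (#|[set X in Q | g X t]| = \sum_(X in Q) g X t)%N.
  by rewrite -sum1_card big_mkcond [RHS]big_mkcond; apply: eq_bigr => X _; rewrite inE; case: (X \in Q); case: (g X t).
by under eq_bigr do rewrite E1; under [RHS]eq_bigr do rewrite E2; rewrite exchange_big.
Qed.

Definition clique_rel (Q : {set {set 'I_n}}) := (\sum_(X in Q) (Fe (Cg X) :&: kermx (fomap w)))%MS.

(** What [relation_cliques] needs of [Q]: the relation of each [K5] in the closed set then belongs
    to [clique_rel Q]. *)
Definition covers5 (U : 'M[R]_(n * 3)) (Q : {set {set 'I_n}}) : Prop :=
  forall a b c d f, uniq [:: a; b; c; d; f] ->
    {in [:: a; b; c; d; f] &, forall i j, (erow w i j <= U)%MS} ->
    exists2 X, X \in Q & {subset [:: a; b; c; d; f] <= X}.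

Lemma relation_cliques U Q D : covers5 U Q -> (rspan w D <= U)%MS ->
  (Fe D :&: kermx (fomap w) <= clique_rel Q)%MS.
Proof.
move=> HQ DU.
have GA : clique_rel Q *m fomap w = 0 by apply/sub_kermxP/sumsmx_subP => X _; exact: capmxSr.
have GK5 a b c d f : uniq [:: a; b; c; d; f] ->
    {in [:: a; b; c; d; f] &, forall i j, (erow w i j <= U)%MS} -> (K5comb w fe a b c d f <= clique_rel Q)%MS.
  move=> U5 /(HQ _ _ _ _ _ U5)[X XQ sX]; apply: (sumsmx_sup X) => //.
  have foX i j : i \in [:: a; b; c; d; f] -> j \in [:: a; b; c; d; f] -> (fe i j <= Fe (Cg X))%MS.
    by move=> /sX iX /sX jX; apply: fo_Fs; rewrite inE /= iX jX.
  rewrite sub_capmx; apply/andP; split; last first.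
    apply/sub_kermxP; rewrite /K5comb !mulmxDl -!scalemxAl !fomapE; exact: K5_er.
  by rewrite /K5comb; repeat apply: addmx_sub; apply: scalemx_sub; apply: foX; rewrite !inE eqxx ?orbT.
apply/rV_subP => x; rewrite sub_capmx => /andP[xD /sub_kermxP x0].
apply: (relation_span gw GK5 GA (W := setT) _ DU xD x0).
by apply/subsetP => e _; rewrite !inE.
Qed.

(** The relations on [D] have dimension at most the sum of those on the members [X], each of which
    has [#|E(X)| - (3 #|X| - 6)]. The codegree terms correct for edges counted several times. *)
Lemma rank_union (Q : {set {set 'I_n}}) (D := \bigcup_(X in Q) Cg X) :
  {in Q, forall X, (3 <= #|X|)%N} -> covers5 (rspan w D) Q ->
  (3 * \sum_(X in Q) #|X| <= \rank (rspan w D) + \sum_(e in EKn n) (codegree Q e.1 e.2).-1 + 6 * #|Q|)%N.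
Proof.
move=> Q3 HQ; pose A := fomap w; pose G := clique_rel Q.
have rel : (Fe D :&: kermx A <= G)%MS := relation_cliques HQ (submx_refl _).
have rD : (#|D :&: EKn n| <= \rank (rspan w D) + \rank G)%N.
  apply: leq_trans (rank_Fs_ge D) _; rewrite -(mxrank_mul_ker (Fe D) A) Fs_map leq_add2l.
  exact: mxrankS.
have rG : (\rank G <= \sum_(X in Q) \rank (Fe (Cg X) :&: kermx A)%MS)%N.
  exact: mxrank_sum_leqif.
have rX X : X \in Q -> (\rank (Fe (Cg X) :&: kermx A)%MS + #|X| * 3 <= #|Cg X :&: EKn n| + 6)%N.
  move=> XQ; have := rank_complete_geq (Q3 X XQ); have := rank_Fs_complete X.
  rewrite -(mxrank_mul_ker (Fe (Cg X)) A) Fs_map.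
  by move: (\rank _) (\rank _) #|_| #|_| => r1 r2 c1 c2; clear; lia.
have sumX : (\sum_(X in Q) (\rank (Fe (Cg X) :&: kermx A)%MS + #|X| * 3)
    <= \sum_(X in Q) (#|Cg X :&: EKn n| + 6))%N by apply: leq_sum.
rewrite !big_split /= sum_nat_const in sumX.
have CE : (\sum_(X in Q) #|Cg X :&: EKn n| = \sum_(e in EKn n) codegree Q e.1 e.2)%N.
  rewrite -(sum_card_set Q (EKn n) (fun X e => (e.1 \in X) && (e.2 \in X))).
  by apply: eq_bigr => X _; apply: eq_card => e; rewrite !inE andbC.
(* The truncated [.-1] is 0 also for edges in no member, as it should be. *)
have DE : (#|D :&: EKn n| + \sum_(e in EKn n) (codegree Q e.1 e.2).-1 = \sum_(e in EKn n) codegree Q e.1 e.2)%N.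
  have -> : (#|D :&: EKn n| = \sum_(e in EKn n) (0 < codegree Q e.1 e.2))%N.
    rewrite -sum1_card [LHS]big_mkcond [RHS]big_mkcond; apply: eq_bigr => e _; rewrite inE andbC.
    case: (e \in EKn n) => //=; rewrite card_gt0.
    have -> : (e \in D) = ([set X in Q | (e.1 \in X) && (e.2 \in X)] != set0).
      apply/bigcupP/set0Pn => [[X XQ]|[X]]; rewrite inE; first by exists X; rewrite inE XQ.
      by case/andP=> XQ eX; exists X; rewrite ?inE.
    by case: (_ != _).
  by rewrite -big_split /=; apply: eq_bigr => e _; case: (codegree _ _ _).
move: CE DE rD rG sumX; rewrite -big_distrl /=.
have arith p1 p2 p3 p4 p5 p6 p7 p8 p9 : p1 = p2 -> (p3 + p4 = p2)%N -> (p3 <= p5 + p6)%N ->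
    (p6 <= p7)%N -> (p7 + p8 * 3 <= p1 + p9 * 6)%N -> (3 * p8 <= p5 + p4 + 6 * p9)%N by clear; lia.
exact: arith.
Qed.
End Counting.

(** * Maximal cliques of the closure *)

Section Cliques.
Variables (R : realFieldType) (n : nat) (w : 'I_(n + n) -> R).
Hypothesis gw : alg_indep_Q w.
Variable (F : {set 'I_n * 'I_n}).
Implicit Types (i j k l m v a b c d f : 'I_n) (T W X Y : {set 'I_n}) (S C D : {set 'I_n * 'I_n}).

Notation U := (rspan w F).
Notation Cg X := (setX X X).

Definition clique X : bool := [forall i in X, forall j in X, (erow w i j <= U)%MS].

Lemma cliqueP X : reflect {in X &, forall i j, (erow w i j <= U)%MS} (clique X).
Proof.
apply: (iffP forall_inP) => [H i j iX jX|H i iX]; first exact: (forall_inP (H i iX)).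
by apply/forall_inP => j jX; apply: H.
Qed.

Lemma clique_Sp X : clique X = (rspan w (Cg X) <= U)%MS.
Proof.
apply/cliqueP/idP => [H|H i j iX jX]; last by apply: submx_trans H; exact: er_Sp_setX.
by apply: SpP => i j; rewrite inE => /andP[/= iX jX]; exact: H.
Qed.

(** Three edges from [x] to [Y] add rank 3, all that the complete graph on [x] and [Y] can add, so
    the two spans agree. *)
Lemma clique_cone Y x i j k : clique Y -> x \notin Y -> uniq [:: i; j; k] ->
  i \in Y -> j \in Y -> k \in Y ->
  (erow w x i <= U)%MS -> (erow w x j <= U)%MS -> (erow w x k <= U)%MS -> clique (x |: Y).
Proof.
move=> cY xY U3 iY jY kY xi xj xk.
have nx t : t \in Y -> x != t by move=> tY; apply: contraNneq xY => ->.
pose B := rspan w (Cg Y); pose A := (B + (<<erow w x i>> + <<erow w x j>> + <<erow w x k>>))%MS.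
have B0 : B *m blk R x = 0.
  apply: Sp_blk0 => p q; rewrite inE /= => /andP[/nx px /nx qx].
  by rewrite !(eq_sym _ x) px qx.
have AU : (A <= U)%MS by rewrite !addsmx_sub !genmxE xi xj xk -clique_Sp cY.
have eA t : (erow w x t <= <<erow w x i>> + <<erow w x j>> + <<erow w x k>>)%MS -> (erow w x t <= A)%MS.
  by move/submx_trans; apply; exact: addsmxSr.
have xiA : (erow w x i <= A)%MS by rewrite eA // -addsmxA (submx_trans _ (addsmxSl _ _)) ?genmxE.
have xjA : (erow w x j <= A)%MS.
  by rewrite eA // (submx_trans _ (addsmxSl _ _)) // (submx_trans _ (addsmxSr _ _)) ?genmxE.
have xkA : (erow w x k <= A)%MS by rewrite eA // (submx_trans _ (addsmxSr _ _)) ?genmxE.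
move: (U3); rewrite /= !inE !negb_or => /and3P[/andP[ij ik] jk _].
have bn p q : p \in Y -> q \in Y -> p != q -> br w x p q != 0.
  by move=> /nx xp /nx xq pq; apply: (br_neq0 gw); rewrite /= !inE negb_or xp xq pq.
have rA := star_rank (nx i iY) (nx j jY) (nx k kY) B0 (addsmxSl _ _ : (B <= A)%MS) xiA xjA xkA
  (bn i j iY jY ij) (bn i k iY kY ik) (bn j k jY kY jk).
have rW := rank_complete_step gw (setU11 x Y).
rewrite (setU1K xY) -/B in rW.
have AW : (A <= rspan w (Cg (x |: Y)))%MS.
  by rewrite !addsmx_sub !genmxE !er_Sp_setX ?SpS ?setXS ?subsetUr ?setU11 // setU1r.
rewrite clique_Sp; apply: submx_trans AU.
by have := mxrank_leqif_sup AW => /geq_leqif <-; exact: leq_trans rW rA.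
Qed.

Definition max_cliques : {set {set 'I_n}} := [set X | maxset clique X & (5 <= #|X|)%N].

Lemma max_cliques_clique X : X \in max_cliques -> clique X.
Proof. by rewrite inE => /andP[/maxsetP[]]. Qed.

Lemma max_cliques_max X Y : X \in max_cliques -> clique Y -> X \subset Y -> Y = X.
Proof. by rewrite inE => /andP[/maxsetP[_ H] _]; exact: H. Qed.

Lemma max_cliques_card X : X \in max_cliques -> (5 <= #|X|)%N.
Proof. by rewrite inE => /andP[]. Qed.

Lemma clique_extend Z : clique Z -> (5 <= #|Z|)%N -> exists2 X, X \in max_cliques & Z \subset X.
Proof.
move=> cZ Z5; have [X maxX ZX] := maxset_exists cZ.
by exists X => //; rewrite inE maxX (leq_trans Z5 (subset_leq_card ZX)).
Qed.

(** With three shared vertices, [clique_cone] would allow each vertex of [X] to be added to [Y]. *)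
Lemma max_cliques_inter X Y : X \in max_cliques -> Y \in max_cliques -> X != Y -> (#|X :&: Y| <= 2)%N.
Proof.
move=> XP YP; apply: contraNT; rewrite -ltnNge cardE => XY3.
have [i [j [k [U3 iXY jXY kXY]]]] : exists i j k, [/\ uniq [:: i; j; k], i \in X :&: Y, j \in X :&: Y & k \in X :&: Y].
  move: XY3; have := enum_uniq (X :&: Y); have := mem_enum (X :&: Y).
  case: (enum _) => [|i [|j [|k s]]] //= mT V _; exists i, j, k.
  split; rewrite -?mT ?inE ?eqxx ?orbT //.
  by move: V; rewrite !inE !negb_or => /and4P[/and3P[-> -> _] /andP[-> _] _ _].
move: iXY jXY kXY; rewrite !inE => /andP[iX iY] /andP[jX jY] /andP[kX kY].
suff XY : X \subset Y by rewrite (max_cliques_max XP (max_cliques_clique YP) XY).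
apply/subsetP => x xX; apply: contraT => xY.
have cX := cliqueP _ (max_cliques_clique XP).
have cxY : clique (x |: Y) by apply: (@clique_cone Y x i j k); rewrite ?max_cliques_clique ?cX.
by move: xY; rewrite -(max_cliques_max YP cxY (subsetUr _ _)) setU11.
Qed.

Lemma max_cliques_covers5 V : (V <= U)%MS -> covers5 w V max_cliques.
Proof.
move=> VU a b c d f U5 H.
have [X XP sX] : exists2 X, X \in max_cliques & [set:: [:: a; b; c; d; f]] \subset X.
  apply: clique_extend; last by rewrite cardsE (card_uniqP U5).
  by apply/cliqueP => i j; rewrite !inE => iS jS; apply: submx_trans VU; apply: H; rewrite !inE.
by exists X => // t tS; apply: (subsetP sX); rewrite inE.
Qed.

(** The relation expressing this edge by the rest of [C] has coefficient 1 at [ij], and is a sum of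
    relations supported on cliques. *)
Lemma circuit_covered i j C : (i, j) \in C -> C \subset F -> C \subset EKn n ->
  (erow w i j <= rspan w (C :\ (i, j)))%MS -> exists X, [/\ X \in max_cliques, i \in X & j \in X].
Proof.
move=> eC CF CE; rewrite -Fs_map => /submxP[u uE].
have ij : (i < j)%N by have := subsetP CE _ eC; rewrite inE.
pose y := fedge R i j - u *m fspan R (C :\ (i, j)).
have yC : (y <= fspan R C)%MS.
  rewrite addmx_sub ?eqmx_opp ?(submx_trans (submxMl _ _)) ?Fs_sub ?subD1set //.
  by apply: fo_Fs; rewrite eC.
have y0 : y *m fomap w = 0 by rewrite mulmxBl fomapE -mulmxA -uE subrr.
have : (y <= clique_rel w max_cliques)%MS.
  apply: submx_trans (relation_cliques gw (max_cliques_covers5 (submx_refl _)) (SpS w CF)).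
  by rewrite sub_capmx yC; apply/sub_kermxP.
pose D := \bigcup_(X in max_cliques) Cg X.
have GD : (clique_rel w max_cliques <= fspan R D)%MS.
  apply/sumsmx_subP => X XP; apply: submx_trans (capmxSl _ _) _; apply: Fs_sub.
  exact: (@bigcup_sup _ _ X (fun Y => Y \in max_cliques) (fun Y => Cg Y) XP).
move=> /submx_trans/(_ GD) yD.
have y1 : y 0 (enum_rank (i, j)) = 1.
  have u0 : (u *m fspan R (C :\ (i, j))) 0 (enum_rank (i, j)) = 0.
    apply: (Fs_coord (S := C :\ (i, j)) ij); rewrite ?submxMl ?inE ?eqxx // negb_and orbC.
    by apply/orP; left; apply/negP => /(subsetP CE); rewrite inE /edgeKn /= ltnNge ltnW.
  by rewrite mxE [X in _ + X]mxE u0 subr0 /fedge ij mxE !eqxx.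
have [ijD|ijD] := boolP ((i, j) \in D).
  by case/bigcupP: ijD => X XP; rewrite inE => /andP[/= iX jX]; exists X.
have jiD : (j, i) \notin D.
  apply: contra ijD => /bigcupP[X XP]; rewrite inE => /andP[/= jX iX].
  by apply/bigcupP; exists X; rewrite // inE /= iX.
by move: y1; rewrite (Fs_coord ij ijD jiD yD) => /eqP; rewrite eq_sym oner_eq0.
Qed.

Notation dP := (codegree max_cliques).

Definition excess v : nat := \sum_(u | u != v) (dP v u).-1.

Lemma degeC (Q : {set {set 'I_n}}) i j : codegree Q i j = codegree Q j i.
Proof. by rewrite /codegree; apply: eq_card => X; rewrite !inE [(i \in X) && _]andbC. Qed.

Lemma sum_ordered (g : 'I_n -> 'I_n -> nat) : (forall i j, g i j = g j i) ->
  (\sum_v \sum_(u | u != v) g v u = 2 * \sum_(e in EKn n) g e.1 e.2)%N.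
Proof.
move=> gC; have E : (\sum_(e in EKn n) g e.1 e.2 = \sum_(v : 'I_n) \sum_(u : 'I_n | (v < u)%N) g v u)%N.
  by rewrite pair_big_dep /=; apply: eq_bigl => e; rewrite inE.
rewrite E mul2n -addnn; rewrite [X in (_ = _ + X)%N](exchange_big_dep predT) //= -big_split /=.
apply: eq_bigr => v _; rewrite (bigID (fun u : 'I_n => (v < u)%N)) /=; congr (_ + _)%N.
  by apply: eq_bigl => u; apply: andb_idl => vu; apply: contraTneq vu => ->; rewrite ltnn.
rewrite [RHS](eq_bigr (fun u => g v u)) => [|u _]; last exact: gC.
by apply: eq_bigl => u; rewrite -leqNgt ltn_neqAle (inj_eq val_inj).
Qed.

(** [rank_union] for the cliques through [v], with union [V]: their sizes add up to
    [d_v + (#|V| - 1) + excess v], the rank is at most [3 #|V| - 6], and only edges at [v] lie in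
    more than one of them. *)
Lemma star_excess_bound v : (0 < dP v v)%N -> (2 * excess v + 3 <= 3 * dP v v)%N.
Proof.
pose Q := [set X in max_cliques | v \in X]; pose D := \bigcup_(X in Q) Cg X.
have cQ : #|Q| = dP v v by apply: eq_card => X; rewrite !inE andbb.
have QP X : X \in Q -> X \in max_cliques by rewrite inE => /andP[].
have vQ X : X \in Q -> v \in X by rewrite inE => /andP[].
move=> d0; have DU : (rspan w D <= U)%MS.
  apply: SpP => i j /bigcupP[X /QP XP]; rewrite inE => /andP[/= iX jX].
  exact: (cliqueP _ (max_cliques_clique XP)).
pose V := cover Q.
have DV : D \subset Cg V.
  apply/bigcupsP => X XQ; apply/subsetP => -[i j]; rewrite !inE => /andP[/= iX jX].
  by apply/andP; split; apply/bigcupP; exists X.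
have vV t : t \in V -> (erow w v t <= rspan w D)%MS.
  case/bigcupP=> X XQ tX; apply: er_Sp; apply/orP; left; apply/bigcupP; exists X => //.
  by rewrite inE /= vQ.
(* A vertex outside [V] has no edge in [D], so no vector of the span has a load there. *)
have notV t s : t != s -> (erow w t s <= rspan w D)%MS -> t \in V.
  move=> ts tsD; apply: contraT => tV.
  have D0 : rspan w D *m blk R t = 0.
    apply: Sp_blk0 => i j /(subsetP DV); rewrite inE => /andP[/= iV jV].
    by apply/andP; split; apply: contraNneq tV => <-.
  have := submxMr (blk R t) tsD; rewrite D0 er_blk eqxx => /submxP[z]; rewrite mulmx0 => /eqP.
  by rewrite (negPf (dv_neq0 gw ts)).
(* Five vertices spanned by [D] lie in [V], hence are joined to [v] in the closure; with [v] they
   extend to a maximal clique, which passes through [v]. *)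
have HQ : covers5 w (rspan w D) Q.
  move=> a b c d f U5 H; pose s := [:: a; b; c; d; f].
  have sV t : t \in s -> t \in V.
    move=> ts; have [t' t's tt'] : exists2 t', t' \in s & t != t'.
      have [ta|ta] := eqVneq t a; last by exists a; rewrite ?inE ?eqxx.
      exists b; first by rewrite !inE eqxx orbT.
      by move: U5; rewrite ta /= !inE !negb_or => /and5P[/and4P[]].
    by apply: (notV t t') => //; apply: H.
  have cZ : clique (v |: [set:: s]).
    have sU t t' : t \in s -> t' \in s -> (erow w t t' <= U)%MS.
      by move=> ts t's; apply: submx_trans DU; apply: H.
    have vU t : t \in s -> (erow w v t <= U)%MS by move=> /sV/vV/submx_trans; apply.
    apply/cliqueP => i j; rewrite !in_setU1 !in_set => /predU1P[->|iS] /predU1P[->|jS].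
    - by rewrite erii sub0mx.
    - exact: vU.
    - by rewrite erN eqmx_opp vU.
    - exact: sU.
  have [X XP sX] : exists2 X, X \in max_cliques & v |: [set:: s] \subset X.
    apply: clique_extend => //; apply: leq_trans (subset_leq_card (subsetUr [set v] _)).
    by rewrite cardsE (card_uniqP U5).
  exists X; first by rewrite inE XP (subsetP sX) // setU11.
  by move=> t ts; apply: (subsetP sX); rewrite in_setU1 in_set ts orbT.
have Q3 : {in Q, forall X, (3 <= #|X|)%N} by move=> X /QP/max_cliques_card; apply: leq_trans.
have := rank_union gw Q3 HQ; rewrite -/D cQ.
have -> : (\sum_(X in Q) #|X| = \sum_u dP v u)%N.
  rewrite (eq_bigr (fun X => #|[set t in setT | t \in X]|)) => [|X _]; last first.
    by apply: eq_card => t; rewrite !inE.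
  rewrite (sum_card_set Q setT (fun X t => t \in X)); apply: eq_big => [t|t _]; rewrite ?inE //.
  by apply: eq_card => X; rewrite !inE andbA.
have V1 : (#|V| <= 1 + \sum_(u | u != v) (0 < dP v u))%N.
  have -> : (\sum_(u | u != v) (0 < dP v u) = #|[set u | (u != v) && (0 < dP v u)]|)%N.
    by rewrite -sum1_card -big_mkcondr /=; apply: eq_bigl => u; rewrite inE.
  have := leq_card_setU [set v] [set u | (u != v) && (0 < dP v u)%N]; rewrite cards1; apply: leq_trans.
  apply: subset_leq_card; apply/subsetP => u /bigcupP[X XQ uX]; rewrite !inE.
  case: eqVneq => //= _; rewrite card_gt0; apply/set0Pn; exists X.
  by rewrite inE (QP _ XQ) vQ.
have V3 : (3 <= #|V|)%N.
  have /card_gt0P[X XQ] : (0 < #|Q|)%N by rewrite cQ.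
  by apply: leq_trans (Q3 X XQ) (subset_leq_card _); exact: (@bigcup_sup _ _ X (fun Y => Y \in Q) (fun Y => Y) XQ).
have rV : (\rank (rspan w D) + 6 <= 3 * #|V|)%N.
  by apply: leq_trans (rank_complete_leq gw V3); rewrite leq_add2r; apply/mxrankS/SpS.
have dQ u : codegree Q v u = dP v u.
  by apply: eq_card => X; rewrite !inE; case: (v \in X); rewrite ?andbF ?andbT.
have eQ : (\sum_(e in EKn n) (codegree Q e.1 e.2).-1 = excess v)%N.
  apply/eqP; rewrite -(eqn_pmul2l (m := 2)) //.
  rewrite -(sum_ordered (g := fun i j => (codegree Q i j).-1)) => [|i j]; last by rewrite degeC.
  have small p q : p != v -> q != v -> p != q -> (codegree Q p q).-1 = 0%N.
    move=> pv qv pq; apply/eqP; rewrite -leqn0 -ltnS.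
    have : (codegree Q p q <= 1)%N; last by case: (codegree Q p q) => [|[]].
    rewrite leqNgt; apply/negP => /card_gt1P[X [Y []]].
    rewrite in_set => /andP[/[dup] /QP XP /vQ vX /andP[pX qX]].
    rewrite in_set => /andP[/[dup] /QP YP /vQ vY /andP[pY qY]] XY; have := max_cliques_inter XP YP XY; apply/negP; rewrite -ltnNge.
    apply: (@leq_trans #|[set v; p; q]|).
      by rewrite -setUA !cardsU1 cards1 !inE negb_or !(eq_sym v) pv qv pq.
    by apply: subset_leq_card; apply/subsetP => t; rewrite !inE -orbA => /or3P[]/eqP->; apply/andP.
  rewrite (bigD1 v) //= mul2n -addnn; apply/eqP; congr (_ + _)%N.
    by apply: eq_bigr => u _; rewrite dQ.
  apply: eq_bigr => p pv; rewrite (bigD1 v) 1?eq_sym //= degeC dQ big1 ?addn0 // => q /andP[qp qv].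
  by rewrite small // eq_sym.
rewrite eQ (bigD1 v) //=.
have -> : (\sum_(u | u != v) dP v u = \sum_(u | u != v) (0 < dP v u) + excess v)%N.
  by rewrite -big_split /=; apply: eq_bigr => u _; case: (dP v u).
move: V1 rV.
have arith p1 p2 p3 p4 p5 : (p1 <= 1 + p2)%N -> (p3 + 6 <= 3 * p1)%N ->
  (3 * (p4 + (p2 + p5)) <= p3 + p5 + 6 * p4)%N -> (2 * p5 + 3 <= 3 * p4)%N by clear; lia.
exact: arith.
Qed.
End Cliques.

(** * Back to the matroid of the statement *)

Section Bridge.
Variables (R : realFieldType) (n : nat) (x y : 'I_n -> R).
Implicit Types (S C : {set 'I_n * 'I_n}).

Lemma cof_row_coords e : cof_row x y e = erow (coords x y) e.1 e.2.
Proof.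
have pxE i : px (coords x y) i = x i.
  by rewrite /px /coords; case: splitP => j /= E; [congr x; apply: val_inj | have := ltn_ord i; rewrite E ltnNge leq_addr].
have pyE i : py (coords x y) i = y i.
  rewrite /py /coords; case: splitP => j /= E; last by congr y; apply: val_inj; apply: (@addnI n).
  by have := ltn_ord j; rewrite -E ltnNge leq_addr.
congr mxvec; apply/matrixP => v k; rewrite !mxE /= /Dvec !pxE !pyE.
by [].
Qed.

Lemma cof_rankE S : cof_rank x y S = \rank (rspan (coords x y) S).
Proof. by rewrite /cof_rank; congr (\rank _); apply: eq_bigr => e _; rewrite cof_row_coords. Qed.

(** Otherwise adding [e] to the independent set [C] minus [e] would make [C] independent. *)
Lemma circuit_edge C e : cof_circuit x y C -> e \in C ->
  (erow (coords x y) e.1 e.2 <= rspan (coords x y) (C :\ e))%MS.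
Proof.
move=> [CE [nC minC]] eC; have [_] := minC _ (properD1 eC); rewrite cof_rankE => rC.
apply: contraT => eN; case: nC; split=> //; rewrite cof_rankE.
by rewrite (SpD1 _ eC) rank_add_row eN rC addn1 [RHS](cardsD1 e) eC.
Qed.
End Bridge.

Theorem theorem7p1 (R : realFieldType) (n : nat) (x y : 'I_n -> R)
  (Hgen : alg_indep_Q (coords x y)) (F : {set 'I_n * 'I_n})
  (HF : F \subset EKn n) (Hconn : k_connected 5 F) (Hcyc : cof_cyclic x y F) :
  cof_spans x y F.
Proof.
pose w := coords x y; pose U := rspan w F; pose P := max_cliques w F; pose d v := codegree P v v.
have [n6 conn] := Hconn.
have cov i j : adj F i j -> exists X, [/\ X \in P, i \in X & j \in X].
  have cov1 p q : (p, q) \in F -> exists X, [/\ X \in P, p \in X & q \in X].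
    case: Hcyc => Cs [Cc FE]; rewrite -{1}FE => /bigcupP[C CP eC].
    apply: (circuit_covered Hgen eC); last exact: (circuit_edge (Cc C CP) eC).
      by rewrite -FE; exact: (@bigcup_sup _ _ C (fun D => D \in Cs) (fun D => D) CP).
    by case: (Cc C CP).
  by case/orP => /cov1[X [XP iX jX]]; exists X.
rewrite /cof_spans !cof_rankE.
have [cT|ncT] := boolP (clique w F setT).
  apply/eqP; rewrite eqn_leq mxrankS ?SpS //= mxrankS //.
  by apply: SpP => i j _; apply: (cliqueP _ _ _ cT).
have XT X : X \in P -> X != setT by move=> XP; apply: contraNneq ncT => <-; exact: max_cliques_clique XP.
have d1 v : (0 < d v)%N.
  have [u uv] : exists u, u != v.
    have : (0 < #|[set~ v]|)%N by rewrite cardsC1 card_ord; case: n n6 {x y Hgen F HF Hconn Hcyc w U P d conn cov ncT XT v} => [|[]].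
    by case/card_gt0P=> u; rewrite !inE => uv; exists u.
  have := conn set0 _ v u; rewrite cards0 !inE => /(_ isT isT isT)/connectP[[|t p] /=].
    by move=> _ E; rewrite E eqxx in uv.
  move=> /andP[/and3P[_ _ /cov[X [XP vX _]]] _] _; rewrite card_gt0; apply/set0Pn.
  by exists X; rewrite in_set XP vX.
pose B := [set v | (1 < d v)%N].
(* Delete the vertices of [X] that lie in a second clique. If they are fewer than 5 the rest stays
   connected, yet a path starting in [X] cannot leave it: at a vertex with [d = 1] the clique of the
   next edge is [X] again. *)
have bd X : X \in P -> (5 <= #|[set v in B | v \in X]|)%N.
  move=> XP; rewrite leqNgt; apply/negP => small; set S := [set v in B | v \in X] in small.
  have [t tX] : exists t, t \notin X.
    by have := XT X XP; rewrite -subTset => /subsetPn[t _ tX]; exists t.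
  have [u /setDP[uX uS]] : exists u, u \in X :\: S.
    apply/set0Pn; rewrite -card_gt0 cardsD subn_gt0; apply: leq_ltn_trans (subset_leq_card (subsetIr _ _)) _.
    exact: leq_trans small (max_cliques_card XP).
  have tS : t \notin S by rewrite inE (negPf tX) andbF.
  have /connectP[p] := conn S small u t uS tS.
  elim: p u uX {uS} => [|s p IHp] u uX /=; first by move=> _ tu; rewrite tu uX in tX.
  case/andP=> /and3P[uS sS /cov[Y [YP uY sY]]] pp; apply: IHp => //.
  apply: contraNT uS => sX; rewrite !in_set uX andbT.
  apply/card_gt1P; exists X, Y; split; first by rewrite in_set XP uX.
    by rewrite in_set YP uY.
  by apply: contraNneq sX => ->.
have Q3 : {in P, forall X : {set 'I_n}, (3 <= #|X|)%N} by move=> X /max_cliques_card; apply: leq_trans.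
pose D := \bigcup_(X in P) setX X X.
have DU : (rspan w D <= U)%MS.
  by apply: SpP => i j /bigcupP[X XP]; rewrite inE => /andP[/= iX jX]; apply: (cliqueP _ _ _ (max_cliques_clique XP)).
have tot := rank_union Hgen Q3 (max_cliques_covers5 DU); rewrite -/D in tot.
have rD : (\rank (rspan w D) + 6 <= 3 * n)%N.
  have nT : #|[set: 'I_n]| = n by rewrite cardsT card_ord.
  have n3 : (3 <= #|[set: 'I_n]|)%N by rewrite nT (leq_trans _ n6).
  have := rank_complete_leq Hgen n3; rewrite nT; apply: leq_trans; rewrite leq_add2r.
  by apply/mxrankS/SpS/subsetP => e _; rewrite !inE.
have sX : (\sum_(X in P) #|X| = \sum_v d v)%N.
  rewrite (eq_bigr (fun X : {set 'I_n} => #|[set t in setT | t \in X]|)) => [|X _]; last first.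
    by apply: eq_card => t; rewrite !inE.
  rewrite (sum_card_set P setT (fun X t => t \in X)); apply: eq_big => [t|t _]; rewrite ?inE //.
  by apply: eq_card => X; rewrite !inE andbb.
have sB : (5 * #|P| <= \sum_(v in B) d v)%N.
  have <- : (\sum_(X in P) #|[set v in B | v \in X]| = \sum_(v in B) d v)%N.
    rewrite (sum_card_set P B (fun X t => t \in X)); apply: eq_bigr => v _.
    by apply: eq_card => X; rewrite !inE andbb.
  by rewrite mulnC -sum_nat_const; apply: leq_sum => X /bd.
have sE := sum_ordered (g := fun i j => (codegree P i j).-1) (fun i j => congr1 predn (degeC P i j)).
(* The total count is multiplied by 20: [120 #|P|] is at most 24 times the sum of [d] over [B], and
   each edge is seen from both ends, which gives 10. Equality holds for [d v = 1], with excess 0.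
   For [d v = 2] the excess bound 3/2 must be rounded down to 1: 48 + 10 + 60 is at most 120. *)
have loc v : (24 * (if v \in B then d v else 0) + 10 * excess w F v + 60 <= 60 * d v)%N.
  have := star_excess_bound Hgen (d1 v); have := d1 v; rewrite -/(d v) inE.
  by move: (d v) (excess _ _ _) => p q; clear; case: ifP; lia.
have : (\sum_v (excess w F v * 10 + (if v \in B then d v else 0) * 24 + 60)
   <= \sum_v (d v * 60))%N by apply: leq_sum => v _; have := loc v; lia.
rewrite !big_split /= -!big_distrl /= -big_mkcond.
rewrite sum_nat_const card_ord /excess sE.
move: tot rD sB; rewrite sX.
(* The 6 of the rank bound, taken 20 times, is the surplus that gives the contradiction. *)
have arith p1 p2 p3 p4 p5 q : (3 * p1 <= p2 + p3 + 6 * p4)%N -> (p2 + 6 <= 3 * q)%N ->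
   (5 * p4 <= p5)%N -> (2 * p3 * 10 + p5 * 24 + q * 60 <= p1 * 60)%N -> False by clear; lia.
by move=> t1 t2 t3 t4; case: (arith _ _ _ _ _ _ t1 t2 t3 t4).
Qed.
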